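(* Let $\mathcal{H}_0$ be a separable Hilbert space and $\mathcal{G}_0$ be a finite-dimensional (Hilbert) space. Let $X=(X_t)_{t\in\mathbb{Z}}$ be a process defined on $(\Omega,\mathcal{F},\mathbb{P})$ and valued in $\mathcal{H}_0$ which is stationary and ergodic, and which is weakly stationary. Let $(\Theta,\Delta)$ be a compact metric space and let $L$ and $R$ be in $\mathcal{C}(\Theta\times\mathbb{T},\mathcal{L}_b(\mathcal{H}_0,\mathcal{G}_0))$. Then $$\lim_{n\to\infty}\tilde{\mathcal{Q}}^{(L,R)}_{I_n^{X^c_n}}=\tilde{\mathcal{Q}}^{(L,R)}_{\nu_X}\quad\text{uniformly in }\mathcal{C}(\Theta,\mathcal{S}_1(\mathcal{G}_0)),\quad\mathbb{P}\text{-a.s.}$$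
   Context: Hilbert spaces are complex. $\mathcal{L}_b(\mathcal{H}_0,\mathcal{G}_0)$: bounded operators with the operator norm; $\mathcal{S}_1$: trace-class operators with trace norm $\|\cdot\|_1$; $\mathcal{S}_1^+$: positive semidefinite ones; $\mathrm{P}^{\mathsf{H}}$: adjoint; $x\otimes y:z\mapsto\langle z,y\rangle x$; $\mathbb{T}=\mathbb{R}/2\pi\mathbb{Z}$; $\mathrm{Leb}_{\mathbb{T}}$ is Lebesgue measure on $\mathbb{T}$ divided by $2\pi$. $\mathcal{C}(\mathcal{E}_1,\mathcal{E}_2)$ is the set of continuous functions between metric spaces, and $F_n\to F$ uniformly in $\mathcal{C}(\mathcal{E}_1,\mathcal{E}_2)$ means $\sup_{x\in\mathcal{E}_1}d_2(F_n(x),F(x))\to0$. Stationary means strictly stationary and ergodic refers to the shift on $\mathcal{H}_0^{\mathbb{Z}}$ under the law of $X$. Weakly stationary means $X_t\in L^2(\Omega,\mathcal{F},\mathcal{H}_0,\mathbb{P})$, constant mean (not necessarily zero), and $\mathrm{Cov}(X_{t+h},X_t)=\mathrm{Cov}(X_h,X_0)$, where $\langle\mathrm{Cov}(X,Y)y,x\rangle=\mathrm{Cov}(\langle X,x\rangle,\langle Y,y\rangle)$. The spectral operator measure $\nu_X:\mathcal{B}(\mathbb{T})\to\mathcal{S}_1^+(\mathcal{H}_0)$ is the $\|\cdot\|_1$-$\sigma$-additive measure such that $\mathrm{Cov}(X_h,X_0)=\int e^{ih\lambda}\nu_X(\mathrm{d}\lambda)$ for all $h\in\mathbb{Z}$;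 it has a density $f_X$ with respect to the finite measure $\|\nu_X\|_1:A\mapsto\|\nu_X(A)\|_1$. Centered periodogram: $X^c_{n,k}=X_k-\frac1n\sum_{j=1}^nX_j$, $d_n^{X^c_n}(\lambda)=n^{-1/2}\sum_{k=1}^nX^c_{n,k}e^{-i\lambda k}$, $I_n^{X^c_n}(\lambda)=d_n^{X^c_n}(\lambda)\otimes d_n^{X^c_n}(\lambda)$. Quadratic functionals: for $\theta\in\Theta$, $$\tilde{\mathcal{Q}}^{(L,R)}_{I_n^{X^c_n}}(\theta)=\int L(\theta,\lambda)\,I_n^{X^c_n}(\lambda)\,R(\theta,\lambda)^{\mathsf{H}}\,\mathrm{Leb}_{\mathbb{T}}(\mathrm{d}\lambda),$$ $$\tilde{\mathcal{Q}}^{(L,R)}_{\nu_X}(\theta)=\int L(\theta,\lambda)\,\nu_X(\mathrm{d}\lambda)\,R(\theta,\lambda)^{\mathsf{H}}=\int L(\theta,\lambda)f_X(\lambda)R(\theta,\lambda)^{\mathsf{H}}\,\|\nu_X\|_1(\mathrm{d}\lambda).$$ *)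

(* Defs.v *)
From HB Require Import structures.
From mathcomp Require Import all_boot all_order all_algebra.
From mathcomp Require Import complex.
From mathcomp Require Import all_classical all_reals all_analysis.

Set Implicit Arguments.
Unset Strict Implicit.
Unset Printing Implicit Defensive.

Import Order.TTheory GRing.Theory Num.Theory.
Import numFieldNormedType.Exports.

Local Open Scope classical_set_scope.
Local Open Scope ring_scope.

(* Complex Hilbert spaces: complete normed spaces whose norm comes from an
   inner product, linear in its first argument.  The library norm `|x| of a
   normed module over R[i] is an element of R[i] (a nonnegative real). *)
HB.mixin Record CompleteNormedModule_isHilbert (R : realType) H
    of CompleteNormedModule R[i] H := {
  hdot : {dot H for Num.conj : R[i] -> R[i]} ;
  hdot_normE : forall x : H, hdot x x = `|x| ^+ 2
}.

#[short(type="hilbertType")]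
HB.structure Definition Hilbert (R : realType) :=
  { H of CompleteNormedModule R[i] H & CompleteNormedModule_isHilbert R H }.

Definition separable (T : topologicalType) : Prop :=
  exists2 S : set T, countable S & dense S.

Definition finite_dimensional (K : pzRingType) (V : lmodType K) : Prop :=
  exists n (e : 'I_n -> V), forall x : V,
    exists c : 'I_n -> K, x = \sum_i c i *: e i.

Section operators.
Context {R : realType}.
Implicit Types H G : hilbertType R.

Definition hnorm H (x : H) : R := complex.Re `|x|.

Definition opnorm H G (A : H -> G) : \bar R :=
  ereal_sup [set (hnorm (A x))%:E | x in [set x | hnorm x <= 1]].

Definition bounded_op H G (A : H -> G) : Prop :=
  linear A /\ (opnorm A < +oo)%E.

(* A^H; existence and uniqueness for bounded A is the Riesz representation
   theorem *)
Definition adjoint H G (A : H -> G) : G -> H :=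
  xget 0 [set B : G -> H | forall x y, hdot (A x) y = hdot x (B y)].

(* in the order of R[i], [0 <= z] says that z is real and nonnegative *)
Definition positive_op H (A : H -> H) : Prop := forall x, 0 <= hdot (A x) x.

Definition abs_op H (A S : H -> H) : Prop :=
  [/\ bounded_op S, positive_op S & S \o S = adjoint A \o A].

Definition linear_span H (E : set H) : set H :=
  [set x | exists n (e : 'I_n -> H) (c : 'I_n -> R[i]),
     (forall i, E (e i)) /\ x = \sum_i c i *: e i].

Definition orthonormal_basis H (E : set H) : Prop :=
  [/\ forall e, E e -> hdot e e = 1,
      forall e e', E e -> E e' -> e <> e' -> hdot e e' = 0 &
      dense (linear_span E)].

(* ||A||_1 = Tr |A|.  For a bounded A all choices of S and E give the same
   value, so the infimum is over a singleton; for A not linear and bounded it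
   is over the empty set, and its value is +oo. *)
Definition trace_norm H (A : H -> H) : \bar R :=
  ereal_inf [set t | exists (S : H -> H) (E : set H),
    [/\ bounded_op A, abs_op A S, orthonormal_basis E &
        t = \esum_(e in E) (complex.Re (hdot (S e) e))%:E]].

Definition trace_class H (A : H -> H) : Prop := (trace_norm A < +oo)%E.

Definition tensor H G (x : G) (y : H) : H -> G := fun z => hdot z y *: x.

Definition expi (x : R) : R[i] := (cos x +i* sin x)%C.

End operators.

(* Integration of V-valued functions.  The norm N on (a subspace of) V takes
   values in [0, +oo] and V is restricted to {N < +oo}, so that
   V := H -> H, N := trace_norm gives the Bochner integral in S_1(H).
   A step function is given by a list s of pairs (A, v), for
   \sum_(A, v) \1_A v. *)
Section integration.
Context {R : realType} {d} {T : measurableType d}.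

Definition step (V : lmodType R[i]) (s : seq (set T * V)) (t : T) : V :=
  \sum_(p <- s) (\1_(p.1) t : R[i]) *: p.2.

Definition step_integral (V : lmodType R[i]) (mu : set T -> \bar R)
    (s : seq (set T * V)) : V :=
  \sum_(p <- s) (fine (mu p.1))%:C%C *: p.2.

(* mu is meant to be a finite measure *)
Definition is_bochner_integral (V : lmodType R[i]) (N : V -> \bar R)
    (mu : set T -> \bar R) (F : T -> V) (I : V) : Prop :=
  exists s : nat -> seq (set T * V),
  [/\ forall n p, p \in s n -> measurable p.1 /\ (N p.2 < +oo)%E,
      forall t, N (step (s n) t - F t) @[n --> \oo] --> 0%E,
      (\int[mu]_t N (step (s n) t - F t)%R)%E @[n --> \oo] --> 0%E &
      N (step_integral mu (s n) - I) @[n --> \oo] --> 0%E].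

Definition bochner (V : lmodType R[i]) (N : V -> \bar R)
    (mu : set T -> \bar R) (F : T -> V) : V :=
  xget 0 [set I | is_bochner_integral N mu F I].

(* I is the integral of the bounded function phi against the V-valued
   measure nu *)
Definition is_vector_integral (V : lmodType R[i]) (N : V -> \bar R)
    (nu : set T -> V) (phi : T -> R[i]) (I : V) : Prop :=
  exists s : nat -> seq (set T * R[i]^o),
  [/\ forall n p, p \in s n -> measurable p.1,
      forall e : R, 0 < e -> \forall n \near \oo,
        forall t, complex.Re `|step (s n) t - phi t| < e &
      N (\sum_(p <- s n) p.2 *: nu p.1 - I) @[n --> \oo] --> 0%E].

Definition complex_integral (mu : {measure set T -> \bar R}) (U : T -> R[i]) : R[i] :=
  (Rintegral mu setT (fun t => complex.Re (U t))
   +i* Rintegral mu setT (fun t => complex.Im (U t)))%C.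

End integration.

Section processes.
Context {R : realType} {d} {Om : measurableType d} (P : probability Om R).
Context {H : hilbertType R}.

Definition complex_cov (U V : Om -> R[i]) : R[i] :=
  complex_integral P (fun w =>
    (U w - complex_integral P U) * (V w - complex_integral P V)^*).

Definition cov_op (X Y : Om -> H) : H -> H :=
  xget 0 [set C : H -> H | bounded_op C /\ forall x y,
    hdot (C y) x = complex_cov (fun w => hdot (X w) x) (fun w => hdot (Y w) y)].

Definition expectation_vec (X : Om -> H) : H :=
  bochner (fun x : H => (hnorm x)%:E) P X.

Definition process (X : int -> Om -> H) : Prop :=
  forall t (U : set H), open U -> measurable (X t @^-1` U).

Definition path_sigma_algebra : set (set (int -> H)) :=
  <<s [set A | exists t (U : set H), open U /\ A = [set x | U (x t)]] >>.

Definition path_law (X : int -> Om -> H) (B : set (int -> H)) : \bar R :=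
  P [set w | B (fun t => X t w)].

Definition path_shift (x : int -> H) : int -> H := fun t => x (t + 1).

Definition strictly_stationary (X : int -> Om -> H) : Prop :=
  forall B, path_sigma_algebra B ->
    path_law X (path_shift @^-1` B) = path_law X B.

Definition ergodic (X : int -> Om -> H) : Prop :=
  forall B, path_sigma_algebra B -> path_shift @^-1` B = B ->
    path_law X B = 0%E \/ path_law X B = 1%E.

Definition weakly_stationary (X : int -> Om -> H) : Prop :=
  [/\ forall t, (\int[P]_w ((hnorm (X t w)) ^+ 2)%:E < +oo)%E,
      forall t, expectation_vec (X t) = expectation_vec (X 0) &
      forall t h, cov_op (X (t + h)) (X t) = cov_op (X h) (X 0)].

End processes.

(* The torus R/2piZ is represented by its fundamental domain ]-pi, pi]:
   functions on it are 2pi-periodic functions on R, or arbitrary functions on R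
   when they only matter up to their values on ]-pi, pi]; its Borel sets are
   the Borel subsets of ]-pi, pi], and its measures are the measures on R
   concentrated on ]-pi, pi]. *)
Section spectral.
Context {R : realType}.

Definition torus : set R := `]- pi, pi]%classic.

Lemma measurable_torus : measurable torus.
Proof. exact: measurable_itv. Qed.

Lemma inv_2pi_ge0 : 0 <= (2 * pi : R)^-1.
Proof. by rewrite invr_ge0 mulr_ge0 ?pi_ge0. Qed.

Definition Leb_torus : set R -> \bar R :=
  mscale (NngNum inv_2pi_ge0) (mrestr lebesgue_measure measurable_torus).

(* S_1^+(H)-valued measures on the torus *)
Definition operator_measure (H : hilbertType R) (nu : set R -> H -> H) : Prop :=
  [/\ forall A, measurable A -> positive_op (nu A) /\ trace_class (nu A),
      forall A, measurable A -> nu A = nu (A `&` torus) &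
      forall A : nat -> set R, (forall k, measurable (A k)) ->
        trivIset setT A ->
        trace_norm (\sum_(k < n) nu (A k) - nu (\bigcup_k A k))
          @[n --> \oo] --> 0%E].

Definition spectral_operator_measure (H : hilbertType R) d
    (Om : measurableType d) (P : probability Om R) (X : int -> Om -> H)
    (nu : set R -> H -> H) : Prop :=
  operator_measure nu /\
  forall h : int, is_vector_integral (@trace_norm R H) nu
    (fun x => expi (h%:~R * x)) (cov_op P (X h) (X 0)).

Definition operator_density (H : hilbertType R) (nu : set R -> H -> H)
    (mu : set R -> \bar R) (f : R -> H -> H) : Prop :=
  (forall x, trace_class (f x)) /\
  forall A, measurable A ->
    is_bochner_integral (@trace_norm R H) mu
      (fun x => (\1_A x : R[i]) *: f x) (nu A).

End spectral.

Section functionals.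
Context {R : realType}.
Context {H G : hilbertType R}.

Definition centered (X : int -> H) (n k : nat) : H :=
  X k%:Z - (n%:R : R[i])^-1 *: \sum_(1 <= j < n.+1) X j%:Z.

Definition dft (X : int -> H) (n : nat) (x : R) : H :=
  ((Num.sqrt n%:R)^-1)%:C%C *:
    \sum_(1 <= k < n.+1) expi (- (x * k%:R)) *: centered X n k.

Definition periodogram (X : int -> H) (n : nat) (x : R) : H -> H :=
  tensor (dft X n x) (dft X n x).

Definition sandwich (A B : H -> G) (C : H -> H) : G -> G :=
  A \o C \o adjoint B.

(* the common form of both functionals: \int L(theta, x) F(x) R(theta, x)^H
   mu(dx), a Bochner integral in S_1(G) *)
Definition quadratic_functional (Theta : Type) (Lf Rf : Theta -> R -> H -> G)
    (mu : set R -> \bar R) (F : R -> H -> H) (theta : Theta) : G -> G :=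
  bochner (@trace_norm R G) mu
    (fun x => sandwich (Lf theta x) (Rf theta x) (F x)).

End functionals.

Section continuous_functions.
Context {R : realType}.

(* continuous functions from T to (the subspace {N < +oo} of V, with norm N) *)
Definition in_C (T : topologicalType) (V : zmodType) (N : V -> \bar R)
    (F : T -> V) : Prop :=
  (forall p, (N (F p) < +oo)%E) /\
  forall p (e : R), 0 < e -> \forall q \near p, (N (F q - F p)%R < e%:E)%E.

(* the 0 only matters for empty T *)
Definition uniform_cvg_in_C (T : topologicalType) (V : zmodType)
    (N : V -> \bar R) (Fn : nat -> T -> V) (F : T -> V) : Prop :=
  [/\ forall n, in_C N (Fn n),
      in_C N F &
      ereal_sup (0%E |` [set N (Fn n x - F x) | x in [set: T]])
        @[n --> \oo] --> 0%E].

(* C(Theta * torus, L_b(H, G)) *)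
Definition continuous_operator_field (Theta : topologicalType)
    (H G : hilbertType R) (Lf : Theta -> R -> H -> G) : Prop :=
  [/\ forall theta x, bounded_op (Lf theta x),
      forall theta x, Lf theta (x + 2 * pi) = Lf theta x &
      in_C (@opnorm R H G) (fun p : Theta * R => Lf p.1 p.2)].

End continuous_functions.

(* Main.v *)
(* Let g_i be an orthonormal basis of G_0.  The entries of both functionals in
   this basis have the form \int <F(x) v_i(x), u_j(x)> mu(dx), where F is I_n or
   f_X, and u_j = L(theta, .)^H g_j, v_i = R(theta, .)^H g_i are continuous
   periodic H_0-valued functions.  Such a form is bounded by M |u|_oo |v|_oo,
   where M is (up to a constant) the mass of the operator measure F d mu; for
   the periodogram the mass is at most (1/n) \sum_(k <= n) |X_k|^2, which is
   a.s. bounded in n.  By Fejer's theorem, which is used through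
   quadrature nodes instead of integrals, u and v are uniform limits of
   trigonometric polynomials with vector coefficients, so convergence of the
   forms reduces to convergence of the Fourier coefficients
   \int e^{ihx} <F(x) b, a> mu(dx).  For I_n these are the empirical
   autocovariances of <X_t, a>, <X_t, b>, and for f_X they are
   <Cov(X_h, X_0) b, a>; Birkhoff's theorem on the path space gives a.s.
   convergence for all h and all a, b in a countable dense set, and the bound
   by M extends it to all a, b.  Uniformity in theta follows from compactness,
   since the bound by M makes the forms equicontinuous in theta, uniformly in n. *)
Require Import Defs.
From HB Require Import structures.
From mathcomp Require Import all_boot all_order all_algebra.
From mathcomp Require Import complex.
From mathcomp Require Import all_classical all_reals all_analysis.
From mathcomp Require Import measurable_realfun ring lra zify.

Set Implicit Arguments.
Unset Strict Implicit.
Unset Printing Implicit Defensive.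

Import Order.TTheory GRing.Theory Num.Theory.
Import numFieldNormedType.Exports.

Local Open Scope classical_set_scope.
Local Open Scope ring_scope.

(** * Complex numbers and Hilbert spaces *)

(** Two definitions shape the argument. [trace_norm] is an infimum over square roots of A^H A and
    orthonormal bases. Over H_0 it enters through its lower bound by the operator norm; the upper
    bound by matrix entries, for which a square root must be exhibited, is proved over G_0 by
    diagonalising a matrix. [is_bochner_integral] asks for step functions with small integrated
    error but says nothing on the measurability of that error. The integral of a nonnegative
    function is a supremum over simple functions below it, so it is monotone all the same and can
    dominate measurable scalar functions.

    The constant M depends on the outcome. This is harmless: the ergodic theorem is applied to
    countably many functions of the path, and what follows concerns one fixed outcome outside a null
    set, with a deterministic sequence of observations. *)

Section complex_numbers.
Context {R : realType}.
Implicit Types z w : R[i].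

(** The library norm has values in [R[i]]; its real part lies in a totally ordered field, where
    estimates can be settled by [lra] and [nra]. *)
Definition cnorm z : R := complex.Re `|z|.

Lemma normE z : `|z| = (cnorm z)%:C%C.
Proof. by []. Qed.

Lemma ReD z w : complex.Re (z + w) = complex.Re z + complex.Re w.
Proof. by case: z w => ? ? []. Qed.

Lemma ImD z w : complex.Im (z + w) = complex.Im z + complex.Im w.
Proof. by case: z w => ? ? []. Qed.

Lemma ReN z : complex.Re (- z) = - complex.Re z.
Proof. by case: z. Qed.

Lemma ImN z : complex.Im (- z) = - complex.Im z.
Proof. by case: z. Qed.

Lemma ReB z w : complex.Re (z - w) = complex.Re z - complex.Re w.
Proof. by rewrite ReD ReN. Qed.

Lemma ImB z w : complex.Im (z - w) = complex.Im z - complex.Im w.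
Proof. by rewrite ImD ImN. Qed.

Lemma ReM z w :
  complex.Re (z * w) = complex.Re z * complex.Re w - complex.Im z * complex.Im w.
Proof. by case: z w => ? ? []. Qed.

Lemma ImM z w :
  complex.Im (z * w) = complex.Re z * complex.Im w + complex.Im z * complex.Re w.
Proof. by case: z w => ? ? []. Qed.

Lemma ReJ z : complex.Re z^* = complex.Re z.
Proof. by case: z. Qed.

Lemma ImJ z : complex.Im z^* = - complex.Im z.
Proof. by case: z. Qed.

Lemma Re_sum I r (Q : pred I) (F : I -> R[i]) :
  complex.Re (\sum_(i <- r | Q i) F i) = \sum_(i <- r | Q i) complex.Re (F i).
Proof. by rewrite (big_morph _ ReD (erefl : complex.Re (0 : R[i]) = 0)). Qed.

Lemma Im_sum I r (Q : pred I) (F : I -> R[i]) :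
  complex.Im (\sum_(i <- r | Q i) F i) = \sum_(i <- r | Q i) complex.Im (F i).
Proof. by rewrite (big_morph _ ImD (erefl : complex.Im (0 : R[i]) = 0)). Qed.

Lemma complex_eq z w :
  complex.Re z = complex.Re w -> complex.Im z = complex.Im w -> z = w.
Proof. by case: z w => ? ? [? ?] /= -> ->. Qed.

Lemma conjR (x : R) : (x%:C%C : R[i])^* = x%:C%C.
Proof. exact: conjc_real. Qed.

Lemma natC n : (n%:R : R[i]) = (n%:R : R)%:C%C.
Proof. by rewrite rmorph_nat. Qed.

Lemma cnorm_ge0 z : 0 <= cnorm z.
Proof. by rewrite -ler0c -normE. Qed.

Lemma cnorm0 : cnorm 0 = 0.
Proof. by rewrite /cnorm normr0. Qed.

Lemma cnormN z : cnorm (- z) = cnorm z.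
Proof. by rewrite /cnorm normrN. Qed.

Lemma cnormD z w : cnorm (z + w) <= cnorm z + cnorm w.
Proof. by rewrite -lecR rmorphD /= -!normE ler_normD. Qed.

Lemma cnormB z w : cnorm (z - w) <= cnorm z + cnorm w.
Proof. by rewrite (le_trans (cnormD _ _))// cnormN. Qed.

Lemma cnorm_distC z w : cnorm (z - w) = cnorm (w - z).
Proof. by rewrite -cnormN opprB. Qed.

Lemma cnormM z w : cnorm (z * w) = cnorm z * cnorm w.
Proof. by apply: complexI; rewrite rmorphM /= -!normE normrM. Qed.

Lemma cnormJ z : cnorm z^* = cnorm z.
Proof. by rewrite /cnorm norm_conjC. Qed.

Lemma cnormR (x : R) : cnorm x%:C%C = `|x|.
Proof. by rewrite /cnorm normc_def /= expr0n addr0 sqrtr_sqr. Qed.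

Lemma cnorm_nat n : cnorm n%:R = n%:R.
Proof. by rewrite natC cnormR ger0_norm. Qed.

Lemma cnorm_eq0 z : cnorm z = 0 -> z = 0.
Proof. by move=> z0; apply/eqP; rewrite -normr_eq0 normE z0. Qed.

Lemma cnorm_sum I r (Q : pred I) (F : I -> R[i]) :
  cnorm (\sum_(i <- r | Q i) F i) <= \sum_(i <- r | Q i) cnorm (F i).
Proof.
elim/big_ind2 : _ => //; first by rewrite cnorm0.
by move=> a b c e ab ce; rewrite (le_trans (cnormD _ _))// lerD.
Qed.

Lemma cnorm_sqr z : cnorm z ^+ 2 = complex.Re z ^+ 2 + complex.Im z ^+ 2.
Proof. by apply: complexI; rewrite add_Re2_Im2 rmorphXn. Qed.

Lemma Re_le_cnorm z : `|complex.Re z| <= cnorm z.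
Proof. by rewrite -lecR; exact: normc_ge_Re. Qed.

Lemma Im_le_cnorm z : `|complex.Im z| <= cnorm z.
Proof.
rewrite -(ler_pXn2r (ltn0Sn 1)) ?nnegrE ?cnorm_ge0// cnorm_sqr real_normK ?num_real//.
by rewrite lerDr sqr_ge0.
Qed.

Lemma cnorm_le_ReIm z : cnorm z <= `|complex.Re z| + `|complex.Im z|.
Proof.
rewrite -(ler_pXn2r (ltn0Sn 1)) ?nnegrE ?cnorm_ge0 ?addr_ge0// cnorm_sqr sqrrD.
rewrite !real_normK ?num_real// -addrA [_ *+ 2 + _]addrC addrA lerDl.
by rewrite mulrn_wge0 ?mulr_ge0.
Qed.

Lemma expiD (x y : R) : expi (x + y) = expi x * expi y.
Proof.
by apply: complex_eq; rewrite ?ReM ?ImM /= ?cosD ?sinD // addrC [cos x * _]mulrC.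
Qed.

Lemma expi0 : expi (0 : R) = 1.
Proof. by rewrite /expi cos0 sin0. Qed.

Lemma expiN (x : R) : expi (- x) = (expi x)^*.
Proof. by rewrite /expi cosN sinN. Qed.

Lemma cnorm_expi (x : R) : cnorm (expi x) = 1.
Proof.
have : cnorm (expi x) ^+ 2 = 1 by rewrite cnorm_sqr /= cos2Dsin2.
by move/eqP; rewrite sqrf_eq1 => /orP[/eqP//|/eqP h]; move: (cnorm_ge0 (expi x)); rewrite h ler0N1.
Qed.

End complex_numbers.

Section hilbert_spaces.
Context {R : realType} {H : hilbertType R}.
Implicit Types (x y z : H) (a : R[i]).

Lemma hnormE x : `|x| = (hnorm x)%:C%C.
Proof. by rewrite /hnorm RRe_real // ger0_real. Qed.

Lemma hnorm_ge0 x : 0 <= hnorm x.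
Proof. by rewrite -ler0c -hnormE. Qed.

Lemma hnorm0 : hnorm (0 : H) = 0.
Proof. by rewrite /hnorm normr0. Qed.

Lemma hnorm_eq0 x : hnorm x = 0 -> x = 0.
Proof. by move=> x0; apply/eqP; rewrite -normr_eq0 hnormE x0. Qed.

Lemma hnormN x : hnorm (- x) = hnorm x.
Proof. by rewrite /hnorm normrN. Qed.

Lemma hnormD x y : hnorm (x + y) <= hnorm x + hnorm y.
Proof. by rewrite -lecR rmorphD /= -!hnormE ler_normD. Qed.

Lemma hnormB x y : hnorm (x - y) <= hnorm x + hnorm y.
Proof. by rewrite (le_trans (hnormD _ _))// hnormN. Qed.

Lemma hnorm_distC x y : hnorm (x - y) = hnorm (y - x).
Proof. by rewrite -hnormN opprB. Qed.

Lemma hnorm_triangle x y z : hnorm (x - z) <= hnorm (x - y) + hnorm (y - z).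
Proof. by rewrite (le_trans _ (hnormD _ _))// addrA subrK. Qed.

Lemma hnorm_distD x y : `|hnorm x - hnorm y| <= hnorm (x - y).
Proof.
have h (u v : H) : hnorm u - hnorm v <= hnorm (u - v).
  by rewrite lerBlDr; apply: (le_trans _ (hnormD _ _)); rewrite subrK.
by rewrite ler_norml h lerNl opprB hnorm_distC h.
Qed.

Lemma hnormZ a x : hnorm (a *: x) = cnorm a * hnorm x.
Proof. by apply: complexI; rewrite rmorphM /= -!hnormE normrZ. Qed.

Lemma hnorm_sum I r (Q : pred I) (F : I -> H) :
  hnorm (\sum_(i <- r | Q i) F i) <= \sum_(i <- r | Q i) hnorm (F i).
Proof.
elim/big_ind2 : _ => //; first by rewrite hnorm0.
by move=> ? ? ? ? ab ce; rewrite (le_trans (hnormD _ _))// lerD.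
Qed.

Lemma hdotDl x y z : hdot (x + y) z = hdot x z + hdot y z.
Proof. exact: linearDl. Qed.

Lemma hdotDr x y z : hdot x (y + z) = hdot x y + hdot x z.
Proof. exact: linearDr. Qed.

Lemma hdotZl a x y : hdot (a *: x) y = a * hdot x y.
Proof. exact: linearZl_LR. Qed.

Lemma hdotZr a x y : hdot x (a *: y) = a^* * hdot x y.
Proof. exact: linearZr_LR. Qed.

Lemma hdotNr x y : hdot x (- y) = - hdot x y.
Proof. exact: linearNr. Qed.

Lemma hdotBl x y z : hdot (x - y) z = hdot x z - hdot y z.
Proof. exact: linearBl. Qed.

Lemma hdotBr x y z : hdot x (y - z) = hdot x y - hdot x z.
Proof. exact: linearBr. Qed.

Lemma hdot0l x : hdot 0 x = 0.
Proof. exact: linear0l. Qed.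

Lemma hdot_suml I r (Q : pred I) (F : I -> H) y :
  hdot (\sum_(i <- r | Q i) F i) y = \sum_(i <- r | Q i) hdot (F i) y.
Proof. exact: linear_sumlz. Qed.

Lemma hdot_sumr I r (Q : pred I) (F : I -> H) y :
  hdot y (\sum_(i <- r | Q i) F i) = \sum_(i <- r | Q i) hdot y (F i).
Proof. exact: linear_sumr. Qed.

Lemma hdotC x y : hdot x y = (hdot y x)^*.
Proof. by rewrite hermC expr0 mul1r. Qed.

Lemma hdotxx x : hdot x x = (hnorm x ^+ 2)%:C%C.
Proof. by rewrite hdot_normE hnormE rmorphXn. Qed.

Lemma hdot_ge0 x : 0 <= hdot x x.
Proof. by rewrite hdotxx ler0c sqr_ge0. Qed.

Lemma hdot_eq x y : (forall z, hdot x z = hdot y z) -> x = y.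
Proof.
move=> xy; apply/eqP; rewrite -subr_eq0; apply/eqP/hnorm_eq0/eqP.
rewrite -sqrf_eq0; apply/eqP/complexI.
by rewrite -hdotxx hdotBl xy subrr.
Qed.

End hilbert_spaces.

(* Stated for semidefinite forms, to apply to <S x, y> with S positive. *)
Lemma cauchy_schwarz {R : realType} (V : lmodType R[i]) (b : V -> V -> R[i]) :
  (forall a x y z, b (a *: x + y) z = a * b x z + b y z) ->
  (forall x y, b x y = (b y x)^*) -> (forall x, 0 <= b x x) ->
  forall x y, cnorm (b x y) ^+ 2 <= complex.Re (b x x) * complex.Re (b y y).
Proof.
move=> bl bC b0 x y.
have bD u v w : b (u + v) w = b u w + b v w.
  by have := bl 1 u v w; rewrite scale1r mul1r.
have b00 w : b 0 w = 0 by apply: (addrI (b 0 w)); rewrite -bD !addr0.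
have bZ a u w : b (a *: u) w = a * b u w.
  by have := bl a u 0 w; rewrite addr0 b00 addr0.
have bDr u v w : b w (u + v) = b w u + b w v.
  by rewrite bC bD rmorphD /= -!bC.
have bZr a u w : b w (a *: u) = a^* * b w u by rewrite bC bZ rmorphM /= -bC.
have re u : b u u = (complex.Re (b u u))%:C%C.
  by rewrite RRe_real // ger0_real.
have rb u : 0 <= complex.Re (b u u) by rewrite -ler0c -re.
set p := complex.Re (b x x); set q := complex.Re (b y y).
set z := b x y.
(* Positivity at x - t z y: the factor z = b x y makes the cross terms real, which leaves a real
   quadratic in t. *)
have key (t : R) : 0 <= p - 2 * t * cnorm z ^+ 2 + t ^+ 2 * cnorm z ^+ 2 * q.
  have := rb (x + (- (t%:C%C * z)) *: y).
  rewrite bD !bDr !bZ !bZr [b y x]bC -/z [b y y]re -/q [b x x]re -/p.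
  rewrite rmorphN rmorphM /= conjR; move=> h; apply: (le_trans h); rewrite le_eqVlt; apply/orP; left; apply/eqP.
  rewrite cnorm_sqr.
  case: (z) => u v.
  rewrite ?(ReD, ReM, ImM, ReN, ImN, ImD) /=; ring.
(* If q = 0 the expression is affine in t and, unless z = 0, takes the value -1 at the t chosen
   below. If q > 0 its value at 1 / q gives the claim. *)
have [q0|q0] := leP q 0.
  have {}q0 : q = 0 by apply/eqP; rewrite eq_le q0 rb.
  rewrite q0 mulr0; apply: contrapT => /negP; rewrite -ltNge => zp.
  have := key ((p + 1) / (2 * cnorm z ^+ 2)).
  rewrite q0 mulr0 addr0.
  have -> : 2 * ((p + 1) / (2 * cnorm z ^+ 2)) * cnorm z ^+ 2 = p + 1.
    by move: (cnorm z ^+ 2) zp => c c0; field; rewrite gt_eqF.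
  lra.
have := key q^-1.
have -> : p - 2 / q * cnorm z ^+ 2 + q^-1 ^+ 2 * cnorm z ^+ 2 * q =
   (p * q - cnorm z ^+ 2) / q by field; rewrite gt_eqF.
by rewrite pmulr_lge0 ?invr_gt0// subr_ge0.
Qed.

Section hilbert_topology.
Context {R : realType} {H : hilbertType R}.
Implicit Types (x y z : H).

Lemma hdot_le x y : cnorm (hdot x y) <= hnorm x * hnorm y.
Proof.
rewrite -(ler_pXn2r (ltn0Sn 1)) ?nnegrE ?mulr_ge0 ?hnorm_ge0 ?cnorm_ge0//.
have := @cauchy_schwarz R H (fun u v => hdot u v).
rewrite /= => /(_ _ _ _ x y); rewrite !hdotxx /= exprMn; apply.
- by move=> *; rewrite hdotDl hdotZl.
- by move=> *; exact: hdotC.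
- exact: hdot_ge0.
Qed.

(** A positive radius in [R[i]] is real, so real radii describe all neighbourhoods. *)
Lemma nbhs_hnormP x (A : set H) :
  nbhs x A <-> exists2 e : R, 0 < e & forall y, hnorm (x - y) < e -> A y.
Proof.
split.
  move/nbhs_ballP => [e /= e0 eA].
  have re : e = (complex.Re e)%:C%C by rewrite RRe_real// gtr0_real.
  exists (complex.Re e); first by rewrite -ltcR -re.
  move=> y xy; apply: eA; rewrite -ball_normE /ball_ /= hnormE.
  by rewrite re ltcR.
move=> [e e0 eA]; apply/nbhs_ballP; exists e%:C%C; first by rewrite /= ltcR.
by move=> y; rewrite -ball_normE /ball_ /= hnormE ltcR; exact: eA.
Qed.

Lemma hnorm_complete (u : nat -> H) :
  (forall e : R, 0 < e -> exists N, forall m n, (N <= m)%N -> (N <= n)%N ->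
    hnorm (u m - u n) < e) ->
  exists l, forall e : R, 0 < e -> \forall n \near \oo, hnorm (l - u n) < e.
Proof.
move=> cu.
have /cvg_ex[l ul] : cvg (u @ \oo).
  apply: cauchy_cvg; apply: cauchy_exP => e e0.
  have re : e = (complex.Re e)%:C%C by rewrite RRe_real// gtr0_real.
  have [|N uN] := cu (complex.Re e); first by rewrite -ltcR -re.
  exists (u N); exists N => // n /= Nn.
  by rewrite -ball_normE /ball_ /= hnormE re ltcR uN.
exists l => e e0.
have : nbhs l [set y | hnorm (l - y) < e] by apply/nbhs_hnormP; exists e.
by move/ul.
Qed.

End hilbert_topology.

(** * Riesz representation *)

Section riesz.
Context {R : realType} {H : hilbertType R}.

(** First-order condition at a minimum: near t = 0 the linear term would dominate. The test point -c
    / (q + 1) also covers q = 0. *)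
Lemma real_quadratic_ge0 (c q : R) :
  0 <= q -> (forall t, 0 <= 2 * t * c + t ^+ 2 * q) -> c = 0.
Proof.
move=> q0 /(_ (- c / (q + 1))).
have q1 : 0 < q + 1 by rewrite ltr_wpDl.
have -> : 2 * (- c / (q + 1)) * c + (- c / (q + 1)) ^+ 2 * q =
  - (c ^+ 2 * (q + 2) / (q + 1) ^+ 2) by field; rewrite gt_eqF.
rewrite oppr_ge0 pmulr_lle0 ?invr_gt0 ?exprn_gt0// pmulr_lle0; last lra.
by move=> c0; apply/eqP; rewrite -sqrf_eq0 eq_le c0 sqr_ge0.
Qed.

Lemma hnorm2D (x y : H) :
  hnorm (x + y) ^+ 2 = hnorm x ^+ 2 + 2 * complex.Re (hdot x y) + hnorm y ^+ 2.
Proof.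
apply: complexI; rewrite -hdotxx hdotDl !hdotDr [hdot y x]hdotC.
apply: complex_eq; rewrite !(ReD, ImD, ReJ, ImJ) !hdotxx /=; ring.
Qed.

Lemma parallelogram (x y : H) :
  hnorm (x + y) ^+ 2 + hnorm (x - y) ^+ 2 = 2 * (hnorm x ^+ 2 + hnorm y ^+ 2).
Proof. by rewrite !hnorm2D hdotNr ReN hnormN; ring. Qed.

(* The representing vector is the minimiser of |x|^2 - 2 Re phi(x). *)
Theorem riesz (phi : H -> R[i]) (K : R) :
  (forall a x y, phi (a *: x + y) = a * phi x + phi y) ->
  (forall x, cnorm (phi x) <= K * hnorm x) ->
  exists y, forall x, phi x = hdot x y.
Proof.
move=> phil phiK.
have phiD x y : phi (x + y) = phi x + phi y.
  by have := phil 1 x y; rewrite scale1r mul1r.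
have phi0 : phi 0 = 0 by apply: (addrI (phi 0)); rewrite -phiD !addr0.
have phiZ a x : phi (a *: x) = a * phi x.
  by have := phil a x 0; rewrite addr0 phi0 addr0.
pose J x := hnorm x ^+ 2 - 2 * complex.Re (phi x).
(* Completing the square: J x >= |x|^2 - 2 K |x| >= - K^2. *)
have Jge x : - K ^+ 2 <= J x.
  have h1 : complex.Re (phi x) <= K * hnorm x.
    by rewrite (le_trans _ (phiK x))// (le_trans (ler_norm _))// Re_le_cnorm.
  have h2 := sqr_ge0 (hnorm x - K).
  rewrite /J; nra.
pose m := inf (range J).
have Jinf : has_inf (range J).
  split; first by exists (J 0), 0.
  by exists (- K ^+ 2) => _ [x _ <-].
have mJ x : m <= J x by apply: ge_inf; [exact: Jinf.2 | exists x].
have /choice[u uP] n : exists x, J x < m + n.+1%:R^-1.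
  have [|_ [x _ <-] Jx] := @inf_adherent _ (range J) n.+1%:R^-1 _ Jinf; last by exists x.
  by rewrite invr_gt0.
(* The parallelogram law and m <= J at the midpoint force near-minimisers to be close, so a
   minimising sequence is Cauchy. *)
have Jpar x y : hnorm (x - y) ^+ 2 <= 2 * (J x + J y - 2 * m).
  have /(_ ((2^-1 : R)%:C%C *: (x + y))) := mJ.
  rewrite /J hnormZ cnormR phiZ phiD ReM !ReD ImD /=.
  rewrite ger0_norm ?invr_ge0// exprMn.
  have := parallelogram x y.
  move: (hnorm _) (hnorm (x + y)) (hnorm x) (hnorm y) (complex.Re _) (complex.Re _) => a b c d e f.
  rewrite mul0r subr0; lra.
have smallV (e : R) : 0 < e -> exists N, forall n, (N <= n)%N -> n.+1%:R^-1 < e.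
  move=> e0; have [N _ hN] := near_infty_natSinv_lt (PosNum e0).
  by exists N => n Nn; exact: hN.
have [e e0|l ul] := @hnorm_complete R H u.
  have [|N hN] := smallV (e ^+ 2 / 4); first by rewrite divr_gt0 ?exprn_gt0.
  exists N => p n /hN hp /hN hn.
  rewrite -(ltr_pXn2r (ltn0Sn 1)) ?nnegrE ?hnorm_ge0 ?ltW//.
  apply: (le_lt_trans (Jpar _ _)).
  have := uP p; have := uP n; move: hp hn.
  by move: (p.+1%:R^-1) (n.+1%:R^-1) (J _) (J _) (m) => a b c f g; lra.
have Re_l z : complex.Re (hdot l z) = complex.Re (phi z).
  apply/eqP; rewrite -subr_eq0; apply/eqP.
  apply: (@real_quadratic_ge0 _ (hnorm z ^+ 2)); first exact: sqr_ge0.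
  move=> t; apply: contrapT => /negP; rewrite -ltNge.
  set c := _ - _; set q := hnorm z ^+ 2 => neg.
  (* If the quadratic were negative at t, then J (u n + t z) would fall below m for large n: the
     excess of J (u n) over m is less than e, replacing l by u n costs at most 2 |t| e |z|, and
     together this is less than the gain e (2 + 2 |t| |z|). *)
  pose e : R := - (2 * t * c + t ^+ 2 * q) / (2 + 2 * `|t| * hnorm z).
  have den : 0 < 2 + 2 * `|t| * hnorm z by rewrite ltr_wpDr// !mulr_ge0 ?hnorm_ge0.
  have e0 : 0 < e by rewrite divr_gt0// oppr_gt0.
  have [N hN] := smallV e e0.
  have [M _ hM] := ul e e0.
  have /= Hl := hM (maxn N M) (leq_maxr _ _).
  have HN := hN (maxn N M) (leq_maxl _ _).
  move: (maxn N M) Hl HN => n Hl HN.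
  have := uP n; have := mJ (u n + t%:C%C *: z).
  rewrite /J hnorm2D phiD phiZ hdotZr ReD !ReM conjR /= !mul0r !subr0.
  rewrite hnormZ cnormR exprMn real_normK ?num_real//.
  have : `|t * complex.Re (hdot (u n) z) - t * complex.Re (hdot l z)| <= `|t| * (e * hnorm z).
    rewrite -mulrBr normrM ler_wpM2l// -ReB -hdotBl (le_trans (Re_le_cnorm _))//.
    by rewrite (le_trans (hdot_le _ _))// ler_wpM2r ?hnorm_ge0// hnorm_distC ltW.
  rewrite ler_norml => /andP[_].
  have : e * (2 + 2 * `|t| * hnorm z) = - (2 * t * c + t ^+ 2 * q).
    by rewrite /e divfK// gt_eqF.
  move: neg HN; rewrite /c /q; clearbody e.
  move: (complex.Re (hdot l z)) (complex.Re (hdot (u n) z)) (complex.Re (phi z)).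
  move: (complex.Re _) (hnorm z ^+ 2) (hnorm z) (hnorm (u n) ^+ 2) (n.+1%:R^-1 : R) (`|t| : R) (m) => *.
  suff : (0 : R) < 0 by rewrite ltxx.
  lra.
exists l => z; apply: complex_eq.
  by rewrite hdotC ReJ Re_l.
(* The imaginary part of a linear functional is its real part at -i z. *)
have := Re_l ((0 -i* 1)%C *: z).
by rewrite [hdot z l]hdotC ImJ phiZ hdotZr !ReM ReJ ImJ /=; lra.
Qed.

End riesz.

(** * Bounded operators and adjoints *)

Section bounded_operators.
Context {R : realType}.
Implicit Types H G : hilbertType R.

Lemma linD H G (A : H -> G) : linear A -> {morph A : x y / x + y}.
Proof. by move=> lA x y; have := lA 1 x y; rewrite !scale1r. Qed.

Lemma lin0 H G (A : H -> G) : linear A -> A 0 = 0.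
Proof. by move=> lA; apply: (addrI (A 0)); rewrite -(linD lA) !addr0. Qed.

Lemma linZ H G (A : H -> G) : linear A -> forall a x, A (a *: x) = a *: A x.
Proof. by move=> lA a x; have := lA a x 0; rewrite (lin0 lA) !addr0. Qed.

Lemma linB H G (A : H -> G) : linear A -> {morph A : x y / x - y}.
Proof. by move=> lA x y; rewrite (linD lA) -[- y]scaleN1r (linZ lA) scaleN1r. Qed.

Lemma lin_sum H G (A : H -> G) : linear A -> forall I r (Q : pred I) (F : I -> H),
  A (\sum_(i <- r | Q i) F i) = \sum_(i <- r | Q i) A (F i).
Proof. by move=> lA *; rewrite (big_morph A (linD lA) (lin0 lA)). Qed.

Lemma linear_comp H G (K : hilbertType R) (A : H -> G) (B : G -> K) :
  linear A -> linear B -> linear (B \o A).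
Proof. by move=> lA lB a x y; rewrite /= lA lB. Qed.

Lemma opnorm_ge0 H G (A : H -> G) : (0 <= opnorm A)%E.
Proof.
apply: (@le_trans _ _ (hnorm (A 0))%:E); first by rewrite lee_fin hnorm_ge0.
by apply: ereal_sup_ubound; exists 0 => //=; rewrite hnorm0.
Qed.

Lemma opnorm_leP H G (A : H -> G) (K : R) : linear A -> 0 <= K ->
  (opnorm A <= K%:E)%E <-> forall x, hnorm (A x) <= K * hnorm x.
Proof.
move=> lA K0; split=> [AK x|AK].
  have [x0|x0] := eqVneq (hnorm x) 0.
    by rewrite (hnorm_eq0 x0) lin0// !hnorm0 mulr0.
  have xp : 0 < hnorm x by rewrite lt_neqAle eq_sym x0 hnorm_ge0.
  have : ((hnorm (A ((hnorm x)^-1%:C%C *: x)))%:E <= K%:E)%E.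
    apply: (le_trans _ AK); apply: ereal_sup_ubound => /=.
    exists ((hnorm x)^-1%:C%C *: x) => //=.
    by rewrite hnormZ cnormR ger0_norm ?invr_ge0 ?hnorm_ge0// mulVf.
  rewrite lee_fin linZ// hnormZ cnormR ger0_norm ?invr_ge0 ?hnorm_ge0//.
  by rewrite mulrC ler_pdivrMr.
apply: ub_ereal_sup => _ [x /= x1 <-]; rewrite lee_fin (le_trans (AK x))//.
by rewrite -[leRHS]mulr1 ler_wpM2l.
Qed.

Lemma bounded_opP H G (A : H -> G) :
  bounded_op A <-> linear A /\ exists2 K : R, 0 <= K & forall x, hnorm (A x) <= K * hnorm x.
Proof.
split=> -[lA].
  move=> Afin; split=> //; exists (fine (opnorm A)).
    by rewrite fine_ge0// opnorm_ge0.
  apply/opnorm_leP => //; first by rewrite fine_ge0// opnorm_ge0.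
  by rewrite fineK// ge0_fin_numE// opnorm_ge0.
move=> [K K0 AK]; split=> //; apply: (@le_lt_trans _ _ K%:E); last exact: ltry.
exact/opnorm_leP.
Qed.

(** [adjoint] is a choice with a default value; Riesz supplies a candidate, so the choice meets its
    specification. *)
Lemma adjointP H G (A : H -> G) : bounded_op A ->
  forall x y, hdot (A x) y = hdot x (adjoint A y).
Proof.
move=> /bounded_opP[lA [K K0 AK]].
have /choice[B BP] (y : G) : exists z, forall x, hdot (A x) y = hdot x z.
  apply: (@riesz _ _ _ (K * hnorm y)) => [a u v|x].
    by rewrite lA hdotDl hdotZl.
  by rewrite (le_trans (hdot_le _ _))// mulrAC ler_wpM2r// hnorm_ge0.
rewrite /adjoint.
by have := @xgetPex _ (0 : G -> H) [set B | forall x y, hdot (A x) y = hdot x (B y)]; apply; exists B.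
Qed.

Lemma adjoint_linear H G (A : H -> G) : bounded_op A -> linear (adjoint A).
Proof.
move=> bA a x y; apply: hdot_eq => z; apply: (can_inj conjCK); rewrite -!hdotC.
by rewrite -adjointP// !hdotDr !hdotZr -!adjointP.
Qed.

End bounded_operators.

(** * Trace norms *)

Section trace_norm_lower_bound.
Context {R : realType} {H : hilbertType R}.

(** Polarisation: reality of the quadratic form at x + y matches the imaginary parts, and at x + i y
    the real parts. *)
Lemma positive_op_herm (S : H -> H) : linear S -> positive_op S ->
  forall x y, hdot (S x) y = (hdot (S y) x)^*.
Proof.
move=> lS S0 x y.
have im0 z : complex.Im (hdot (S z) z) = 0 by have := S0 z; exact: ger0_Im.
have h1 := im0 (x + y); have h2 := im0 (x + (0 +i* 1)%C *: y).
move: h1 h2.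
rewrite !(linD lS) !(linZ lS) !hdotDl !hdotDr !hdotZl !hdotZr.
rewrite !(ImD, ReD, ImM, ReM, ReJ, ImJ) !im0 /= => h1 h2.
by apply: complex_eq; rewrite ?ReJ ?ImJ; lra.
Qed.

Lemma dense_hnorm (E : set H) x (e : R) : dense E -> 0 < e ->
  exists2 y, E y & hnorm (x - y) < e.
Proof.
move=> dE e0.
have [||y [/interior_subset/= xy Ey]] := dE (interior [set y | hnorm (x - y) < e]).
- by exists x; apply/nbhs_hnormP; exists e.
- exact: open_interior.
by exists y.
Qed.

(** A combination in [linear_span] may repeat vectors; the coefficients of equal vectors are
    collected so that orthonormality can be used. *)
Lemma linear_span_uniq (E : set H) x : linear_span E x ->
  exists (s : seq H) (c : H -> R[i]), [/\ uniq s, forall e, e \in s -> E e &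
    x = \sum_(e <- s) c e *: e].
Proof.
move=> [n [e [c [Ee ->]]]].
exists (undup [seq e i | i <- enum 'I_n]), (fun h => \sum_(i | e i == h) c i).
split; first exact: undup_uniq.
  by move=> h; rewrite mem_undup => /mapP[i _ ->].
under [RHS]eq_bigr do rewrite scaler_suml big_mkcond.
rewrite exchange_big /=; apply: eq_bigr => i _.
rewrite (bigD1_seq (e i)) ?undup_uniq ?mem_undup ?map_f ?mem_index_enum//= ?mem_enum// eqxx.
by rewrite big1 ?addr0// => h; rewrite eq_sym => /negbTE ->.
Qed.

Lemma hdot_sum_orthonormal (E : set H) (s : seq H) (c : H -> R[i]) :
  orthonormal_basis E -> uniq s -> (forall e, e \in s -> E e) ->
  hnorm (\sum_(e <- s) c e *: e) ^+ 2 = \sum_(e <- s) cnorm (c e) ^+ 2.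
Proof.
move=> [E1 E0 _] us sE; apply: complexI; rewrite -hdotxx hdot_suml rmorph_sum /=.
apply: eq_big_seq => e es; rewrite hdot_sumr (bigD1_seq e)//= big_seq_cond big1.
  rewrite addr0 hdotZl hdotZr E1 ?mulr1 -?normCK ?rmorphXn //; exact: sE.
by move=> h /andP[hs he]; rewrite hdotZl hdotZr (E0 _ _ (sE _ es) (sE _ hs)) ?mulr0// => ee; rewrite ee eqxx in he.
Qed.

Lemma esum_ge_seq (E : set H) (a : H -> \bar R) (s : seq H) :
  uniq s -> (forall e, e \in s -> E e) ->
  (\sum_(e <- s) a e <= \esum_(e in E) a e)%E.
Proof.
move=> us sE; apply: ereal_sup_ubound; exists [set` s].
  by split; [exact: finite_seq | move=> e /=; exact: sE].
by rewrite -fsbig_seq.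
Qed.

(* A positive operator is bounded by its trace: on the span of the basis,
   <S x, x> is a double sum controlled by |<S e, e'>|^2 <= <S e, e><S e', e'>. *)
Lemma positive_op_le_trace (S : H -> H) (E : set H) (T : R) :
  bounded_op S -> positive_op S -> orthonormal_basis E ->
  (\esum_(e in E) (complex.Re (hdot (S e) e))%:E <= T%:E)%E ->
  forall x, hnorm (S x) <= T * hnorm x.
Proof.
move=> bS S0 onbE TS.
have /bounded_opP[lS [K K0 SK]] := bS.
have hermS := positive_op_herm lS S0.
pose p x := complex.Re (hdot (S x) x).
have p0 x : 0 <= p x by have := S0 x; rewrite lecE /= => /andP[_].
have T0 : 0 <= T.
  by rewrite -lee_fin (le_trans _ TS)// esum_ge0// => e _; rewrite lee_fin p0.
have cs x y : cnorm (hdot (S x) y) ^+ 2 <= p x * p y.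
  apply: (@cauchy_schwarz R H (fun u v => hdot (S u) v)) => //.
  by move=> a u v w; rewrite lS hdotDl hdotZl.
have pspan x : linear_span E x -> p x <= T * hnorm x ^+ 2.
  move=> /linear_span_uniq[s [c [us sE ->]]].
  rewrite (hdot_sum_orthonormal c onbE us sE).
  have sT : \sum_(e <- s) p e <= T.
    by rewrite -lee_fin (le_trans _ TS)// -sumEFin esum_ge_seq.
  apply: (@le_trans _ _ ((\sum_(e <- s) p e) * \sum_(e <- s) cnorm (c e) ^+ 2)); last first.
    by rewrite ler_wpM2r// sumr_ge0// => ? _; rewrite sqr_ge0.
  rewrite /p (lin_sum lS) hdot_suml Re_sum.
  under eq_bigr do rewrite hdot_sumr Re_sum.
  (* By Cauchy-Schwarz each term is at most the geometric mean of |c_e|^2 p_f and |c_f|^2 p_e. The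
     double sum of the arithmetic means factors. *)
  apply: (@le_trans _ _ (\sum_(e <- s) \sum_(f <- s)
      (cnorm (c e) ^+ 2 * p f + cnorm (c f) ^+ 2 * p e) / 2)).
    apply: ler_sum => e _; apply: ler_sum => f _.
    rewrite (linZ lS) hdotZl hdotZr (le_trans (ler_norm _))//.
    rewrite (le_trans (Re_le_cnorm _))// !cnormM cnormJ.
    have := cs e f; have := p0 e; have := p0 f.
    move: (cnorm_ge0 (c e)) (cnorm_ge0 (c f)) (cnorm_ge0 (hdot (S e) f)).
    move: (cnorm (c e)) (cnorm (c f)) (cnorm (hdot (S e) f)) (p e) (p f) => u v w a b u0 v0 w0 b0 a0 wab.
    rewrite ler_pdivlMr//.
    rewrite -(ler_pXn2r (ltn0Sn 1)) ?nnegrE ?addr_ge0 ?mulr_ge0 ?sqr_ge0//.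
    have h1 : 0 <= (u ^+ 2 * b - v ^+ 2 * a) ^+ 2 by rewrite sqr_ge0.
    have h2 : u ^+ 2 * v ^+ 2 * w ^+ 2 <= u ^+ 2 * v ^+ 2 * (a * b).
      by rewrite ler_wpM2l// mulr_ge0// sqr_ge0.
    have -> : (u * (v * w) * 2) ^+ 2 = 4 * (u ^+ 2 * v ^+ 2 * w ^+ 2) by ring.
    have -> : (u ^+ 2 * b + v ^+ 2 * a) ^+ 2 =
      (u ^+ 2 * b - v ^+ 2 * a) ^+ 2 + 4 * (u ^+ 2 * v ^+ 2 * (a * b)) by ring.
    lra.
  rewrite le_eqVlt; apply/orP; left; apply/eqP.
  under eq_bigr do rewrite -mulr_suml big_split /= -mulr_sumr -mulr_suml.
  rewrite -mulr_suml big_split /= -mulr_suml -mulr_sumr; by field.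
(* Extension by density, using that S is bounded: [C] bounds the change of both sides per unit of
   distance, for points at distance at most 1. *)
have pall x : p x <= T * hnorm x ^+ 2.
  apply/ler_addgt0Pr => e e0.
  pose C := (K + T) * (2 * hnorm x + 1).
  have C0 : 0 <= C by rewrite mulr_ge0 ?addr_ge0 ?mulr_ge0 ?hnorm_ge0.
  pose dl := Num.min 1 (e / (C + 1)).
  have C1 : 0 < C + 1 by rewrite ltr_wpDl.
  have dl0 : 0 < dl by rewrite lt_min ltr01 divr_gt0.
  have [_ _ dE] := onbE.
  have [y Ey xy] := dense_hnorm x dE dl0.
  have d1 : hnorm (x - y) <= 1 by rewrite (le_trans (ltW xy))// ge_min lexx.
  have dC : hnorm (x - y) * C <= e.
    rewrite (@le_trans _ _ (e / (C + 1) * C))//.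
      by rewrite ler_wpM2r// (le_trans (ltW xy))// ge_min lexx orbT.
    by rewrite mulrAC ler_pdivrMr// ler_pM2l// lerDl.
  have ny : hnorm y <= hnorm x + hnorm (x - y).
    by have := hnorm_triangle y x 0; rewrite !subr0 hnorm_distC addrC.
  have py := pspan y Ey.
  have h1 : p x - p y <= K * hnorm (x - y) * (hnorm x + hnorm y).
    have -> : p x - p y = complex.Re (hdot (S x) (x - y) + hdot (S (x - y)) y).
      by rewrite /p (linB lS) hdotBr hdotBl !(ReD, ReN); ring.
    rewrite (le_trans (ler_norm _))// (le_trans (Re_le_cnorm _))// (le_trans (cnormD _ _))//.
    rewrite mulrDr lerD// (le_trans (hdot_le _ _))//.
      by rewrite mulrAC ler_wpM2r ?hnorm_ge0.
    by rewrite ler_wpM2r ?hnorm_ge0.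
  move: h1 py ny d1 dC (hnorm_ge0 (x - y)) (hnorm_ge0 x) (hnorm_ge0 y); rewrite /C.
  move: (p x) (p y) (hnorm x) (hnorm y) (hnorm (x - y)) K0 T0.
  move=> px py a b d K0 T0 h1 h2 h3 h4 h5 d0 a0 b0.
  have h6 : T * b ^+ 2 <= T * (a + d) ^+ 2 by rewrite ler_wpM2l// ler_pXn2r ?nnegrE ?addr_ge0.
  have h7 : K * d * (a + b) <= K * d * (2 * a + 1).
    by rewrite ler_wpM2l ?mulr_ge0//; lra.
  have h8 : T * (d * (2 * a + d)) <= T * (d * (2 * a + 1)).
    by rewrite !ler_wpM2l//; lra.
  nra.
(* Cauchy-Schwarz at x and S x gives |S x|^4 <= p x * p (S x) <= T^2 |x|^2 |S x|^2; it remains to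
   divide by |S x|^2. *)
move=> x; have [x0|x0] := eqVneq (hnorm (S x)) 0.
  by rewrite x0 mulr_ge0 ?hnorm_ge0.
have xp : 0 < hnorm (S x) by rewrite lt_neqAle eq_sym x0 hnorm_ge0.
have := cs x (S x); rewrite hdotxx cnormR ger0_norm ?sqr_ge0// => h.
rewrite -(ler_pXn2r (ltn0Sn 1)) ?nnegrE ?mulr_ge0 ?hnorm_ge0//.
rewrite -(ler_pM2r (exprn_gt0 2 xp)) -expr2 (le_trans h)//.
rewrite (@le_trans _ _ ((T * hnorm x ^+ 2) * (T * hnorm (S x) ^+ 2)))//.
  by rewrite ler_pM.
by rewrite exprMn le_eqVlt; apply/orP; left; apply/eqP; ring.
Qed.

Lemma abs_op_hnorm (A S : H -> H) : bounded_op A -> abs_op A S ->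
  forall x, hnorm (A x) = hnorm (S x).
Proof.
move=> bA [[lS _] S0 SA] x.
apply/eqP; rewrite -(eqrXn2 (ltn0Sn 1)) ?hnorm_ge0//; apply/eqP/complexI.
rewrite -!hdotxx adjointP//.
have -> : adjoint A (A x) = S (S x) by have /(congr1 (@^~ x)) := SA.
by rewrite hdotC -(positive_op_herm lS S0).
Qed.

(** The bound holds for each member of the set whose infimum is [trace_norm A], since |A x| = |S x|
    and S is bounded by its trace. Estimates over the infinite-dimensional space pass through it. *)
Lemma opnorm_le_trace_norm (A : H -> H) : (opnorm A <= trace_norm A)%E.
Proof.
apply: le_ereal_inf_tmp => _ [S [E [bA SA onbE ->]]].
set t := (\esum_(e in E) _)%E.
have [bS S0 _] := SA.
have t0 : (0 <= t)%E.
  by apply: esum_ge0 => e _; rewrite lee_fin; have := S0 e; rewrite lecE => /andP[].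
case tE : t t0 => [T||] t0 //; last by rewrite leey.
apply/opnorm_leP => //; first exact: bA.1.
move=> x; rewrite (abs_op_hnorm bA SA).
by apply: (positive_op_le_trace bS S0 onbE); rewrite -/t tE.
Qed.

Lemma trace_norm_ge0 (A : H -> H) : (0 <= trace_norm A)%E.
Proof. by rewrite (le_trans (opnorm_ge0 A))// opnorm_le_trace_norm. Qed.

Lemma trace_norm_bounded (A : H -> H) : (trace_norm A < +oo)%E -> bounded_op A.
Proof.
move=> /ereal_inf_lt[_ [S [E [bA _ _ _]]] _] //.
Qed.

Lemma trace_normP (A : H -> H) : (trace_norm A < +oo)%E ->
  forall x, hnorm (A x) <= fine (trace_norm A) * hnorm x.
Proof.
move=> Afin; have [lA _] := trace_norm_bounded Afin.
have A0 := trace_norm_ge0 A.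
apply/opnorm_leP; rewrite ?fine_ge0//.
by rewrite fineK ?opnorm_le_trace_norm// ge0_fin_numE.
Qed.

End trace_norm_lower_bound.

(** * Finite-dimensional spaces: frames, square roots and trace norms *)

Section orthonormal_frames.
Context {R : realType} {G : hilbertType R}.

(** An indexed family with exact expansions, where [orthonormal_basis] has a set with dense span; m
    = 0 is allowed. *)
Definition orthonormal_frame m (g : 'I_m -> G) : Prop :=
  (forall i j, hdot (g i) (g j) = (i == j)%:R) /\
  forall x, x = \sum_i hdot x (g i) *: g i.

Lemma gram_schmidt n (e : 'I_n -> G) : exists m (g : 'I_m -> G),
  (forall i j, hdot (g i) (g j) = (i == j)%:R) /\
  forall k, e k = \sum_i hdot (e k) (g i) *: g i.
Proof.
elim: n e => [|n IH] e.
  by exists 0%N, (fun=> 0); split; [case | case].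
have [m [g [gg eg]]] := IH (fun i => e (lift ord0 i)).
pose r := e ord0 - \sum_i hdot (e ord0) (g i) *: g i.
have rg i : hdot r (g i) = 0.
  rewrite /r hdotBl hdot_suml (bigD1 i)//= hdotZl gg eqxx mulr1 big1 ?addr0 ?subrr//.
  by move=> j ji; rewrite hdotZl gg (negbTE ji) mulr0.
have [r0|r0] := eqVneq r 0.
  exists m, g; split => // k.
  by case: (unliftP ord0 k) => [j ->|->]; [exact: eg | apply/eqP; rewrite -subr_eq0; apply/eqP].
have rp : 0 < hnorm r.
  rewrite lt_neqAle hnorm_ge0 andbT eq_sym; apply: contra_neq r0; exact: hnorm_eq0.
pose f : G := (hnorm r)^-1%:C%C *: r.
have fg i : hdot f (g i) = 0 by rewrite hdotZl rg mulr0.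
have gf i : hdot (g i) f = 0 by rewrite hdotC fg conjC0.
have ff : hdot f f = 1.
  rewrite hdotZl hdotZr conjR hdotxx -!rmorphM /= mulrA -expr2 exprVn mulVf//.
  by rewrite gt_eqF ?exprn_gt0.
pose g' (i : 'I_m.+1) := if unlift ord0 i is Some j then g j else f.
have g'0 : g' ord0 = f by rewrite /g' unlift_none.
have g'S i : g' (lift ord0 i) = g i by rewrite /g' liftK.
exists m.+1, g'; split.
  move=> i j; case: (unliftP ord0 i) => [i' ->|->]; case: (unliftP ord0 j) => [j' ->|->];
    rewrite ?g'0 ?g'S ?eqxx//.
move=> k; rewrite big_ord_recl g'0; under eq_bigr do rewrite g'S.
case: (unliftP ord0 k) => [j ->|->].
  have -> : hdot (e (lift ord0 j)) f = 0.
    by rewrite (eg j) hdot_suml big1// => i _; rewrite hdotZl gf mulr0.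
  by rewrite scale0r add0r; exact: eg.
have -> : hdot (e ord0) f *: f = r.
  have {1}-> : e ord0 = r + \sum_i hdot (e ord0) (g i) *: g i by rewrite subrK.
  rewrite hdotDl hdot_suml big1 ?addr0 => [|i _]; last by rewrite hdotZl gf mulr0.
  rewrite {2}/f scalerA hdotZr conjR hdotxx -rmorphM /= -rmorphM /=.
  have -> : (hnorm r)^-1 * hnorm r ^+ 2 / hnorm r = 1 by field; rewrite gt_eqF.
  by rewrite scale1r.
by rewrite subrK.
Qed.

Lemma orthonormal_frame_exists : finite_dimensional G ->
  exists m (g : 'I_m -> G), orthonormal_frame g.
Proof.
move=> [n [e eG]]; have [m [g [gg eg]]] := gram_schmidt e.
exists m, g; split=> // x; have [c ->] := eG x.
under [RHS]eq_bigr do rewrite hdot_suml scaler_suml.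
rewrite exchange_big /=; apply: eq_bigr => k _.
rewrite {1}(eg k) scaler_sumr; apply: eq_bigr => i _.
by rewrite hdotZl scalerA.
Qed.

Section frame.
Variables (m : nat) (g : 'I_m -> G) (fg : orthonormal_frame g).

(** Coordinates are rows and matrices act from the right, so a matrix product lists the operators in
    their order of application. *)
Definition coord (x : G) : 'rV[R[i]]_m := \row_i hdot x (g i).
Definition of_coord (v : 'rV[R[i]]_m) : G := \sum_i v 0 i *: g i.
Definition op_of_mx (M : 'M[R[i]]_m) (x : G) : G := of_coord (coord x *m M).

Lemma coordK x : of_coord (coord x) = x.
Proof. by rewrite [RHS]fg.2; apply: eq_bigr => i _; rewrite mxE. Qed.

Lemma of_coordK v : coord (of_coord v) = v.
Proof.
apply/rowP => j; rewrite mxE hdot_suml (bigD1 j)//= hdotZl fg.1 eqxx mulr1.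
by rewrite big1 ?addr0// => i ij; rewrite hdotZl fg.1 (negbTE ij) mulr0.
Qed.

Lemma coord_linear a x y : coord (a *: x + y) = a *: coord x + coord y.
Proof. by apply/rowP => j; rewrite !mxE hdotDl hdotZl. Qed.

Lemma of_coord_linear a u v : of_coord (a *: u + v) = a *: of_coord u + of_coord v.
Proof.
rewrite /of_coord scaler_sumr -big_split; apply: eq_bigr => i _.
by rewrite !mxE scalerDl scalerA.
Qed.

Lemma hdot_coord x y : hdot x y = (coord x *m (map_mx Num.conj (coord y)^T)) 0 0.
Proof.
rewrite mxE {1}(fg.2 x) hdot_suml; apply: eq_bigr => i _.
by rewrite !mxE hdotZl -hdotC.
Qed.

Lemma op_of_mx_linear M : linear (op_of_mx M).
Proof. by move=> a x y; rewrite /op_of_mx coord_linear mulmxDl -scalemxAl of_coord_linear. Qed.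

Lemma op_of_mx_comp M N x : op_of_mx N (op_of_mx M x) = op_of_mx (M *m N) x.
Proof. by rewrite /op_of_mx of_coordK mulmxA. Qed.

Definition mx_of_op (A : G -> G) : 'M[R[i]]_m := \matrix_(i, j) hdot (A (g i)) (g j).

Lemma mx_of_opK (A : G -> G) : linear A -> op_of_mx (mx_of_op A) = A.
Proof.
move=> lA; apply/funext => x; rewrite /op_of_mx -[RHS]coordK; congr of_coord.
apply/rowP => j; rewrite !mxE [in RHS](fg.2 x) (lin_sum lA) hdot_suml.
by apply: eq_bigr => i _; rewrite !mxE (linZ lA) hdotZl.
Qed.

Lemma frame_hnorm i : hnorm (g i) = 1.
Proof.
apply/eqP; rewrite -(eqrXn2 (ltn0Sn 1)) ?hnorm_ge0// expr1n; apply/eqP/complexI.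
by rewrite -hdotxx fg.1 eqxx.
Qed.

Lemma linear_frame_bounded (A : G -> G) : linear A -> bounded_op A.
Proof.
move=> lA; apply/bounded_opP; split=> //.
exists (\sum_i hnorm (A (g i))); first by rewrite sumr_ge0// => *; exact: hnorm_ge0.
move=> x; rewrite {1}(fg.2 x) (lin_sum lA) (le_trans (hnorm_sum _ _ _))// mulr_suml.
apply: ler_sum => i _; rewrite (linZ lA) hnormZ mulrC ler_wpM2l ?hnorm_ge0//.
by rewrite (le_trans (hdot_le _ _))// frame_hnorm mulr1.
Qed.

Lemma mx_of_adjoint (A : G -> G) : linear A ->
  mx_of_op (adjoint A) = map_mx Num.conj (mx_of_op A)^T.
Proof.
move=> lA; apply/matrixP => i j; rewrite !mxE hdotC -adjointP//.
exact: linear_frame_bounded.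
Qed.

(** In the row convention [a *m ah] is the matrix of A^H A. It is hermitian, so a unitary matrix
    diagonalises it, and the square root is taken on the diagonal. *)
Lemma abs_op_exists (A : G -> G) : linear A -> exists S, abs_op A S.
Proof.
move=> lA; pose a := mx_of_op A; pose ah := map_mx Num.conj a^T.
pose M := a *m ah.
have hM : map_mx Num.conj M^T = M.
  rewrite /M trmx_mul map_mxM /ah; congr (_ *m _).
  by apply/matrixP => i j; rewrite !mxE; exact: conjCK.
have nM : M \is normalmx by apply/normalmxP; rewrite hM.
have /orthomx_spectralP := nM.
set P := spectralmx M; set dg := spectral_diag M => ME.
have uP : P \is unitarymx := spectral_unitarymx _.
pose Ph := map_mx Num.conj P^T.
have PPh : P *m Ph = 1%:M by exact/unitarymxP.
have {}ME : M = Ph *m diag_mx dg *m P by rewrite {1}ME invmx_unitary.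
have dgE : diag_mx dg = (P *m a) *m map_mx Num.conj (P *m a)^T.
  rewrite trmx_mul map_mxM -!mulmxA [a *m (_ *m _)]mulmxA -/ah -/M.
  by rewrite ME -!mulmxA PPh mulmx1 mulmxA PPh mul1mx.
(* The eigenvalues are the squared norms of the rows of P a. *)
have dg0 i : 0 <= dg 0 i.
  have /matrixP/(_ i i) := dgE; rewrite !mxE eqxx mulr1n => ->.
  by apply: sumr_ge0 => k _; rewrite !mxE -normCK exprn_ge0.
pose rt := map_mx sqrtC dg.
pose T := Ph *m diag_mx rt *m P.
have TT : T *m T = M.
  rewrite /T -!mulmxA [P *m (Ph *m _)]mulmxA PPh mul1mx ME.
  rewrite [diag_mx rt *m (_ *m _)]mulmxA mulmxA; congr (_ *m _); congr (_ *m _).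
  apply/matrixP => i j; rewrite mul_diag_mx !mxE.
  by have [->|ij] := eqVneq i j; rewrite ?mulr0n ?mulr0// !mulr1n -expr2 sqrtCK.
exists (op_of_mx T); split.
- by apply: linear_frame_bounded; exact: op_of_mx_linear.
- move=> x; rewrite hdot_coord of_coordK /T.
  pose w := coord x *m Ph.
  rewrite !mulmxA -/w.
  have -> : w *m diag_mx rt *m P *m map_mx Num.conj (coord x)^T =
      w *m diag_mx rt *m map_mx Num.conj w^T.
    rewrite -[in LHS]mulmxA; congr (_ *m _); rewrite /w trmx_mul map_mxM; congr (_ *m _).
    by apply/matrixP => i j; rewrite !mxE; apply/esym; exact: conjCK.
  rewrite mxE; apply: sumr_ge0 => k _; rewrite mul_mx_diag !mxE.
  by rewrite mulrAC mulr_ge0 ?sqrtC_ge0// -normCK exprn_ge0.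
- apply/funext => x /=; rewrite op_of_mx_comp TT /M.
  rewrite -op_of_mx_comp mx_of_opK// /ah -mx_of_adjoint// mx_of_opK//.
  by apply: adjoint_linear; exact: linear_frame_bounded.
Qed.

Lemma orthonormal_frame_basis : orthonormal_basis (range g).
Proof.
split.
- by move=> _ [i _ <-]; rewrite fg.1 eqxx.
- move=> _ _ [i _ <-] [j _ <-] gij; rewrite fg.1; case: eqP => // ij.
  by case: gij; rewrite ij.
- move=> O [x Ox] _; exists x; split=> //.
  by exists m, g, (fun i => hdot x (g i)); split; [move=> i; exists i | exact: fg.2].
Qed.

(** Computed in the frame, Tr |A| is the sum of <S g_i, g_i>, each at most |S g_i| = |A g_i|.
    Convergence in trace norm thus reduces to convergence of matrix entries. *)
Lemma trace_norm_frame_le (A : G -> G) : linear A ->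
  (trace_norm A <= (\sum_i \sum_j cnorm (hdot (A (g i)) (g j)))%:E)%E.
Proof.
move=> lA; have bA := linear_frame_bounded lA.
have [S SA] := abs_op_exists lA.
apply: (@le_trans _ _ (\esum_(e in range g) (complex.Re (hdot (S e) e))%:E)%E).
  by apply: ereal_inf_lbound; exists S, (range g); split=> //; exact: orthonormal_frame_basis.
(* The sum over the set [range g] counts each vector once; injectivity turns it into a sum over
   indices. *)
have gI : injective g.
  move=> i j gij; apply/eqP; have := fg.1 i j; rewrite gij fg.1 eqxx.
  by case: (i == j) => // /eqP; rewrite oner_eq0.
have -> : range g = [set` [seq g i | i <- enum 'I_m]].
  apply/seteqP; split=> [_ [i _ <-] /=|x /= /mapP[i _ ->]]; last by exists i.
  by apply: map_f; rewrite mem_enum.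
rewrite esum_fset; first last.
- by move=> e _; rewrite lee_fin; have [_ S0 _] := SA; have := S0 e; rewrite lecE => /andP[].
- exact: finite_seq.
rewrite -fsbig_seq; last by rewrite map_inj_uniq ?enum_uniq.
rewrite big_map big_enum sumEFin lee_fin.
apply: ler_sum => i _.
rewrite (le_trans (ler_norm _))// (le_trans (Re_le_cnorm _))// (le_trans (hdot_le _ _))//.
rewrite frame_hnorm mulr1 -(abs_op_hnorm bA SA) {1}(fg.2 (A (g i))).
rewrite (le_trans (hnorm_sum _ _ _))//; apply: ler_sum => j _.
by rewrite hnormZ frame_hnorm mulr1.
Qed.

Lemma trace_norm_frame_fin (A : G -> G) : linear A -> (trace_norm A < +oo)%E.
Proof. by move=> lA; rewrite (le_lt_trans (trace_norm_frame_le lA))// ltry. Qed.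

End frame.
End orthonormal_frames.

(** * Complex-valued and Bochner integrals *)

Section ereal_limits.
Context {R : realType}.
Implicit Types u : nat -> \bar R.

Lemma ecvg0P u : (forall n, 0 <= u n)%E ->
  u n @[n --> \oo] --> 0%E <->
  forall e : R, 0 < e -> \forall n \near \oo, (u n < e%:E)%E.
Proof.
move=> u0; split=> [ul e e0|ul].
  have : nbhs (0%E : \bar R) [set x | (x < e%:E)%E].
    by apply: open_nbhs_nbhs; split; [exact: open_ereal_lt_ereal | rewrite /= lte_fin].
  by move/ul.
have fu : \forall n \near \oo, u n \is a fin_num.
  near=> n; rewrite ge0_fin_numE//; apply: (@lt_trans _ _ 1%:E); last exact: ltry.
  by near: n; exact: ul.
apply/fine_cvgP; split=> //.
apply/cvgrPdist_lt => e e0; near=> n.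
rewrite /= sub0r normrN ger0_norm ?fine_ge0// -lte_fin fineK.
  by near: n; exact: ul.
by near: n.
Unshelve. all: by end_near.
Qed.

Lemma ecvg0_le u v : (forall n, 0 <= u n)%E -> (forall n, u n <= v n)%E ->
  v n @[n --> \oo] --> 0%E -> u n @[n --> \oo] --> 0%E.
Proof.
move=> u0 uv /ecvg0P v0; apply/ecvg0P => // e e0.
have {}v0 := v0 (fun n => le_trans (u0 n) (uv n)) e e0.
by apply: filterS v0 => n; exact: le_lt_trans.
Qed.

End ereal_limits.

Section complex_integral.
Context {R : realType} {d} {T : measurableType d}.
Implicit Types F G : T -> R[i].

(** [complex_integral] is defined by parts, so measurability and integrability are required of both
    parts. *)
Definition cmeasurable F :=
  measurable_fun setT (fun t => complex.Re (F t)) /\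
  measurable_fun setT (fun t => complex.Im (F t)).

Lemma cmeasurable_cst z : cmeasurable (fun=> z).
Proof. by split; exact: measurable_cst. Qed.

Lemma cmeasurableD F G : cmeasurable F -> cmeasurable G ->
  cmeasurable (fun t => F t + G t).
Proof.
move=> [? ?] [? ?]; split; [under eq_fun do rewrite ReD | under eq_fun do rewrite ImD];
  exact: measurable_funD.
Qed.

Lemma cmeasurableM F G : cmeasurable F -> cmeasurable G ->
  cmeasurable (fun t => F t * G t).
Proof.
move=> [? ?] [? ?]; split.
  under eq_fun do rewrite ReM.
  by apply: measurable_funB; exact: measurable_funM.
under eq_fun do rewrite ImM.
by apply: measurable_funD; exact: measurable_funM.
Qed.

Lemma cmeasurableN F : cmeasurable F -> cmeasurable (fun t => - F t).
Proof.
move=> mF; under eq_fun do rewrite -mulN1r.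
by apply: cmeasurableM => //; exact: cmeasurable_cst.
Qed.

Lemma cmeasurableB F G : cmeasurable F -> cmeasurable G ->
  cmeasurable (fun t => F t - G t).
Proof. by move=> mF mG; apply: cmeasurableD => //; exact: cmeasurableN. Qed.

Lemma cmeasurableJ F : cmeasurable F -> cmeasurable (fun t => (F t)^*).
Proof.
move=> [? ?]; split; [under eq_fun do rewrite ReJ | under eq_fun do rewrite ImJ] => //.
exact: measurable_funN.
Qed.

Lemma cmeasurable_indic A : measurable A -> cmeasurable (fun t => \1_A t).
Proof.
move=> mA; split.
  rewrite (_ : (fun _ => _) = (\1_A : T -> R)); first exact: measurable_indic.
  by apply/funext => t; rewrite !indicE; case: (t \in A).
rewrite (_ : (fun _ => _) = cst 0); first exact: measurable_cst.
by apply/funext => t; rewrite !indicE; case: (t \in A).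
Qed.

Lemma cmeasurable_sum_seq (I : eqType) (r : seq I) (F : I -> T -> R[i]) :
  (forall i, i \in r -> cmeasurable (F i)) -> cmeasurable (fun t => \sum_(i <- r) F i t).
Proof.
elim: r => [|i r IH] mF.
  by under eq_fun do rewrite big_nil; exact: cmeasurable_cst.
under eq_fun do rewrite big_cons; apply: cmeasurableD.
  by apply: mF; rewrite mem_head.
by apply: IH => j jr; apply: mF; rewrite in_cons jr orbT.
Qed.

Lemma cmeasurable_lim (Fn : nat -> T -> R[i]) F :
  (forall n, cmeasurable (Fn n)) ->
  (forall t (e : R), 0 < e -> \forall n \near \oo, cnorm (Fn n t - F t) < e) ->
  cmeasurable F.
Proof.
move=> mF FnF; split.
  apply: (@measurable_fun_cvg _ _ _ _ (fun n t => complex.Re (Fn n t))).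
    by move=> n; exact: (mF n).1.
  move=> t _; apply/cvgrPdist_lt => e e0; near=> n.
  rewrite -ReB (le_lt_trans (Re_le_cnorm _))// cnorm_distC.
  by near: n; exact: FnF.
apply: (@measurable_fun_cvg _ _ _ _ (fun n t => complex.Im (Fn n t))).
  by move=> n; exact: (mF n).2.
move=> t _; apply/cvgrPdist_lt => e e0; near=> n.
rewrite -ImB (le_lt_trans (Im_le_cnorm _))// cnorm_distC.
by near: n; exact: FnF.
Unshelve. all: by end_near.
Qed.

Variable mu : {measure set T -> \bar R}.

Definition cintegrable F :=
  mu.-integrable setT (EFin \o (fun t => complex.Re (F t))) /\
  mu.-integrable setT (EFin \o (fun t => complex.Im (F t))).

Local Notation cint := (complex_integral mu).

Lemma cintegrable_measurable F : cintegrable F -> cmeasurable F.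
Proof.
by move=> [/measurable_int/measurable_EFinP h1 /measurable_int/measurable_EFinP h2]; split.
Qed.

Lemma cintegrableD F G : cintegrable F -> cintegrable G ->
  cintegrable (fun t => F t + G t).
Proof.
move=> [f1 f2] [g1 g2]; split.
  rewrite (_ : _ \o _ = (EFin \o (fun t => complex.Re (F t))) \+
     (EFin \o (fun t => complex.Re (G t))))%E; first exact: integrableD.
  by apply/funext => t; rewrite /= ReD.
rewrite (_ : _ \o _ = (EFin \o (fun t => complex.Im (F t))) \+
   (EFin \o (fun t => complex.Im (G t))))%E; first exact: integrableD.
by apply/funext => t; rewrite /= ImD.
Qed.

Lemma Rintegral_linear (f g : T -> R) (a b : R) :
  mu.-integrable setT (EFin \o f) -> mu.-integrable setT (EFin \o g) ->
  mu.-integrable setT (EFin \o (fun t => a * f t + b * g t)) /\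
  Rintegral mu setT (fun t => a * f t + b * g t) =
  a * Rintegral mu setT f + b * Rintegral mu setT g.
Proof.
move=> fi gi.
have afi : mu.-integrable setT (EFin \o (fun t => a * f t)).
  rewrite (_ : _ \o _ = (fun t => a%:E * (EFin \o f) t)%E); first exact: integrableZl.
  by apply/funext => t; rewrite /= EFinM.
have bgi : mu.-integrable setT (EFin \o (fun t => b * g t)).
  rewrite (_ : _ \o _ = (fun t => b%:E * (EFin \o g) t)%E); first exact: integrableZl.
  by apply/funext => t; rewrite /= EFinM.
split; last by rewrite RintegralD// !RintegralZl.
rewrite (_ : _ \o _ = (EFin \o (fun t => (a * f t)%R)) \+ (EFin \o (fun t => (b * g t)%R)))%E.
  exact: integrableD.
by apply/funext => t; rewrite /= EFinD.
Qed.

Lemma cintZ_both a F : cintegrable F ->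
  cintegrable (fun t => a * F t) /\ cint (fun t => a * F t) = a * cint F.
Proof.
move=> [f1 f2].
have [i1 e1] := Rintegral_linear (complex.Re a) (- complex.Im a) f1 f2.
have [i2 e2] := Rintegral_linear (complex.Re a) (complex.Im a) f2 f1.
have E1 : (fun t => complex.Re (a * F t)) =
    (fun t => complex.Re a * complex.Re (F t) + - complex.Im a * complex.Im (F t)).
  by apply/funext => t; rewrite ReM mulNr.
have E2 : (fun t => complex.Im (a * F t)) =
    (fun t => complex.Re a * complex.Im (F t) + complex.Im a * complex.Re (F t)).
  by apply/funext => t; rewrite ImM.
split; first by split; rewrite ?E1 ?E2.
apply: complex_eq; rewrite ?ReM ?ImM /= ?E1 ?E2 ?e1 ?e2 ?mulNr//.
Qed.

Lemma cintegrableZ a F : cintegrable F -> cintegrable (fun t => a * F t).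
Proof. by move=> /(cintZ_both a)[]. Qed.

Lemma cintZ a F : cintegrable F -> cint (fun t => a * F t) = a * cint F.
Proof. by move=> /(cintZ_both a)[]. Qed.

Lemma cintD F G : cintegrable F -> cintegrable G ->
  cint (fun t => F t + G t) = cint F + cint G.
Proof.
move=> [f1 f2] [g1 g2]; apply: complex_eq; rewrite ?ReD ?ImD /= -RintegralD//.
  by apply: eq_Rintegral => t _; rewrite ReD.
by apply: eq_Rintegral => t _; rewrite ImD.
Qed.

Lemma cintegrableB F G : cintegrable F -> cintegrable G ->
  cintegrable (fun t => F t - G t).
Proof.
move=> iF iG; under eq_fun do rewrite -[- G _]mulN1r.
by apply: cintegrableD => //; exact: cintegrableZ.
Qed.

Lemma cintB F G : cintegrable F -> cintegrable G ->
  cint (fun t => F t - G t) = cint F - cint G.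
Proof.
move=> iF iG; under eq_fun do rewrite -[- G _]mulN1r.
by rewrite cintD ?cintZ ?mulN1r//; exact: cintegrableZ.
Qed.

Lemma cint0 : cintegrable (fun=> 0) /\ cint (fun=> 0) = 0.
Proof.
split; first by split; exact: integrable0.
by apply: complex_eq; rewrite /= /Rintegral integral0.
Qed.

Lemma cint_sum_both (I : eqType) (r : seq I) (F : I -> T -> R[i]) :
  (forall i, i \in r -> cintegrable (F i)) ->
  cintegrable (fun t => \sum_(i <- r) F i t) /\
  cint (fun t => \sum_(i <- r) F i t) = \sum_(i <- r) cint (F i).
Proof.
elim: r => [|i r IH] iF.
  by under eq_fun do rewrite big_nil; rewrite big_nil; exact: cint0.
under eq_fun do rewrite big_cons; rewrite big_cons.
have [|h1 h2] := IH; first by move=> j jr; apply: iF; rewrite in_cons jr orbT.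
have h3 : cintegrable (F i) by apply: iF; rewrite mem_head.
by split; [exact: cintegrableD | rewrite cintD// h2].
Qed.

Lemma cintegrable_dom F (B : T -> R) : cmeasurable F ->
  mu.-integrable setT (EFin \o B) -> (forall t, cnorm (F t) <= B t) -> cintegrable F.
Proof.
move=> [m1 m2] iB FB; split.
  apply: (le_integrable measurableT _ _ iB); first exact/measurable_EFinP.
  move=> t _ /=; rewrite lee_fin (le_trans (Re_le_cnorm _))// (le_trans (FB t))//.
  exact: ler_norm.
apply: (le_integrable measurableT _ _ iB); first exact/measurable_EFinP.
move=> t _ /=; rewrite lee_fin (le_trans (Im_le_cnorm _))// (le_trans (FB t))//.
exact: ler_norm.
Qed.

(** The real and imaginary parts are bounded separately, whence the factor 2, which reappears in
    later constants. *)
Lemma cint_le F (B : T -> R) : cintegrable F ->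
  mu.-integrable setT (EFin \o B) -> (forall t, cnorm (F t) <= B t) ->
  cnorm (cint F) <= 2 * Rintegral mu setT B.
Proof.
move=> [i1 i2] iB FB; rewrite (le_trans (cnorm_le_ReIm _))// mulrDl mul1r lerD//=.
  rewrite (le_trans (le_normr_Rintegral _ _))// le_Rintegral//.
    exact: integrable_norm.
  by move=> t _; rewrite (le_trans (Re_le_cnorm _)).
rewrite (le_trans (le_normr_Rintegral _ _))// le_Rintegral//.
  exact: integrable_norm.
by move=> t _; rewrite (le_trans (Im_le_cnorm _)).
Qed.

End complex_integral.

Section finite_measure.
Context {R : realType} {d} {T : measurableType d}.
Variable mu : {finite_measure set T -> \bar R}.

Lemma integrable_cst_fin (c : R) : mu.-integrable setT (EFin \o (fun=> c)).
Proof. exact: finite_measure_integrable_cst. Qed.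

Lemma cintegrable_bounded (F : T -> R[i]) (c : R) : cmeasurable F ->
  (forall t, cnorm (F t) <= c) -> cintegrable mu F.
Proof. by move=> mF Fc; apply: (cintegrable_dom mF (integrable_cst_fin c)). Qed.

Lemma cint_bounded (F : T -> R[i]) (c : R) : cmeasurable F ->
  (forall t, cnorm (F t) <= c) ->
  cnorm (complex_integral mu F) <= 2 * (c * fine (mu setT)).
Proof.
move=> mF Fc; rewrite -[c * _]Rintegral_cst//.
apply: cint_le => //; [exact: (cintegrable_bounded mF Fc) | exact: integrable_cst_fin].
Qed.

Lemma cint_indic A : measurable A ->
  cintegrable mu (fun t => \1_A t) /\
  complex_integral mu (fun t => \1_A t) = (fine (mu A))%:C%C.
Proof.
move=> mA; have mF := @cmeasurable_indic R _ _ _ mA; split.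
  apply: (@cintegrable_bounded _ 1) => // t.
  by rewrite indicE; case: (t \in A); rewrite cnorm_nat.
have E1 : (fun t => complex.Re (\1_A t : R[i])) = (\1_A : T -> R).
  by apply/funext => t; rewrite !indicE; case: (t \in A).
have E2 : (fun t => complex.Im (\1_A t : R[i])) = cst 0.
  by apply/funext => t; rewrite !indicE; case: (t \in A).
apply: complex_eq; rewrite /= ?E1 ?E2; last by rewrite /Rintegral integral0.
by rewrite /Rintegral integral_indic// setIT.
Qed.

End finite_measure.

Section lower_integral.
Context {R : realType} {d} {T : measurableType d}.
Variable mu : {measure set T -> \bar R}.

(** A simple function below f is also below g, and the integrals are suprema over such functions.
    This is applied to trace norms of approximation errors, whose measurability is not known. *)
Lemma ge0_le_integral_nomeas (f g : T -> \bar R) :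
  (forall t, 0 <= f t)%E -> (forall t, f t <= g t)%E ->
  (\int[mu]_t f t <= \int[mu]_t g t)%E.
Proof.
move=> f0 fg; have g0 t : (0 <= g t)%E by exact: le_trans (fg t).
rewrite !ge0_integralTE//; apply: ereal_sup_le => _ [h hf <-].
by exists h => // t; exact: le_trans (fg t).
Qed.

(* [D] need not be measurable: its integral is a lower integral. *)
Lemma cint_dominated (psi : T -> R[i]) (D : T -> \bar R) (c : R) :
  cmeasurable psi -> 0 < c -> (forall t, 0 <= D t)%E ->
  (forall t, (cnorm (psi t))%:E <= c%:E * D t)%E -> (\int[mu]_t D t < +oo)%E ->
  cintegrable mu psi /\
  cnorm (complex_integral mu psi) <= 2 * c * fine (\int[mu]_t D t)%E.
Proof.
move=> [m1 m2] c0 D0 psiD Doo.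
have real_part (g : T -> R) : measurable_fun setT g ->
    (forall t, `|g t| <= cnorm (psi t)) ->
    mu.-integrable setT (EFin \o g) /\
    `|Rintegral mu setT g| <= c * fine (\int[mu]_t D t)%E.
  move=> mg gpsi.
  have le1 : (\int[mu]_t (c^-1 * `|g t|)%:E <= \int[mu]_t D t)%E.
    apply: ge0_le_integral_nomeas => t.
      by rewrite lee_fin mulr_ge0// invr_ge0 ltW.
    rewrite EFinM lee_pdivrMl//; apply: le_trans (psiD t).
    by rewrite lee_fin gpsi.
  have mng : measurable_fun setT (fun t => `|g t|).
    by apply: measurableT_comp => //; exact: normr_measurable.
  have le2 : (\int[mu]_t `|g t|%:E <= c%:E * \int[mu]_t D t)%E.
    rewrite -lee_pdivrMl// -ge0_integralZl//.
    - exact/measurable_EFinP.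
    - by rewrite lee_fin invr_ge0 ltW.
  have Dfin : (\int[mu]_t D t)%E \is a fin_num.
    by rewrite ge0_fin_numE//; apply: integral_ge0.
  have ig : mu.-integrable setT (EFin \o g).
    apply/integrableP; split; first exact/measurable_EFinP.
    by rewrite (le_lt_trans le2)// -(fineK Dfin) -EFinM ltry.
  split=> //; rewrite (le_trans (le_normr_Rintegral _ _))//.
  rewrite /Rintegral -lee_fin EFinM (fineK Dfin) fineK//.
  by rewrite ge0_fin_numE ?integral_ge0// (le_lt_trans le2)// -(fineK Dfin) -EFinM ltry.
have [i1 b1] := real_part _ m1 (fun t => Re_le_cnorm _).
have [i2 b2] := real_part _ m2 (fun t => Im_le_cnorm _).
split; first by split.
rewrite (le_trans (cnorm_le_ReIm _))//= -mulrA mulrDl mul1r; exact: lerD.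
Qed.

End lower_integral.

(** * Scalar forms of Bochner integrals *)

Section bochner_forms.
Context {R : realType} {d} {T : measurableType d} {H : hilbertType R}.
Implicit Types (s : seq (set T * (H -> H))) (u v : T -> H).

(** A weak form of measurability of the pair: it makes forms of step functions measurable, and pairs
    of constant or of continuous functions have it. *)
Definition scalar_measurable u v := forall B : H -> H, bounded_op B ->
  cmeasurable (fun t => hdot (B (v t)) (u t)).

Lemma linear_sub (A B : H -> H) : linear A -> linear B -> linear (fun x => A x - B x).
Proof. by move=> lA lB a x y; rewrite lA lB opprD addrACA scalerBr. Qed.

Lemma step_form s t x y :
  hdot (step s t x) y = \sum_(p <- s) \1_(p.1) t * hdot (p.2 x) y.
Proof.
by rewrite /step fct_sumE hdot_suml; apply: eq_bigr => p _; rewrite hdotZl.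
Qed.

Lemma step_integral_form (mu : set T -> \bar R) s x y :
  hdot (step_integral mu s x) y =
  \sum_(p <- s) (fine (mu p.1))%:C%C * hdot (p.2 x) y.
Proof.
by rewrite /step_integral fct_sumE hdot_suml; apply: eq_bigr => p _; rewrite hdotZl.
Qed.

Lemma lincomb_linear s (c : set T * (H -> H) -> R[i]) :
  (forall p, p \in s -> linear p.2) -> linear (\sum_(p <- s) c p *: p.2).
Proof.
move=> ls a x y; rewrite !fct_sumE scaler_sumr -big_split.
apply: eq_big_seq => p ps /=.
change (c p *: p.2 (a *: x + y) = a *: (c p *: p.2 x) + c p *: p.2 y).
by rewrite (ls _ ps) scalerDr !scalerA mulrC.
Qed.

Variable mu : {finite_measure set T -> \bar R}.
Variables (F : T -> H -> H) (I : H -> H).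
Hypothesis FI : is_bochner_integral (@trace_norm R H) mu F I.

(** Some approximation error at t has finite trace norm, hence is a bounded operator, and F t is the
    linear value of a step function minus this error. *)
Lemma bochner_integrand_linear t : linear (F t).
Proof.
have [s [sP sF _ _]] := FI.
have [N _ /(_ N (leqnn N))/= hN] :=
  (ecvg0P (fun n => trace_norm_ge0 _)).1 (sF t) 1 ltr01.
have [l1 _] := trace_norm_bounded (lt_trans hN (ltry _)).
have l2 : linear (step (s N) t).
  by apply: lincomb_linear => p /sP[_ /trace_norm_bounded[]].
have -> : F t = (fun x => step (s N) t x - (step (s N) t - F t) x).
  by apply/funext => x; rewrite /= opprB addrC subrK.
exact: linear_sub.
Qed.

Lemma bochner_integral_linear : linear I.
Proof.
have [s [sP _ _ sI]] := FI.
have [N _ /(_ N (leqnn N))/= hN] :=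
  (ecvg0P (fun n => trace_norm_ge0 _)).1 sI 1 ltr01.
have [l1 _] := trace_norm_bounded (lt_trans hN (ltry _)).
have l2 : linear (step_integral mu (s N)).
  by apply: lincomb_linear => p /sP[_ /trace_norm_bounded[]].
have -> : I = (fun x => step_integral mu (s N) x - (step_integral mu (s N) - I) x).
  by apply/funext => x; rewrite /= opprB addrC subrK.
exact: linear_sub.
Qed.

Lemma step_form_measurable s u v :
  (forall p, p \in s -> measurable p.1 /\ (trace_norm p.2 < +oo)%E) ->
  scalar_measurable u v -> cmeasurable (fun t => hdot (step s t (v t)) (u t)).
Proof.
move=> sP muv; under eq_fun do rewrite step_form.
apply: cmeasurable_sum_seq => p /sP[mp Np]; apply: cmeasurableM.
  exact: cmeasurable_indic.
by apply: muv; exact: trace_norm_bounded.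
Qed.

Lemma step_form_le s u v (a b : R) t : 0 <= a -> 0 <= b ->
  (forall p, p \in s -> measurable p.1 /\ (trace_norm p.2 < +oo)%E) ->
  (forall t, hnorm (u t) <= a) -> (forall t, hnorm (v t) <= b) ->
  cnorm (hdot (step s t (v t)) (u t)) <=
  (\sum_(p <- s) fine (trace_norm p.2)) * (a * b).
Proof.
move=> a0 b0 sP ua vb; rewrite step_form (le_trans (cnorm_sum _ _ _))// mulr_suml.
rewrite big_seq [leRHS]big_seq; apply: ler_sum => p /sP[_ Np].
rewrite cnormM indicE cnorm_nat.
rewrite (@le_trans _ _ (cnorm (hdot (p.2 (v t)) (u t))))//.
  by rewrite ler_piMl ?cnorm_ge0// lern1; case: (_ \in _).
have N0 : 0 <= fine (trace_norm p.2) by rewrite fine_ge0// trace_norm_ge0.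
rewrite (le_trans (hdot_le _ _))// [a * b]mulrC mulrA ler_pM ?hnorm_ge0//.
by rewrite (le_trans (trace_normP Np _))// ler_wpM2l.
Qed.

(** Positivity of a and b, rather than nonnegativity, makes the right side +oo whenever the trace
    norm is. *)
Lemma trace_norm_form_le (A : H -> H) (x y : H) (a b : R) : 0 < a -> 0 < b ->
  hnorm y <= a -> hnorm x <= b ->
  ((cnorm (hdot (A x) y))%:E <= (a * b)%:E * trace_norm A)%E.
Proof.
move=> a0 b0 ya xb; have := trace_norm_ge0 A.
case AE : (trace_norm A) => [r||] // r0; last first.
  by rewrite gt0_muley ?lte_fin ?mulr_gt0// leey.
have := @trace_normP _ _ A; rewrite AE => /(_ (ltry _)) /= AP.
rewrite -EFinM lee_fin (le_trans (hdot_le _ _))// -mulrA mulrC ler_pM ?hnorm_ge0//.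
by rewrite (le_trans (AP x))// mulrC ler_wpM2r.
Qed.

(** M is read off from one step function whose integrated distance to F is at most 1. It takes the
    place of the integral of the trace norm of F, a function not known to be measurable. *)
Lemma bochner_form_bound : exists2 M : R, 0 <= M &
  forall u v (a b : R), 0 < a -> 0 < b ->
    (forall t, hnorm (u t) <= a) -> (forall t, hnorm (v t) <= b) ->
    scalar_measurable u v ->
    cintegrable mu (fun t => hdot (F t (v t)) (u t)) /\
    cnorm (complex_integral mu (fun t => hdot (F t (v t)) (u t))) <= M * (a * b).
Proof.
have [s [sP sF sI _]] := FI.
have N0 n t : (0 <= trace_norm (step (s n) t - F t)%R)%E by exact: trace_norm_ge0.
have [|N _ /(_ N (leqnn N))/= hN] := (ecvg0P _).1 sI 1 ltr01.
  by move=> n; apply: integral_ge0.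
have {}hN : (\int[mu]_t trace_norm (step (s N) t - F t)%R <= 1)%E by exact: ltW.
(* The first term bounds the form of the step function, the final 2 that of the error. *)
exists (2 * (\sum_(p <- s N) fine (trace_norm p.2)) * fine (mu setT) + 2).
  rewrite addr_ge0// !mulr_ge0 ?fine_ge0//.
  by rewrite sumr_ge0// => p _; rewrite fine_ge0// trace_norm_ge0.
move=> u v a b a0 b0 ua vb muv.
have mn n := step_form_measurable (sP n) muv.
have psiD n t : ((cnorm (hdot (step (s n) t (v t)) (u t) - hdot (F t (v t)) (u t)))%:E
    <= (a * b)%:E * trace_norm (step (s n) t - F t)%R)%E.
  by rewrite -hdotBl; exact: (@trace_norm_form_le (step (s n) t - F t)).
have ab0 : 0 < a * b by rewrite mulr_gt0.
have mphi : cmeasurable (fun t => hdot (F t (v t)) (u t)).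
  apply: (cmeasurable_lim mn) => t e e0.
  have /= := (ecvg0P (N0^~ t)).1 (sF t) (e / (a * b)) (divr_gt0 e0 ab0).
  move=> h; apply: filterS h => n hn.
  rewrite -lte_fin (le_lt_trans (psiD n t))//.
  by rewrite -lte_pdivlMl// -EFinM mulrC.
have [i1 b1] : cintegrable mu (fun t => hdot (step (s N) t (v t)) (u t)) /\
   cnorm (complex_integral mu (fun t => hdot (step (s N) t (v t)) (u t))) <=
     2 * (\sum_(p <- s N) fine (trace_norm p.2)) * fine (mu setT) * (a * b).
  have le t := step_form_le t (ltW a0) (ltW b0) (sP N) ua vb.
  split; first exact: (cintegrable_bounded mu (mn N) le).
  by rewrite (le_trans (cint_bounded mu (mn N) le))// le_eqVlt; apply/orP; left; apply/eqP; ring.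
have := cint_dominated (cmeasurableB (mn N) mphi) ab0 (N0 N) (psiD N) (le_lt_trans hN (ltry _)).
move=> [i2 b2].
have E : (fun t => hdot (F t (v t)) (u t)) = (fun t =>
    hdot (step (s N) t (v t)) (u t) -
    (hdot (step (s N) t (v t)) (u t) - hdot (F t (v t)) (u t))).
  by apply/funext => t; rewrite opprB addrC subrK.
have iF : cintegrable mu (fun t => hdot (F t (v t)) (u t)).
  by rewrite E; exact: cintegrableB.
split=> //; rewrite E cintB// (le_trans (cnormB _ _))// mulrDl lerD//.
rewrite (le_trans b2)// ler_piMr ?mulr_ge0 ?(ltW a0) ?(ltW b0)//.
rewrite -lee_fin fineK// ge0_fin_numE ?integral_ge0//.
by rewrite (le_lt_trans hN)// ltry.
Qed.

(** For step functions the identity is a finite sum, and both errors tend to zero. Every Bochner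
    integral is thus determined by scalar integrals, whatever the approximating sequence. *)
Lemma bochner_form x y : cintegrable mu (fun t => hdot (F t x) y) /\
  complex_integral mu (fun t => hdot (F t x) y) = hdot (I x) y.
Proof.
have [M M0 MP] := bochner_form_bound.
pose a := hnorm y + 1; pose b := hnorm x + 1.
have a0 : 0 < a by rewrite ltr_wpDl ?hnorm_ge0.
have b0 : 0 < b by rewrite ltr_wpDl ?hnorm_ge0.
have mxy : scalar_measurable (fun=> y) (fun=> x) by move=> B _; exact: cmeasurable_cst.
have ya (t : T) : hnorm y <= a by rewrite lerDl.
have xb (t : T) : hnorm x <= b by rewrite lerDl.
have [iF _] := MP _ _ a b a0 b0 ya xb mxy; split=> //.
apply/eqP; rewrite -subr_eq0; apply/eqP/cnorm_eq0/eqP.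
rewrite eq_le cnorm_ge0 andbT; apply/ler_addgt0Pl => e e0; rewrite addr0.
have [s [sP sF sI sJ]] := FI.
have N0 n t : (0 <= trace_norm (step (s n) t - F t)%R)%E by exact: trace_norm_ge0.
have ab0 : 0 < a * b by rewrite mulr_gt0.
(* The integrand costs two thirds of e, because of the factor 2 in [cint_dominated], and the
   integral one third. *)
have e3 : 0 < e / (3 * (a * b)) by rewrite divr_gt0// mulr_gt0.
have h1 := (ecvg0P (fun n => integral_ge0 mu (fun t _ => N0 n t))).1 sI _ e3.
have h2 := (ecvg0P (fun n => trace_norm_ge0 _)).1 sJ _ e3.
have [n [/= {}h1 {}h2]] := filter_ex (filterI h1 h2).
have mn := step_form_measurable (sP n) mxy.
have le t := step_form_le t (ltW a0) (ltW b0) (sP n) ya xb.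
have i1 := cintegrable_bounded mu mn le.
have psiD t : ((cnorm (hdot (step (s n) t x) y - hdot (F t x) y))%:E
    <= (a * b)%:E * trace_norm (step (s n) t - F t)%R)%E.
  by rewrite -hdotBl; apply: (@trace_norm_form_le (step (s n) t - F t)) => //; [exact: (ya t) | exact: (xb t)].
have [i2 b2] := cint_dominated (cmeasurableB mn (cintegrable_measurable iF)) ab0
  (N0 n) psiD (lt_trans h1 (ltry _)).
have E1 : complex_integral mu (fun t => hdot (step (s n) t x) y) =
    hdot (step_integral mu (s n) x) y.
  under [in LHS]eq_fun do rewrite step_form.
  rewrite step_integral_form.
  have ip p : p \in s n -> cintegrable mu (fun t => \1_(p.1) t * hdot (p.2 x) y) /\
      complex_integral mu (fun t => \1_(p.1) t * hdot (p.2 x) y) =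
      (fine (mu p.1))%:C%C * hdot (p.2 x) y.
    move=> /sP[mp _]; under eq_fun do rewrite mulrC.
    have [i c] := cint_indic mu mp.
    by split; [exact: cintegrableZ | rewrite cintZ// c mulrC].
  have [|_ ->] := cint_sum_both (mu := mu) (r := s n)
     (F := fun p t => \1_(p.1) t * hdot (p.2 x) y); first by move=> p /ip[].
  by apply: eq_big_seq => p /ip[].
rewrite cintB// E1 in b2.
have b3 : cnorm (hdot (step_integral mu (s n) x) y - hdot (I x) y) <=
    e / (3 * (a * b)) * (a * b).
  rewrite -hdotBl -lee_fin (@le_trans _ _ ((a * b)%:E * trace_norm (step_integral mu (s n) - I)%R)%E)//.
    by apply: (@trace_norm_form_le (step_integral mu (s n) - I)) => //; rewrite lerDl.
  by rewrite [X in (_ <= X)%E]EFinM muleC lee_wpmul2r ?lee_fin// ltW.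
rewrite -(subrK (hdot (step_integral mu (s n) x) y) (complex_integral _ _)) -addrA.
rewrite (le_trans (cnormD _ _))// cnorm_distC.
have b4 : fine (\int[mu]_t trace_norm (step (s n) t - F t)%R)%E <= e / (3 * (a * b)).
  rewrite -lee_fin fineK; first exact: ltW.
  by rewrite ge0_fin_numE ?integral_ge0// (lt_trans h1)// ltry.
have e3E : e / (3 * (a * b)) * (a * b) = e / 3 by field; rewrite !gt_eqF.
rewrite e3E in b3.
have b5 : 2 * (a * b) * fine (\int[mu]_t trace_norm (step (s n) t - F t)%R)%E <= 2 * (e / 3).
  rewrite -e3E -mulrA [e / _ * _]mulrC; apply: ler_wpM2l => //; apply: ler_wpM2l => //; exact: ltW.
rewrite (le_trans (lerD (le_trans b2 b5) b3))// le_eqVlt; apply/orP; left; apply/eqP.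
by field.
Qed.

End bochner_forms.

Section step_approximation.
Context {R : realType} {d} {T : measurableType d}.

Lemma ecvg0D (u v : nat -> \bar R) :
  u n @[n --> \oo] --> 0%E -> v n @[n --> \oo] --> 0%E ->
  (u n + v n)%E @[n --> \oo] --> 0%E.
Proof.
move=> u0 v0; have h : (u \+ v)%E n @[n --> \oo] --> (0 + 0)%E by exact: cvgeD.
by rewrite adde0 in h.
Qed.

Lemma ecvg0_sum I (r : seq I) (u : I -> nat -> \bar R) :
  (forall i, u i n @[n --> \oo] --> 0%E) ->
  (\sum_(i <- r) u i n)%E @[n --> \oo] --> 0%E.
Proof.
move=> u0; elim: r => [|i r IH].
  by under eq_fun do rewrite big_nil; exact: cvg_cst.
by under eq_fun do rewrite big_cons; exact: (ecvg0D (u0 i) IH).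
Qed.

Lemma measurable_cnorm (F : T -> R[i]) : cmeasurable F ->
  measurable_fun setT (fun t => cnorm (F t)).
Proof.
move=> [m1 m2].
rewrite (_ : (fun _ => _) = Num.sqrt \o (fun t => complex.Re (F t) ^+ 2 + complex.Im (F t) ^+ 2)).
  apply: measurableT_comp; first by apply: continuous_measurable_fun; exact: sqrt_continuous.
  by apply: measurable_funD; exact: measurable_funX.
apply/funext => t; rewrite /= -cnorm_sqr sqrtr_sqr ger0_norm//; exact: cnorm_ge0.
Qed.

Variable mu : {measure set T -> \bar R}.

Import HBSimple.

(** The decomposition into level sets; z will be 1 for the real part and i for the imaginary
    part. *)
Lemma sfun_steps (k : {sfun T >-> R}) (z : R[i]) t :
  \sum_(p <- [seq (k @^-1` [set y], y%:C%C * z) | y <- finmap.enum_fset (fset_set (range k))])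
    \1_(p.1) t * p.2 = (k t)%:C%C * z.
Proof.
rewrite big_map [in RHS](fimfunE k t) fsbig_finite//= rmorph_sum /= mulr_suml.
apply: eq_bigr => y _; rewrite rmorphM /= mulrC mulrAC; congr (_ * _ * _).
by rewrite !indicE; case: (_ \in _).
Qed.

Lemma cintegrable_approx (phi : T -> R[i]) : cintegrable mu phi ->
  exists s : nat -> seq (set T * R[i]),
    [/\ forall n p, p \in s n -> measurable p.1,
        forall t, (cnorm (\sum_(p <- s n) \1_(p.1) t * p.2 - phi t))%:E
          @[n --> \oo] --> 0%E &
        (\int[mu]_t (cnorm (\sum_(p <- s n) \1_(p.1) t * p.2 - phi t))%:E)%E
          @[n --> \oo] --> 0%E].
Proof.
move=> [i1 i2].
have [k [ki kp kl]] := approximation_sfun_integrable measurableT i1.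
have [l [li lp ll]] := approximation_sfun_integrable measurableT i2.
pose st (f : {sfun T >-> R}) (z : R[i]) :=
  [seq (f @^-1` [set y], y%:C%C * z) | y <- finmap.enum_fset (fset_set (range f))].
exists (fun n => st (k n) 1 ++ st (l n) (0 +i* 1)%C).
have E n t : \sum_(p <- st (k n) 1 ++ st (l n) (0 +i* 1)%C) \1_(p.1) t * p.2 =
    (k n t +i* l n t)%C.
  rewrite big_cat /= !sfun_steps.
  by apply: complex_eq; rewrite ?(ReD, ImD, ReM, ImM) /=; ring.
have le n t : cnorm (\sum_(p <- st (k n) 1 ++ st (l n) (0 +i* 1)%C) \1_(p.1) t * p.2 - phi t) <=
    `|complex.Re (phi t) - k n t| + `|complex.Im (phi t) - l n t|.
  by rewrite E (le_trans (cnorm_le_ReIm _))// ReB ImB /= distrC [X in _ + X]distrC.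
have lim0 (f : nat -> {sfun T >-> R}) (h : T -> R) t :
   (EFin \o f ^~ t @ \oo --> (h t)%:E) -> (`|h t - f n t|%:E)%E @[n --> \oo] --> 0%E.
  move=> /fine_cvgP[_ fh]; apply/ecvg0P => [n|e e0]; first by rewrite lee_fin.
  by move/cvgrPdist_lt : fh => /(_ e e0); apply: filterS => n /=; rewrite lte_fin.
split.
- move=> n p; rewrite mem_cat => /orP[|] /mapP[y _ ->] /=; exact: measurable_sfunP.
- move=> t; apply: (@ecvg0_le _ _ (fun n =>
    (`|complex.Re (phi t) - k n t|%:E + `|complex.Im (phi t) - l n t|%:E)%E)).
  + by move=> n; rewrite lee_fin cnorm_ge0.
  + by move=> n; rewrite -EFinD lee_fin le.
  + by apply: ecvg0D; [exact: (lim0 k (fun t => complex.Re (phi t)) _ (kp t _))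
                      | exact: (lim0 l (fun t => complex.Im (phi t)) _ (lp t _))].
- apply: (@ecvg0_le _ _ (fun n =>
    (\int[mu]_z `|(EFin \o (fun t => complex.Re (phi t))) z - (k n z)%:E| +
     \int[mu]_z `|(EFin \o (fun t => complex.Im (phi t))) z - (l n z)%:E|)%E)).
  + by move=> n; apply: integral_ge0 => t _; rewrite lee_fin cnorm_ge0.
  + move=> n.
    have [m1 m2] : cmeasurable phi by apply: (@cintegrable_measurable _ _ _ mu); split.
    have mk : measurable_fun setT (k n) by [].
    have ml : measurable_fun setT (l n) by [].
    rewrite -ge0_integralD//.
    * apply: ge0_le_integral_nomeas => t; first by rewrite lee_fin cnorm_ge0.
      exact: (le n t).
    * apply: measurableT_comp => //; apply: emeasurable_funB; exact/measurable_EFinP.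
    * apply: measurableT_comp => //; apply: emeasurable_funB; exact/measurable_EFinP.
  + exact: ecvg0D.
Qed.

End step_approximation.

(** * Bochner integrals of operators on a finite-dimensional space *)

Section bochner_finite_dimensional.
Context {R : realType} {d} {T : measurableType d} {G : hilbertType R}.
Variables (m : nat) (g : 'I_m -> G) (fg : orthonormal_frame g).
Variable mu : {finite_measure set T -> \bar R}.

(** Each entry is approximated by scalar step functions, and these are reassembled with matrix
    units; the entrywise bound on the trace norm controls the errors. *)
Lemma bochner_frame_exists (F : T -> G -> G) : (forall t, linear (F t)) ->
  (forall i j, cintegrable mu (fun t => hdot (F t (g i)) (g j))) ->
  exists I, is_bochner_integral (@trace_norm R G) mu F I.
Proof.
move=> lF iF.
pose phi i j t := hdot (F t (g i)) (g j).
have /choice[s sP] (ij : 'I_m * 'I_m) := cintegrable_approx (iF ij.1 ij.2).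
pose S ij n t : R[i] := \sum_(p <- s ij n) \1_(p.1) t * p.2.
(* The matrix unit that sends g_i to g_j. *)
pose E (ij : 'I_m * 'I_m) : G -> G := fun x => hdot x (g ij.1) *: g ij.2.
have lE ij : linear (E ij).
  by move=> a x y; rewrite /E hdotDl hdotZl scalerDl scalerA.
have Eg i j ij : hdot (E ij (g i)) (g j) = (ij == (i, j))%:R.
  rewrite /E hdotZl !fg.1 -natrM mulnb; case: ij => k l /=.
  by rewrite xpair_eqE [k == i]eq_sym.
have ent i j (c : 'I_m * 'I_m -> R[i]) :
  hdot ((\sum_ij c ij *: E ij) (g i)) (g j) = c (i, j).
  rewrite fct_sumE hdot_suml (bigD1 (i, j))//= hdotZl Eg eqxx mulr1 big1 ?addr0//.
  by move=> ij ne; rewrite hdotZl Eg (negbTE ne) mulr0.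
have lsum (c : 'I_m * 'I_m -> R[i]) : linear (\sum_ij c ij *: E ij).
  move=> a x y; rewrite !fct_sumE scaler_sumr -big_split; apply: eq_bigr => ij _ /=.
  change (c ij *: E ij (a *: x + y) = a *: (c ij *: E ij x) + c ij *: E ij y).
  by rewrite lE; move: (E ij x) (E ij y) => ? ?; rewrite scalerDr !scalerA mulrC.
pose r n := flatten [seq [seq (p.1, p.2 *: E ij) | p <- s ij n] | ij <- enum {: 'I_m * 'I_m}].
have stepE n t : step (r n) t = \sum_ij S ij n t *: E ij.
  rewrite /step /r big_flatten big_map big_enum; apply: eq_bigr => ij _.
  by rewrite big_map scaler_suml; apply: eq_bigr => p _; rewrite scalerA.
have intE n : step_integral mu (r n) =
    \sum_ij (\sum_(p <- s ij n) (fine (mu p.1))%:C%C * p.2) *: E ij.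
  rewrite /step_integral /r big_flatten big_map big_enum; apply: eq_bigr => ij _.
  by rewrite big_map scaler_suml; apply: eq_bigr => p _; rewrite scalerA.
have cS ij n : cintegrable mu (S ij n) /\
    complex_integral mu (S ij n) = \sum_(p <- s ij n) (fine (mu p.1))%:C%C * p.2.
  have [sm _ _] := sP ij.
  have ip p : p \in s ij n -> cintegrable mu (fun t => \1_(p.1) t * p.2) /\
      complex_integral mu (fun t => \1_(p.1) t * p.2) = (fine (mu p.1))%:C%C * p.2.
    move=> /sm mp; under eq_fun do rewrite mulrC.
    have [i c] := cint_indic mu mp.
    by split; [exact: cintegrableZ | rewrite cintZ// c mulrC].
  have [|h1 h2] := cint_sum_both (mu := mu) (r := s ij n)
     (F := fun p t => \1_(p.1) t * p.2); first by move=> p /ip[].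
  by split=> //; rewrite h2; apply: eq_big_seq => p /ip[].
pose I := \sum_ij complex_integral mu (phi ij.1 ij.2) *: E ij.
have stepF n t : (trace_norm (step (r n) t - F t)%R <=
    \sum_i \sum_j (cnorm (S (i, j) n t - phi i j t))%:E)%E.
  have l : linear (step (r n) t - F t) by rewrite stepE; exact: linear_sub.
  rewrite (le_trans (trace_norm_frame_le fg l))// -sumEFin.
  apply: lee_sum => i _; rewrite -sumEFin; apply: lee_sum => j _.
  by rewrite lee_fin hdotBl stepE ent.
exists I, r; split.
- move=> n p /flatten_mapP[ij _ /mapP[q qs ->]] /=; split.
    by have [sm _ _] := sP ij; exact: sm qs.
  apply: (trace_norm_frame_fin fg) => a x y.
  change (q.2 *: E ij (a *: x + y) = a *: (q.2 *: E ij x) + q.2 *: E ij y).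
  by rewrite lE; move: (E ij x) (E ij y) => ? ?; rewrite scalerDr !scalerA mulrC.
- move=> t; apply: (ecvg0_le _ (fun n => stepF n t)) => [n|]; first exact: trace_norm_ge0.
  apply: ecvg0_sum => i; apply: ecvg0_sum => j.
  by have [_ sp _] := sP (i, j); exact: sp.
- apply: (@ecvg0_le _ _ (fun n => \sum_i \sum_j \int[mu]_t (cnorm (S (i, j) n t - phi i j t))%:E)%E).
  + by move=> n; apply: integral_ge0 => t _; exact: trace_norm_ge0.
  + move=> n.
    have mD i j : measurable_fun setT (fun t => (cnorm (S (i, j) n t - phi i j t))%:E).
      apply/measurable_EFinP/measurable_cnorm; apply: cmeasurableB.
        by have [/cintegrable_measurable] := cS (i, j) n.
      exact: cintegrable_measurable (iF i j).
    rewrite (le_trans (ge0_le_integral_nomeas mu (fun t => trace_norm_ge0 _) (stepF n)))//.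
    rewrite ge0_integral_sum//=.
    * apply: lee_sum => i _; rewrite ge0_integral_sum// => j t _.
      by rewrite lee_fin cnorm_ge0.
    * by move=> i; exact: emeasurable_sum.
    * by move=> i t _; apply: sume_ge0 => j _; rewrite lee_fin cnorm_ge0.
  + apply: ecvg0_sum => i; apply: ecvg0_sum => j.
    by have [_ _ sl] := sP (i, j); exact: sl.
- have bnd n : (trace_norm (step_integral mu (r n) - I)%R <=
    \sum_i \sum_j (2%:E * \int[mu]_t (cnorm (S (i, j) n t - phi i j t))%:E))%E.
    have l : linear (step_integral mu (r n) - I) by rewrite intE; apply: linear_sub; exact: lsum.
    rewrite (le_trans (trace_norm_frame_le fg l))// -sumEFin.
    apply: lee_sum => i _; rewrite -sumEFin; apply: lee_sum => j _.
    have [i1 e1] := cS (i, j) n.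
    rewrite hdotBl intE !ent -e1 /= -cintB//; last exact: iF.
    set D := (\int[mu]_t _)%E.
    have D0 : (0 <= D)%E by apply: integral_ge0 => t _; rewrite lee_fin cnorm_ge0.
    have [->|Doo] := eqVneq D +oo%E; first by rewrite gt0_muley// leey.
    have Dlt : (D < +oo)%E by rewrite lt_neqAle Doo leey.
    have mS := cmeasurableB (cintegrable_measurable i1) (cintegrable_measurable (iF i j)).
    have [t|t||_ h] := cint_dominated (mu := mu) (c := 1)
      (D := fun t => (cnorm (S (i, j) n t - phi i j t))%:E) mS ltr01.
    + by rewrite lee_fin cnorm_ge0.
    + by rewrite mul1e.
    + exact: Dlt.
    have Dfin : D \is a fin_num by rewrite ge0_fin_numE.
    by rewrite -(fineK Dfin) -EFinM lee_fin (le_trans h)// mulr1.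
  apply: (ecvg0_le _ bnd) => [n|]; first exact: trace_norm_ge0.
  apply: ecvg0_sum => i; apply: ecvg0_sum => j.
  have [_ _ sl] := sP (i, j); rewrite -[X in _ --> X](mule0 2%:E).
  by apply: cvgeZl.
Qed.

(** [bochner] is a choice with default 0; existence makes it a genuine integral, and [bochner_form]
    then forces its entries. *)
Lemma bochner_frame (F : T -> G -> G) : (forall t, linear (F t)) ->
  (forall i j, cintegrable mu (fun t => hdot (F t (g i)) (g j))) ->
  linear (bochner (@trace_norm R G) mu F) /\
  forall x y, hdot (bochner (@trace_norm R G) mu F x) y =
    complex_integral mu (fun t => hdot (F t x) y).
Proof.
move=> lF iF.
have /(@xgetPex _ (0 : G -> G) [set I | is_bochner_integral (@trace_norm R G) mu F I]) :=
  bochner_frame_exists lF iF.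
rewrite -/(bochner _ _ _) => /= FI; split; first exact: bochner_integral_linear FI.
by move=> x y; have [_ ->] := bochner_form FI x y.
Qed.

End bochner_finite_dimensional.

(** * The ergodic theorem *)

Section integral_transfer.
Context {R : realType} {d1 d2} {X : measurableType d1} {Y : measurableType d2}.
Variables (mu : {measure set X -> \bar R}) (nu : {measure set Y -> \bar R}).
Variables (phi : X -> Y) (mphi : measurable_fun setT phi).
Hypothesis nuE : forall A, measurable A -> nu A = mu (phi @^-1` A).

(** [nuE] identifies nu with the pushforward on measurable sets. This one form serves the law of the
    path, the invariance of a measure, and the comparison of [Leb_torus] with a uniform law, where
    phi is the identity. *)
Lemma ge0_integral_transfer (f : Y -> \bar R) : measurable_fun setT f ->
  (forall y, 0 <= f y)%E -> (\int[nu]_y f y = \int[mu]_x f (phi x))%E.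
Proof.
move=> mf f0; transitivity (\int[pushforward mu phi]_y f y)%E.
  by apply: eq_measure_integral => A mA _; rewrite nuE.
by rewrite ge0_integral_pushforward.
Qed.

Lemma integrable_transfer (f : Y -> R) : measurable_fun setT f ->
  nu.-integrable setT (EFin \o f) <-> mu.-integrable setT (EFin \o (f \o phi)).
Proof.
move=> mf; have mfp : measurable_fun setT (f \o phi) by exact: measurableT_comp.
have E : (\int[nu]_y `|(f y)%:E| = \int[mu]_x `|(f (phi x))%:E|)%E.
  rewrite (@ge0_integral_transfer (fun y => `|(f y)%:E|%E))//.
  by apply: measurableT_comp => //; exact/measurable_EFinP.
split=> /integrableP[_ fi]; apply/integrableP; split;
  try exact/measurable_EFinP; by rewrite ?E in fi *.
Qed.

Lemma Rintegral_transfer (f : Y -> R) : measurable_fun setT f ->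
  nu.-integrable setT (EFin \o f) ->
  Rintegral nu setT f = Rintegral mu setT (f \o phi).
Proof.
move=> mf fi; congr fine; rewrite integralE [RHS]integralE.
have mfe : measurable_fun setT (EFin \o f) by exact/measurable_EFinP.
congr (_ - _)%E.
  rewrite [LHS](ge0_integral_transfer (measurable_funepos mfe))//.
  by apply: eq_integral => x _; rewrite !funeposE.
rewrite [LHS](ge0_integral_transfer (measurable_funeneg mfe))//.
by apply: eq_integral => x _; rewrite !funenegE.
Qed.

Lemma ae_transfer (Q : Y -> Prop) : {ae nu, forall y, Q y} -> {ae mu, forall x, Q (phi x)}.
Proof.
move=> [N [mN N0 QN]]; exists (phi @^-1` N); split.
- by rewrite -[X in measurable X]setTI; exact: mphi.
- by rewrite -nuE.
- by move=> x /= Qx; exact: QN.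
Qed.

End integral_transfer.

Section almost_everywhere_countable.
Context {R : realType} {d} {T : measurableType d} (mu : {measure set T -> \bar R}).

Lemma ae_forall_nat (Q : nat -> T -> Prop) :
  (forall n, {ae mu, forall x, Q n x}) -> {ae mu, forall x, forall n, Q n x}.
Proof.
move=> h; change (mu.-negligible (~` [set x | forall n, Q n x])).
have -> : ~` [set x | forall n, Q n x] = \bigcup_n ~` [set x | Q n x].
  by apply/seteqP; split=> [x /existsNP[n Qn]|x [n _ Qn] Qx]; [exists n | exact: Qn].
by apply: negligible_bigcup => n; exact: h.
Qed.

Lemma ae_forall_countable (I : choiceType) (D : set I) (Q : I -> T -> Prop) : countable D ->
  (forall i, D i -> {ae mu, forall x, Q i x}) ->
  {ae mu, forall x, forall i, D i -> Q i x}.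
Proof.
move=> /countable_injP[f finj] h.
(* Each natural number codes at most one index of D, so the exceptional set for n is that of a
   single index. *)
have hn n : {ae mu, forall x, forall i, D i -> f i = n -> Q i x}.
  have [[i [Di fi]]|ni] := pselect (exists i, D i /\ f i = n); last first.
    by apply: aeW => x i Di fi; exfalso; apply: ni; exists i.
  apply: filterS (h i Di) => x Qi j Dj fj.
  by rewrite (finj j i) ?inE// fj.
by apply: filterS (ae_forall_nat hn) => x Qx i Di; exact: Qx Di erefl.
Qed.

End almost_everywhere_countable.

(** S is a Birkhoff sum and m the mean; K and L come from the one-sided bounds for g and for - g,
    and become negligible after division by n. *)
Lemma birkhoff_arith (R : realFieldType) (S K L m r e n : R) : 0 < n -> r < e / 2 ->
  `|K| + `|L| < n * (e / 2) -> S <= K + (m + r) * n -> - S <= L + (- m + r) * n ->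
  `|m - S / n| < e.
Proof.
move=> n0 re KL h1 h2; have := ler_norm K; have := ler_norm L.
have := normr_ge0 K; have := normr_ge0 L.
move: (`|K|) (`|L|) KL => k l KL l0 k0 lL kK.
have rn : r * n < e / 2 * n by rewrite ltr_pM2r.
rewrite ltr_norml; apply/andP; split; rewrite -(ltr_pM2r n0) mulrBl divfK ?gt_eqF//; lra.
Qed.

(* Birkhoff's theorem in the ergodic case.  With M_n = max(0, S_1, ..., S_n),
   M_{n+1} - M_n o tau = max(- M_n o tau, g) has nonnegative integral and, where
   M_n is unbounded, decreases to g; hence \int g < 0 makes M_n bounded a.e. *)
Section birkhoff.
Context {R : realType} {d} {T : measurableType d} (P : probability T R).
Variables (tau : T -> T) (mtau : measurable_fun setT tau).
Hypothesis tauP : forall A, measurable A -> P A = P (tau @^-1` A).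
Hypothesis erg : forall A, measurable A -> tau @^-1` A = A -> P A = 0%E \/ P A = 1%E.

Let birkhoff_sum (g : T -> R) n x := \sum_(k < n) g (iter k tau x).

(** This is max(0, S_1, ..., S_n); the recursion through tau gives measurability, integrability and
    the increment formula by induction. *)
Fixpoint birkhoff_max (g : T -> R) n x : R :=
  if n is n'.+1 then Num.max 0 (g x + birkhoff_max g n' (tau x)) else 0.

Lemma birkhoff_sumS g n x : birkhoff_sum g n.+1 x = g x + birkhoff_sum g n (tau x).
Proof.
rewrite /birkhoff_sum big_ord_recl /=; congr (_ + _).
by apply: eq_bigr => k _; rewrite -iterSr.
Qed.

Lemma birkhoff_max_ge0 g n x : 0 <= birkhoff_max g n x.
Proof. by case: n => //= n; rewrite le_max lexx. Qed.

Lemma birkhoff_max_incr g n x : birkhoff_max g n x <= birkhoff_max g n.+1 x.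
Proof.
elim: n x => [|n IH] x; first by rewrite birkhoff_max_ge0.
by rewrite /= in IH *; rewrite ge_max !le_max lexx /= lerD2l IH orbT.
Qed.

Lemma birkhoff_max_nd g n m x : (n <= m)%N -> birkhoff_max g n x <= birkhoff_max g m x.
Proof.
by move=> /subnK <-; elim: (m - n)%N => //= k IH; exact: le_trans (birkhoff_max_incr g _ x).
Qed.

Lemma birkhoff_sum_le_max g n x : birkhoff_sum g n x <= birkhoff_max g n x.
Proof.
elim: n x => [|n IH] x; first by rewrite /birkhoff_sum big_ord0.
by rewrite birkhoff_sumS /= le_max lerD2l IH orbT.
Qed.

Lemma measurable_birkhoff_max g n : measurable_fun setT g ->
  measurable_fun setT (birkhoff_max g n).
Proof.
move=> mg; elim: n => [|n IH]; first exact: measurable_cst.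
apply: measurable_maxr; first exact: measurable_cst.
by apply: measurable_funD => //; exact: measurableT_comp.
Qed.

Lemma integrable_tau (f : T -> R) : P.-integrable setT (EFin \o f) ->
  P.-integrable setT (EFin \o (f \o tau)) /\
  Rintegral P setT (f \o tau) = Rintegral P setT f.
Proof.
move=> fi; have mf : measurable_fun setT f by move/measurable_int : fi => /measurable_EFinP.
split; first exact: ((integrable_transfer mtau tauP mf).1 fi).
by rewrite -(Rintegral_transfer mtau tauP).
Qed.

Lemma integrable_birkhoff_max g n : P.-integrable setT (EFin \o g) ->
  P.-integrable setT (EFin \o birkhoff_max g n).
Proof.
move=> gi; have mg : measurable_fun setT g by move/measurable_int : gi => /measurable_EFinP.
elim: n => [|n IH]; first exact: integrable0.
have [it _] := integrable_tau IH.
have [ib _] := Rintegral_linear 1 1 (integrable_norm gi) it.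
apply: (le_integrable measurableT _ _ ib).
  exact/measurable_EFinP/measurable_birkhoff_max.
move=> x _; rewrite lee_fin !mul1r.
rewrite ger0_norm ?birkhoff_max_ge0// [leRHS]ger0_norm ?addr_ge0 ?birkhoff_max_ge0//=.
rewrite ge_max addr_ge0 ?birkhoff_max_ge0//= lerD2r; exact: ler_norm.
Qed.

Definition birkhoff_unbounded (g : T -> R) : set T :=
  \bigcap_(c : nat) \bigcup_n [set x | c%:R < birkhoff_max g n x].

(** One step of the recursion changes the maxima by the finite number g x only. The set is therefore
    invariant exactly, as [erg] demands, and not just up to a null set. *)
Lemma birkhoff_unbounded_inv g :
  tau @^-1` (birkhoff_unbounded g) = birkhoff_unbounded g.
Proof.
apply/seteqP; split=> x /= xA c _.
  have [n _ /= hn] := xA (Num.bound (`|c%:R - g x|)) I.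
  exists n.+1 => //=; rewrite lt_max; apply/orP; right.
  rewrite -ltrBlDl (le_lt_trans _ hn)// (le_trans (ler_norm _))// ltW//.
  by apply: archi_boundP.
have [[|n] _ /= hn] := xA (Num.bound (c%:R + `|g x|)) I.
  by move: hn; rewrite ltNge ler0n.
exists n => //=; move: hn; rewrite lt_max ltNge ler0n /= => hn.
rewrite -(ltrD2l (g x)) (le_lt_trans _ hn)//.
apply: (@le_trans _ _ (c%:R + `|g x|)); first by rewrite addrC lerD2l ler_norm.
by apply: ltW; apply: archi_boundP; rewrite addr_ge0.
Qed.

Lemma measurable_birkhoff_unbounded g : measurable_fun setT g ->
  measurable (birkhoff_unbounded g).
Proof.
move=> mg; apply: bigcapT_measurable => c; apply: bigcup_measurable => n _.
rewrite -[X in measurable X]setTI.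
rewrite (_ : [set x | _] = birkhoff_max g n @^-1` `]c%:R, +oo[%classic).
  exact: (measurable_birkhoff_max n mg).
by apply/seteqP; split=> x /=; rewrite in_itv /= andbT.
Qed.

Lemma birkhoff_bounded (g : T -> R) : P.-integrable setT (EFin \o g) ->
  Rintegral P setT g < 0 ->
  {ae P, forall x, exists K, forall n, birkhoff_sum g n x <= K}.
Proof.
move=> gi gneg; have mg : measurable_fun setT g by move/measurable_int : gi => /measurable_EFinP.
have mA := measurable_birkhoff_unbounded mg.
have [A0|A1] := erg mA (birkhoff_unbounded_inv g).
  exists (birkhoff_unbounded g); split=> // x /= /forallNP nK c _.
  apply: contrapT => nc; apply: (nK c%:R) => n.
  rewrite (le_trans (birkhoff_sum_le_max g n x))// leNgt; apply/negP => h.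
  by apply: nc; exists n.
exfalso; move: gneg; apply/negP; rewrite -leNgt.
pose D n x := birkhoff_max g n.+1 x - birkhoff_max g n (tau x).
have DE n x : D n x = Num.max (- birkhoff_max g n (tau x)) (g x).
  by rewrite /D /= addr_maxl sub0r addrK.
(* The domination needed to pass to the limit: as M_n o tau >= 0, a negative increment cannot lie
   below g. *)
have Dg n x : `|D n x| <= `|g x|.
  rewrite DE; have := birkhoff_max_ge0 g n (tau x); move: (birkhoff_max _ _ _) => b b0.
  case: (leP (- b) (g x)) => // h.
  have g0 : g x < 0 by rewrite (lt_le_trans h)// oppr_le0.
  by rewrite normrN (ger0_norm b0) (ltr0_norm g0) lerNr ltW.
have Mi n := integrable_birkhoff_max n gi.
have Di n : P.-integrable setT (EFin \o D n) /\ 0 <= Rintegral P setT (D n).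
  have [ti tE] := integrable_tau (Mi n).
  have [ib E] := Rintegral_linear 1 (-1) (Mi n.+1) ti.
  have -> : D n = (fun t => 1 * birkhoff_max g n.+1 t + -1 * (birkhoff_max g n \o tau) t).
    by apply/funext => x; rewrite mul1r mulN1r.
  split; first exact: ib.
  rewrite E mul1r mulN1r tE subr_ge0.
  apply: le_Rintegral; [exact: measurableT | exact: Mi | exact: (Mi n.+1)|].
  by move=> x _; exact: birkhoff_max_incr.
have mD n : measurable_fun setT (EFin \o D n) by exact: measurable_int (Di n).1.
have DgA x : birkhoff_unbounded g x -> EFin \o D ^~ x @ \oo --> (g x)%:E.
  rewrite -{1}birkhoff_unbounded_inv => /= xA.
  have [N _ /= hN] := xA (Num.bound `|g x|) I.
  apply: cvg_near_cst; exists N => // n /= Nn; rewrite DE max_r// lerNl.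
  rewrite (le_trans (ler_norm _))// normrN (le_trans _ (birkhoff_max_nd g (tau x) Nn))//.
  by rewrite (le_trans _ (ltW hN))// ltW// archi_boundP.
have [||||_ _ cv] := @dominated_convergence _ _ _ P setT measurableT
  (fun n => EFin \o D n) (EFin \o g) (EFin \o (fun x => `|g x|)) mD.
- exact/measurable_EFinP.
- exists (~` birkhoff_unbounded g); split.
  + exact: measurableC.
  + by apply: (etrans (probability_setC P mA)); rewrite A1 subee.
  + by move=> x /= ng xA; apply: ng => _; exact: DgA.
- exact: integrable_norm.
- by apply: aeW => x n _ /=; rewrite lee_fin Dg.
have gfin : (\int[P]_x (EFin \o g) x)%E \is a fin_num by exact: integrable_fin_num.
rewrite -lee_fin /Rintegral fineK// leNgt; apply/negP => neg.
have : nbhs (\int[P]_x (EFin \o g) x)%E [set x | (x < 0)%E].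
  by apply: open_nbhs_nbhs; split => //; exact: open_ereal_lt_ereal.
move=> /cv[N _ /(_ N (leqnn N))] /=; apply/negP; rewrite -leNgt.
have [iD] := Di N; rewrite -lee_fin /Rintegral fineK//.
exact: (integrable_fin_num measurableT iD).
Qed.

Lemma birkhoff_sumB g c n x : birkhoff_sum (fun t => g t - c) n x = birkhoff_sum g n x - c *+ n.
Proof. by rewrite /birkhoff_sum sumrB sumr_const card_ord. Qed.

(** Subtracting slightly more than the mean from g makes the integral negative. The slacks 1 / (k +
    1) are countably many, so they share a null set. *)
Lemma birkhoff_upper (g : T -> R) : P.-integrable setT (EFin \o g) ->
  {ae P, forall x, forall k, exists K, forall n,
    birkhoff_sum g n x <= K + (Rintegral P setT g + k.+1%:R^-1) *+ n}.
Proof.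
move=> gi; apply: ae_forall_nat => k.
pose c := Rintegral P setT g + k.+1%:R^-1.
have ci := integrable_cst_fin P 1.
have [i1 e1] := Rintegral_linear 1 (- c) gi ci.
have E : (fun t => g t - c) = (fun t => 1 * g t + - c * 1).
  by apply/funext => x; rewrite mul1r mulr1.
have neg : Rintegral P setT (fun t => g t - c) < 0.
  rewrite E e1 Rintegral_cst// !mul1r (_ : fine _ = 1) ?mulr1; last first.
    exact: (congr1 fine (probability_setT P)).
  by rewrite subr_lt0 ltrDl invr_gt0.
have ib : P.-integrable setT (EFin \o (fun t => g t - c)) by rewrite E.
apply: filterS (birkhoff_bounded ib neg) => x [K xK]; exists K => n.
by have := xK n; rewrite birkhoff_sumB lerBlDr.
Qed.

Theorem birkhoff (g : T -> R) : P.-integrable setT (EFin \o g) ->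
  {ae P, forall x, (\sum_(k < n) g (iter k tau x)) / n%:R @[n --> \oo] --> Rintegral P setT g}.
Proof.
move=> gi.
have [ni ne] := Rintegral_linear (-1) 0 gi gi.
have E : (fun t => -1 * g t + 0 * g t) = (fun t => - g t).
  by apply/funext => x; rewrite mulN1r mul0r addr0.
rewrite E mulN1r mul0r addr0 in ni ne.
apply: filterS2 (birkhoff_upper gi) (birkhoff_upper ni) => x up lo.
apply/cvgrPdist_lt => e e0.
have [k _ /(_ k (leqnn k)) hk] := near_infty_natSinv_lt (PosNum (divr_gt0 e0 (ltr0Sn R 1))).
rewrite /= in hk.
have [K upK] := up k; have [L loL] := lo k.
pose B := Num.bound ((`|K| + `|L|) / (e / 2)).
exists B.+1 => // n /= Bn.
have n0 : 0 < n%:R :> R by rewrite ltr0n (leq_trans _ Bn).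
have eB : `|K| + `|L| < n%:R * (e / 2).
  rewrite -ltr_pdivrMr ?divr_gt0//; apply: (lt_le_trans (archi_boundP _)).
    by rewrite divr_ge0 ?addr_ge0//; exact: ltW (divr_gt0 e0 _).
  by rewrite ler_nat ltnW.
have h2 : birkhoff_sum g n x <= K + (Rintegral P setT g + k.+1%:R^-1) * n%:R.
  by rewrite mulr_natr; exact: upK.
have h1 : - birkhoff_sum g n x <= L + (- Rintegral P setT g + k.+1%:R^-1) * n%:R.
  by rewrite mulr_natr -ne /birkhoff_sum -sumrN; exact: loL.
exact: (birkhoff_arith n0 hk eB h2 h1).
Qed.

End birkhoff.

(** * Trigonometric approximation *)

Section fejer_approximation.
Context {R : realType}.

(** The double-angle formula turns cos t = 1 into sin (t / 2) = 0, which is impossible strictly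
    inside the interval. *)
Lemma cos_eq1 (t : R) : 0 <= t <= 2 * pi -> cos t = 1 -> t = 0 \/ t = 2 * pi.
Proof.
move=> /andP[t0 tpi] ct.
have [->|tn0] := eqVneq t 0; first by left.
have [->|tn2] := eqVneq t (2 * pi); first by right.
have : 0 < sin (t / 2).
  rewrite sin_gt0_pi//; apply/andP; split.
    by rewrite divr_gt0// lt_neqAle eq_sym tn0.
  by rewrite ltr_pdivrMr// mulrC lt_neqAle tn2.
have -> : sin (t / 2) = 0.
  apply/eqP; rewrite -sqrf_eq0; apply/eqP.
  have := cosD (t / 2) (t / 2); rewrite -splitr ct -!expr2 => h.
  have := cos2Dsin2 (t / 2); lra.
by rewrite ltxx.
Qed.

Lemma expi_eq1 (t : R) : 0 <= t <= 2 * pi -> expi t = 1 -> t = 0 \/ t = 2 * pi.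
Proof. by move=> t0 [ct _]; exact: cos_eq1. Qed.

Lemma expi_nat (t : R) n : expi (t * n%:R) = expi t ^+ n.
Proof.
elim: n => [|n IH]; first by rewrite mulr0 expi0.
by rewrite exprS -IH -expiD -natr1 mulrDr mulr1 addrC.
Qed.

Lemma expi2pi_nat n : expi (2 * pi * n%:R) = 1 :> R[i].
Proof.
rewrite expi_nat (_ : expi _ = 1) ?expr1n//.
by rewrite /expi mulrC mulr_natr cos2pi sin2pi.
Qed.

Lemma sum_roots_of_unity (N m : nat) : (0 < m < N)%N ->
  \sum_(j < N) expi (m%:R * (2 * pi * j%:R / N%:R)) = 0 :> R[i].
Proof.
move=> /andP[m0 mN].
have N0 : 0 < N%:R :> R by rewrite ltr0n (leq_trans _ mN).
pose z : R[i] := expi (m%:R * (2 * pi) / N%:R).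
under eq_bigr => j _.
  rewrite (_ : m%:R * _ = (m%:R * (2 * pi) / N%:R) * j%:R); last by ring.
  rewrite expi_nat -/z; over.
have zN : z ^+ N = 1.
  by rewrite /z -expi_nat divfK ?gt_eqF// mulrC expi2pi_nat.
have z1 : z != 1.
  apply/eqP => /expi_eq1; have h0 : 0 < m%:R * (2 * pi) / N%:R :> R.
    by rewrite divr_gt0// mulr_gt0 ?ltr0n// mulr_gt0// pi_gt0.
  have h1 : m%:R * (2 * pi) / N%:R < 2 * pi :> R.
    by rewrite ltr_pdivrMr// mulrC ltr_pM2l ?ltr_nat// mulr_gt0// pi_gt0.
  rewrite !ltW// => /(_ isT)[] h; [move: h0 | move: h1]; by rewrite h ltxx.
have := subrX1 z N; rewrite zN subrr => /esym/eqP; rewrite mulf_eq0 subr_eq0 (negbTE z1) /=.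
by move/eqP.
Qed.

Definition node (N j : nat) : R := 2 * pi * j%:R / N%:R.

(** Discrete orthogonality, exact because |k - l| < N. It does the work of integration over the
    circle without forming a Hilbert-valued integral. *)
Lemma sum_nodes (N k l : nat) : (k < N)%N -> (l < N)%N ->
  \sum_(j < N) expi ((k%:R - l%:R) * node N j) = N%:R *+ (k == l) :> R[i].
Proof.
move=> kN lN; case: (ltngtP k l) => [kl|lk|->].
- under eq_bigr => j _.
    rewrite -opprB mulNr -natrB ?(ltnW kl)// expiN; over.
  rewrite -rmorph_sum /= sum_roots_of_unity ?mulr0n ?conjC0//.
  by rewrite subn_gt0 kl /= (leq_ltn_trans (leq_subr _ _)).
- under eq_bigr => j _ do rewrite -natrB ?(ltnW lk)//.
  by rewrite sum_roots_of_unity ?mulr0n// subn_gt0 lk /= (leq_ltn_trans (leq_subr _ _)).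
- under eq_bigr do rewrite subrr mul0r expi0.
  by rewrite sumr_const card_ord mulr1n.
Qed.

(* N times the Fejer kernel, as a double exponential sum. *)
Definition fejer (N : nat) (t : R) : R[i] :=
  \sum_(k < N) \sum_(l < N) expi ((k%:R - l%:R) * t).

Lemma fejerE N t : fejer N t = (cnorm (\sum_(k < N) expi (k%:R * t)) ^+ 2)%:C%C.
Proof.
rewrite rmorphXn /= -normE normCK rmorph_sum mulr_suml; apply: eq_bigr => k _.
rewrite mulr_sumr; apply: eq_bigr => l _.
by rewrite mulrBl expiD expiN.
Qed.

(** The analogue of total mass one: after division by N^2 the translates of the kernel to the nodes
    are weights of sum one at every t. *)
Lemma sum_fejer N t : \sum_(j < N) fejer N (t - node N j) = N%:R ^+ 2.
Proof.
have H k l : (k < N)%N -> (l < N)%N ->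
    \sum_(j < N) expi ((k%:R - l%:R) * (t - node N j)) =
    expi ((k%:R - l%:R) * t) * (N%:R *+ (l == k)) :> R[i].
  move=> kN lN; rewrite -sum_nodes// mulr_sumr; apply: eq_bigr => j _.
  by rewrite -expiD; congr expi; ring.
rewrite /fejer exchange_big /=.
under eq_bigr => k _.
  rewrite exchange_big /=; under eq_bigr do rewrite H//.
  rewrite (bigD1 k)//= eqxx subrr mul0r expi0 mul1r mulr1n big1 ?addr0; last first.
    by move=> l lk; rewrite val_eqE (negbTE lk) mulr0n mulr0.
  over.
by rewrite sumr_const card_ord expr2 mulr_natr.
Qed.

(** The geometric sum D satisfies |expi t - 1| |D| <= 2. Measuring distance by the chord |expi t -
    1| takes care of periodicity. *)
Lemma fejer_far N t (eta : R) : 0 < eta -> eta <= cnorm (expi t - 1) ->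
  cnorm (fejer N t) <= 4 / eta ^+ 2.
Proof.
move=> eta0 far.
set D : R[i] := \sum_(k < N) expi (k%:R * t).
have h : (expi t - 1) * D = expi t ^+ N - 1.
  rewrite subrX1; congr (_ * _); apply: eq_bigr => k _.
  by rewrite mulrC expi_nat.
have : cnorm (expi t - 1) * cnorm D <= 2.
  rewrite -cnormM h (le_trans (cnormB _ _))// -expi_nat !cnorm_expi.
  by have := cnorm_nat 1 (R := R); rewrite mulr1n => ->.
move=> h2; rewrite fejerE -/D cnormR ger0_norm ?sqr_ge0// ler_pdivlMr ?exprn_gt0//.
have h3 : eta * cnorm D <= 2.
  by rewrite (le_trans _ h2)// ler_wpM2r// cnorm_ge0.
have -> : 4 = 2 ^+ 2 :> R by rewrite expr2 -natrM.
rewrite -exprMn ler_pXn2r ?nnegrE ?mulr_ge0 ?cnorm_ge0 ?(ltW eta0)// mulrC; exact: h3.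
Qed.

Lemma expi_continuous (x e : R) : 0 < e ->
  \forall y \near x, cnorm (expi y - expi x) < e.
Proof.
move=> e0; have e2 : 0 < e / 2 by rewrite divr_gt0.
have /cvgrPdist_lt/(_ _ e2) hc := @continuous_cos R x.
have /cvgrPdist_lt/(_ _ e2) hs := @continuous_sin R x.
apply: filterS2 hc hs => y hc hs.
rewrite cnorm_distC (le_lt_trans (cnorm_le_ReIm _))// ReB ImB /= [e]splitr; exact: ltrD.
Qed.

Lemma expi_dist (s t : R) : cnorm (expi (s - t) - 1) = cnorm (expi s - expi t).
Proof.
by rewrite -[LHS]mulr1 -(cnorm_expi t) -cnormM mulrBl mul1r -expiD subrK.
Qed.

Section periodic_functions.
Context {H : hilbertType R}.
Implicit Types u : R -> H.

Definition hcontinuous u := forall (x e : R), 0 < e ->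
  \forall y \near x, hnorm (u y - u x) < e.

Definition periodic u := forall x, u (x + 2 * pi) = u x.

(** The point y does not depend on u, so one reduction serves several functions at once; the
    interval is closed for the sake of compactness. *)
Lemma periodic_reduce (x : R) : exists2 y : R, 0 <= y <= 2 * pi &
  forall u, periodic u -> u x = u y.
Proof.
have pi2 : 0 < 2 * pi :> R by rewrite mulr_gt0// pi_gt0.
pose m := Num.floor (x / (2 * pi)).
exists (x - 2 * pi * m%:~R).
  have /andP[h1 h2] := floor_itv (x / (2 * pi)).
  rewrite subr_ge0 mulrC -ler_pdivlMr// h1 /= lerBlDr.
  have h3 : x / (2 * pi) < m%:~R + 1 by move: h2; rewrite (intrD R).
  have -> : 2 * pi + m%:~R * (2 * pi) = (m%:~R + 1) * (2 * pi) :> R by ring.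
  by rewrite -ler_pdivrMr// ltW.
move=> u up.
have upn y n : u (y + 2 * pi * n%:R) = u y.
  elim: n => [|n IH]; first by rewrite mulr0 addr0.
  have -> : y + 2 * pi * n.+1%:R = (y + 2 * pi * n%:R) + 2 * pi :> R by rewrite -natr1; ring.
  by rewrite up.
case: (m) => n; first by rewrite -[in LHS](subrK (2 * pi * n%:R) x) upn.
by rewrite NegzE mulrNz mulrN opprK upn.
Qed.

Lemma periodic_bounded u : hcontinuous u -> periodic u ->
  exists2 U : R, 0 < U & forall x, hnorm (u x) <= U.
Proof.
move=> uc up.
have /compact_near_coveringP cK := @segment_compact R 0 (2 * pi).
(* Near-covering compactness along the filter at +oo: near each point all large i are bounds, so
   some i is a bound on the whole interval. *)
have [|M [_ /(_ (Num.max M 0 + 1))]] := cK R +oo%R (fun i x => hnorm (u x) <= i) _.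
  move=> x _; exists ([set y | hnorm (u y - u x) < 1], [set i | hnorm (u x) + 1 < i]) => /=.
    split; first exact: uc.
    by exists (hnorm (u x) + 1); split=> //; rewrite num_real.
  move=> [y i] /= [hy hi]; rewrite (le_trans _ (ltW hi))//.
  by rewrite -lerBlDl (le_trans _ (ltW hy))// (le_trans (ler_norm _))// hnorm_distD.
rewrite (@le_lt_trans _ _ (Num.max M 0)) ?le_max ?lexx ?ltrDl// => /(_ isT) hM.
exists (Num.max M 0 + 1); first by rewrite ltr_wpDl// le_max lexx orbT.
move=> x; have [y yK ->] := periodic_reduce x => //.
by apply: hM; rewrite /= in_itv.
Qed.

Lemma periodic_expi u s t : periodic u -> 0 <= s <= 2 * pi -> 0 <= t <= 2 * pi ->
  expi s = expi t -> u s = u t.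
Proof.
move=> up; wlog st : s t / s <= t.
  by move=> h s0 t0 st; have [|/ltW] := leP s t => le; [exact: h | rewrite (h t s)].
move=> /andP[s0 s2] /andP[t0 t2] est.
have e1 : expi (t - s) = 1.
  have := expi_dist t s; rewrite est subrr cnorm0 => /cnorm_eq0/eqP.
  by rewrite subr_eq0 => /eqP.
have [||] := @expi_eq1 (t - s) _ e1.
- by rewrite subr_ge0 st /= lerBlDr (le_trans t2)// lerDl.
- by move/eqP; rewrite subr_eq0 => /eqP ->.
move=> h; have tE : t = s + 2 * pi by rewrite -h addrC subrK.
by rewrite tE up.
Qed.

(** Uniform continuity for the chord distance on the circle, in which 0 and 2 pi coincide and in
    which [fejer_far] is stated. *)
Lemma periodic_modulus u : hcontinuous u -> periodic u -> forall e, 0 < e ->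
  exists2 eta : R, 0 < eta & forall s t, 0 <= s <= 2 * pi -> 0 <= t <= 2 * pi ->
    cnorm (expi s - expi t) < eta -> hnorm (u s - u t) < e.
Proof.
move=> uc up e e0.
have /compact_near_coveringP cK := compact_setX (@segment_compact R 0 (2 * pi))
  (@segment_compact R 0 (2 * pi)).
have e2 : 0 < e / 2 by rewrite divr_gt0.
have [|A A0 hA] := cK R 0^'+ (fun i x =>
    cnorm (expi x.1 - expi x.2) < i -> hnorm (u x.1 - u x.2) < e) _.
  move=> [s t] [/= sK tK].
  (* If s and t are the same point of the circle, continuity of u applies. Otherwise nearby chords
     stay bounded below, so the condition on the chord fails for small i. *)
  have [st|st] := eqVneq (expi s) (expi t).
    have ust : u s = u t.
      by move: sK tK; rewrite !in_itv /= => sK tK; exact: (periodic_expi up sK tK st).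
    exists ([set y | hnorm (u y - u s) < e / 2] `*` [set y | hnorm (u y - u t) < e / 2], setT).
      split; last exact: filterT.
      by exists ([set y | hnorm (u y - u s) < e / 2], [set y | hnorm (u y - u t) < e / 2]) => //;
        split; exact: uc.
    move=> [[x y] i] /= [[hx hy] _] _.
    rewrite (le_lt_trans (hnorm_triangle _ (u s) _))// [e]splitr ltrD// ust hnorm_distC//.
  pose dl := cnorm (expi s - expi t) / 3.
  have dl0 : 0 < dl.
    rewrite divr_gt0// lt_neqAle cnorm_ge0 andbT eq_sym; apply: contra_neq st => /cnorm_eq0/eqP.
    by rewrite subr_eq0 => /eqP.
  exists ([set y | cnorm (expi y - expi s) < dl] `*` [set y | cnorm (expi y - expi t) < dl],
      [set i | i < dl]).
    split; last exact: nbhs_right_lt.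
    exists ([set y | cnorm (expi y - expi s) < dl], [set y | cnorm (expi y - expi t) < dl]) => //.
    by split; exact: expi_continuous.
  move=> [[x y] i] /= [[hx hy] hi] hxy; exfalso.
  have : cnorm (expi s - expi t) < dl + dl + dl.
    have -> : expi s - expi t = - (expi x - expi s) + ((expi x - expi y) + (expi y - expi t)).
      by ring.
    have -> : dl + dl + dl = dl + (dl + dl) by rewrite addrA.
    rewrite (le_lt_trans (cnormD _ _))// cnormN ltrD//.
    rewrite (le_lt_trans (cnormD _ _))// ltrD//; exact: lt_trans hxy hi.
  have -> : dl + dl + dl = cnorm (expi s - expi t) by rewrite /dl; field.
  by rewrite ltxx.
exists (A / 2); first by rewrite divr_gt0.
move=> s t sK tK; apply: (hA (A / 2) _ _ (s, t)) => /=; rewrite ?divr_gt0//.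
by rewrite sub0r normrN gtr0_norm ?divr_gt0// ltr_pdivrMr// ltr_pMr// ltr1n.
Qed.

Theorem fejer_approx u : hcontinuous u -> periodic u -> forall e, 0 < e ->
  exists N (c : 'I_N -> 'I_N -> H), forall x,
    hnorm (u x - \sum_(k < N) \sum_(l < N) expi ((k%:R - l%:R) * x) *: c k l) <= e.
Proof.
move=> uc up e e0; have e2 : 0 < e / 2 by rewrite divr_gt0.
have [U U0 uU] := periodic_bounded uc up.
have [eta eta0 ueta] := periodic_modulus uc up e2.
(* B bounds the term of a far node: the kernel is at most 4 / eta^2 there, and two values of u
   differ by at most 2 U. *)
pose B := 8 * U / eta ^+ 2.
have B0 : 0 < B by rewrite divr_gt0 ?exprn_gt0// mulr_gt0.
pose N := (Num.bound (B / (e / 2))).+1.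
have N0 : 0 < N%:R :> R by rewrite ltr0n.
have BN : B / N%:R <= e / 2.
  rewrite ler_pdivrMr// mulrC -ler_pdivrMr// ltW// (lt_le_trans (archi_boundP _))//.
    by rewrite divr_ge0 ?ltW.
  by rewrite ler_nat.
(* The Fejer mean of u with its integral replaced by the average over the nodes; the pair (k, l)
   contributes at frequency k - l. *)
pose c (k l : 'I_N) : H := (N%:R ^+ 2)^-1 *:
  \sum_(j < N) expi (- ((k%:R - l%:R) * node N j)) *: u (node N j).
exists N, c.
move=> x0; have [x xK xE] := periodic_reduce x0.
pose a j := fejer N (x - node N j).
pose v y := u y - \sum_(k < N) \sum_(l < N) expi ((k%:R - l%:R) * y) *: c k l.
have vp : periodic v.
  move=> y; rewrite /v up; congr (_ - _); apply: eq_bigr => k _; apply: eq_bigr => l _.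
  rewrite mulrDr expiD [_ * (2 * pi)]mulrBl expiD expiN.
  by rewrite ![_ * (2 * pi)]mulrC !expi2pi_nat conjC1 !mulr1.
rewrite -/(v x0) (xE _ vp).
(* Since the weights sum to one, the error is a weighted average of differences of values of u. *)
have vE : v x = (N%:R ^+ 2)^-1 *: \sum_(j < N) a j *: (u x - u (node N j)).
  under eq_bigr do rewrite scalerBr.
  rewrite sumrB -scaler_suml sum_fejer scalerBr scalerA mulVf ?scale1r; last first.
    by rewrite expf_neq0// pnatr_eq0.
  congr (_ - _).
  under eq_bigr => k _.
    under eq_bigr => l _ do rewrite /c scalerA mulrC -scalerA scaler_sumr.
    rewrite -scaler_sumr exchange_big /=; over.
  rewrite /= -scaler_sumr exchange_big /=; congr (_ *: _).
  apply: eq_bigr => j _; rewrite /a /fejer scaler_suml; apply: eq_bigr => k _.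
  rewrite scaler_suml; apply: eq_bigr => l _.
  by rewrite scalerA -expiD mulrBr.
have aE j : a j = (cnorm (a j))%:C%C.
  by rewrite /a fejerE cnormR ger0_norm// sqr_ge0.
have sa : \sum_(j < N) cnorm (a j) = N%:R ^+ 2.
  apply: complexI; rewrite rmorph_sum rmorphXn rmorph_nat /= -(sum_fejer N x).
  by apply: eq_bigr => j _; rewrite -aE.
have bj (j : 'I_N) : hnorm (a j *: (u x - u (node N j))) <= e / 2 * cnorm (a j) + B.
  rewrite hnormZ; have nK : 0 <= node N j <= 2 * pi.
    have p0 := pi_ge0 R.
    rewrite /node divr_ge0 ?mulr_ge0//= ler_pdivrMr// ler_wpM2l ?mulr_ge0//.
    by rewrite ler_nat ltnW.
  have [near|far] := ltP (cnorm (expi x - expi (node N j))) eta.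
    rewrite mulrC (@le_trans _ _ (e / 2 * cnorm (a j)))//.
      by rewrite ler_wpM2r ?cnorm_ge0// ltW// ueta.
    by rewrite lerDl ltW.
  rewrite (@le_trans _ _ B)//; last by rewrite lerDr mulr_ge0 ?cnorm_ge0 ?ltW.
  have fa : cnorm (a j) <= 4 / eta ^+ 2 by apply: fejer_far; rewrite ?expi_dist.
  have -> : B = 4 / eta ^+ 2 * (U + U) by rewrite /B; field; rewrite gt_eqF.
  rewrite ler_pM ?cnorm_ge0 ?hnorm_ge0// (le_trans (hnormB _ _))// lerD//.
rewrite vE hnormZ.
have -> : cnorm ((N%:R ^+ 2)^-1) = (N%:R ^+ 2)^-1 :> R.
  have -> : (N%:R ^+ 2)^-1 = ((N%:R ^+ 2)^-1 : R)%:C%C by rewrite fmorphV rmorphXn rmorph_nat.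
  by rewrite cnormR ger0_norm// invr_ge0 sqr_ge0.
rewrite mulrC ler_pdivrMr ?exprn_gt0// (le_trans (hnorm_sum _ _ _))//.
(* Near nodes contribute at most e / 2 times the total weight N^2, far nodes at most N B, and the
   choice of N makes this at most e N^2 / 2. *)
rewrite (le_trans (ler_sum _ (fun j _ => bj j)))// big_split /= -mulr_sumr sa.
rewrite sumr_const card_ord -[B *+ N]mulr_natr.
have -> : e * N%:R ^+ 2 = e / 2 * N%:R ^+ 2 + e / 2 * N%:R ^+ 2 by field.
rewrite lerD2l.
rewrite expr2 mulrA ler_pM2r// -ler_pdivrMr//.
Qed.

End periodic_functions.
End fejer_approximation.

(** * Convergence of quadratic functionals *)

Section complex_limits.
Context {R : realType}.
Implicit Types (z w : nat -> R[i]) (a b : R[i]).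

Definition ccvg z a := forall e : R, 0 < e -> \forall n \near \oo, cnorm (z n - a) < e.

Lemma ccvg_cst a : ccvg (fun=> a) a.
Proof. by move=> e e0; near=> n; rewrite subrr cnorm0. Unshelve. all: by end_near. Qed.

Lemma ccvgD z w a b : ccvg z a -> ccvg w b -> ccvg (fun n => z n + w n) (a + b).
Proof.
move=> za wb e e0; have e2 : 0 < e / 2 by rewrite divr_gt0.
apply: filterS2 (za _ e2) (wb _ e2) => n h1 h2.
by rewrite opprD addrACA (le_lt_trans (cnormD _ _))// [e]splitr ltrD.
Qed.

Lemma ccvg_sum I (r : seq I) (z : I -> nat -> R[i]) (a : I -> R[i]) :
  (forall i, ccvg (z i) (a i)) -> ccvg (fun n => \sum_(i <- r) z i n) (\sum_(i <- r) a i).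
Proof.
move=> h; elim: r => [|i r IH].
  by under eq_fun do rewrite big_nil; rewrite big_nil; exact: ccvg_cst.
by under eq_fun do rewrite big_cons; rewrite big_cons; exact: ccvgD.
Qed.

Lemma ccvgM z w a b : ccvg z a -> ccvg w b -> ccvg (fun n => z n * w n) (a * b).
Proof.
move=> za wb e e0.
pose K := cnorm a + cnorm b + 1.
have K0 : 0 < K by rewrite ltr_wpDl// addr_ge0 ?cnorm_ge0.
pose d := Num.min 1 (e / (2 * K)).
have d0 : 0 < d by rewrite lt_min ltr01 divr_gt0// mulr_gt0.
apply: filterS2 (za _ d0) (wb _ d0) => n h1 h2.
have -> : z n * w n - a * b = (z n - a) * (w n - b) + ((z n - a) * b + a * (w n - b)) by ring.
rewrite (le_lt_trans (cnormD _ _))// (le_lt_trans (lerD (lexx _) (cnormD _ _)))// !cnormM.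
have d1 : d <= 1 by rewrite ge_min lexx.
have dK : d * K <= e / 2.
  rewrite (@le_trans _ _ (e / (2 * K) * K))//.
    by rewrite ler_pM2r// ge_min lexx orbT.
  by rewrite le_eqVlt; apply/orP; left; apply/eqP; field; rewrite gt_eqF.
rewrite (@le_lt_trans _ _ (d * K))//; last by rewrite (le_lt_trans dK)// ltr_pdivrMr// ltr_pMr// ltr1n.
have -> : d * K = d * 1 + (d * cnorm b + cnorm a * d) by rewrite /K; ring.
rewrite lerD ?ler_pM ?cnorm_ge0 ?(ltW h1)//; first by rewrite (le_trans (ltW h2)).
by rewrite lerD ?ler_pM ?cnorm_ge0 ?(ltW h1) ?(ltW h2).
Qed.

Lemma ccvgJ z a : ccvg z a -> ccvg (fun n => (z n)^*) (a^*).
Proof.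
by move=> za e e0; apply: filterS (za e e0) => n; rewrite -rmorphB cnormJ.
Qed.

Lemma ccvgN z a : ccvg z a -> ccvg (fun n => - z n) (- a).
Proof.
by move=> za e e0; apply: filterS (za e e0) => n; rewrite -opprD cnormN.
Qed.

Lemma ccvgB z w a b : ccvg z a -> ccvg w b -> ccvg (fun n => z n - w n) (a - b).
Proof. by move=> za wb; apply: ccvgD => //; exact: ccvgN. Qed.

Lemma ccvg_near z w a : (\forall n \near \oo, z n = w n) -> ccvg z a -> ccvg w a.
Proof. by move=> zw za e e0; apply: filterS2 zw (za e e0) => n ->. Qed.

End complex_limits.

(** * Trigonometric polynomials with vector coefficients *)

Section trigonometric_polynomials.
Context {R : realType} {H : hilbertType R}.
Implicit Types (u v : R -> H) (r : seq (int * H)).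

Definition trig r (t : R) : H := \sum_(p <- r) expi (p.1%:~R * t) *: p.2.

Lemma hcontinuous_cst (x : H) : hcontinuous (fun=> x).
Proof. by move=> t e e0; near=> s; rewrite subrr hnorm0. Unshelve. all: by end_near. Qed.

Lemma hcontinuousD u v : hcontinuous u -> hcontinuous v -> hcontinuous (fun t => u t + v t).
Proof.
move=> cu cv t e e0; have e2 : 0 < e / 2 by rewrite divr_gt0.
apply: filterS2 (cu t _ e2) (cv t _ e2) => s h1 h2.
by rewrite opprD addrACA (le_lt_trans (hnormD _ _))// [e]splitr ltrD.
Qed.

Lemma hcontinuousB u v : hcontinuous u -> hcontinuous v -> hcontinuous (fun t => u t - v t).
Proof.
move=> cu cv; apply: hcontinuousD => // t e e0.
by apply: filterS (cv t _ e0) => s; rewrite -opprD hnormN.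
Qed.

Lemma hcontinuous_expi (a : R) (x : H) : hcontinuous (fun t => expi (a * t) *: x).
Proof.
move=> t e e0; pose d := e / (hnorm x + 1).
have x1 : 0 < hnorm x + 1 by rewrite ltr_wpDl ?hnorm_ge0.
have d0 : 0 < d by rewrite divr_gt0.
have ca : (fun s : R => a * s) @ t --> a * t by apply: cvgM; [exact: cvg_cst | exact: cvg_id].
have h : \forall s \near t, cnorm (expi (a * s) - expi (a * t)) < d.
  exact: ca (expi_continuous (a * t) d0).
apply: filterS h => s hs.
rewrite -scalerBl hnormZ (@le_lt_trans _ _ (d * hnorm x))//.
  by rewrite ler_wpM2r ?hnorm_ge0// ltW.
by rewrite /d mulrAC ltr_pdivrMr// ltr_pM2l// ltrDl.
Qed.

Lemma hcontinuous_trig r : hcontinuous (trig r).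
Proof.
elim: r => [|p r IH] t e e0.
  by near=> s; rewrite /trig !big_nil subrr hnorm0.
have := hcontinuousD (hcontinuous_expi p.1%:~R p.2) IH t e0.
by apply: filterS => s; rewrite /trig !big_cons.
Unshelve. all: by end_near.
Qed.

Lemma fejer_trig u : hcontinuous u -> periodic u -> forall e, 0 < e ->
  exists r, forall t, hnorm (u t - trig r t) <= e.
Proof.
move=> cu pu e e0; have [N [c h]] := fejer_approx cu pu e0.
exists [seq (Posz (kl.1 : 'I_N) - Posz (kl.2 : 'I_N), c kl.1 kl.2) | kl <- enum {: 'I_N * 'I_N}].
move=> t; apply: le_trans (h t); rewrite le_eqVlt; apply/orP; left; apply/eqP.
congr (hnorm (_ - _)); rewrite /trig big_map big_enum pair_big /=.
by apply: eq_bigr => kl _; rewrite intrB.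
Qed.

End trigonometric_polynomials.

Section forms.
Context {R : realType} {H : hilbertType R}.
Implicit Types (u v : R -> H) (mu : {finite_measure set R -> \bar R}) (F : R -> H -> H).

Definition form mu F u v : R[i] :=
  complex_integral mu (fun t => hdot (F t (v t)) (u t)).

(* What the densities I_n (w.r.t. Leb) and f_X (w.r.t. ||nu_X||_1) have in
   common; M stands for the mass of the operator measure. *)
Definition admissible mu F (M : R) :=
  (forall t, linear (F t)) /\
  forall u v (a b : R), hcontinuous u -> hcontinuous v -> 0 < a -> 0 < b ->
    (forall t, hnorm (u t) <= a) -> (forall t, hnorm (v t) <= b) ->
    cintegrable mu (fun t => hdot (F t (v t)) (u t)) /\
    cnorm (form mu F u v) <= M * (a * b).

(** The difference splits into the form of u - u' and v plus that of u' and v - v', so the constant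
    involves the bounds of u' and v. *)
Lemma form_diff mu F M u v u' v' (a b d1 d2 : R) : admissible mu F M -> 0 <= M ->
  hcontinuous u -> hcontinuous v -> hcontinuous u' -> hcontinuous v' ->
  0 < a -> 0 < b -> 0 < d1 -> 0 < d2 ->
  (forall t, hnorm (u' t) <= a) -> (forall t, hnorm (v t) <= b) ->
  (forall t, hnorm (u t - u' t) <= d1) -> (forall t, hnorm (v t - v' t) <= d2) ->
  cnorm (form mu F u v - form mu F u' v') <= M * (d1 * b + a * d2).
Proof.
move=> [lF adm] M0 cu cv cu' cv' a0 b0 d10 d20 ua vb ud vd.
have [i1 h1] := adm _ _ _ _ (hcontinuousB cu cu') cv d10 b0 ud vb.
have [i2 h2] := adm _ _ _ _ cu' (hcontinuousB cv cv') a0 d20 ua vd.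
have ub t : hnorm (u t) <= a + d1.
  by rewrite -(subrK (u' t) (u t)) (le_trans (hnormD _ _))// addrC lerD.
have vb' t : hnorm (v' t) <= b + d2.
  rewrite -[v' t](subKr (v t)) (le_trans (hnormB _ _))// lerD//.
have [i3 _] := adm u v _ _ cu cv (addr_gt0 a0 d10) b0 ub vb.
have [i4 _] := adm u' v' _ _ cu' cv' a0 (addr_gt0 b0 d20) ua vb'.
have -> : form mu F u v - form mu F u' v' =
    form mu F (fun t => u t - u' t) v + form mu F u' (fun t => v t - v' t).
  rewrite /form -cintB// -cintD//; congr complex_integral; apply/funext => t.
  by rewrite (linB (lF t)) hdotBr hdotBl addrA subrK.
by rewrite mulrDr (le_trans (cnormD _ _))// lerD.
Qed.

Lemma cintegrable_expi mu F M (a : R) x y : admissible mu F M ->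
  cintegrable mu (fun t => expi (a * t) * hdot (F t y) x).
Proof.
move=> [lF adm].
have x1 : 0 < hnorm x + 1 by rewrite ltr_wpDl ?hnorm_ge0.
have y1 : 0 < hnorm y + 1 by rewrite ltr_wpDl ?hnorm_ge0.
have [|t|] := adm (fun=> x) (fun t => expi (a * t) *: y) _ _ (hcontinuous_cst x)
  (hcontinuous_expi a y) x1 y1.
- by rewrite lerDl.
- by rewrite hnormZ cnorm_expi mul1r lerDl.
by under eq_fun do rewrite (linZ (lF _)) hdotZl.
Qed.

Lemma form_trig mu F M r s : admissible mu F M ->
  form mu F (trig r) (trig s) = \sum_(q <- s) \sum_(p <- r)
    complex_integral mu (fun t => expi ((q.1 - p.1)%:~R * t) * hdot (F t q.2) p.2).
Proof.
move=> adm; have lF := adm.1.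
have E t : hdot (F t (trig s t)) (trig r t) =
    \sum_(q <- s) \sum_(p <- r) expi ((q.1 - p.1)%:~R * t) * hdot (F t q.2) p.2.
  rewrite /trig (lin_sum (lF t)) hdot_suml; apply: eq_bigr => q _.
  rewrite hdot_sumr; apply: eq_bigr => p _.
  rewrite (linZ (lF t)) hdotZl hdotZr -expiN mulrCA mulrA -expiD.
  by congr (expi _ * _); rewrite intrB; ring.
rewrite /form; under [in LHS]eq_fun do rewrite E.
have inner q : cintegrable mu (fun t => \sum_(p <- r) expi ((q.1 - p.1)%:~R * t) * hdot (F t q.2) p.2)
  /\ complex_integral mu (fun t => \sum_(p <- r) expi ((q.1 - p.1)%:~R * t) * hdot (F t q.2) p.2)
  = \sum_(p <- r) complex_integral mu (fun t => expi ((q.1 - p.1)%:~R * t) * hdot (F t q.2) p.2).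
  apply: (@cint_sum_both _ _ _ mu _ r
    (fun (p : int * H) t => expi ((q.1 - p.1)%:~R * t) * hdot (F t q.2) p.2)).
  by move=> p _; exact: cintegrable_expi adm.
have [|_ ->] := @cint_sum_both _ _ _ mu _ s (fun q t =>
  \sum_(p <- r) expi ((q.1 - p.1)%:~R * t) * hdot (F t q.2) p.2).
  by move=> q _; exact: (inner q).1.
by apply: eq_bigr => q _; exact: (inner q).2.
Qed.

Section convergence.
Variables (mu_ : nat -> {finite_measure set R -> \bar R}) (F_ : nat -> R -> H -> H).
Variables (mu : {finite_measure set R -> \bar R}) (F : R -> H -> H) (M : R).
Hypotheses (M0 : 0 <= M) (adm_ : forall n, admissible (mu_ n) (F_ n) M)
  (adm : admissible mu F M).
Hypothesis coef : forall (h : int) x y, ccvg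
  (fun n => complex_integral (mu_ n) (fun t => expi (h%:~R * t) * hdot (F_ n t y) x))
  (complex_integral mu (fun t => expi (h%:~R * t) * hdot (F t y) x)).

Lemma form_cvg u v : hcontinuous u -> periodic u -> hcontinuous v -> periodic v ->
  ccvg (fun n => form (mu_ n) (F_ n) u v) (form mu F u v).
Proof.
move=> cu pu cv pv e e0.
have [a a0 ua] := periodic_bounded cu pu.
have [b b0 vb] := periodic_bounded cv pv.
(* Replacing u and v by polynomials within d changes a form by at most M d (a + b + d); the cap d <=
   1 yields the constant M (a + b + 1). *)
pose d := Num.min 1 (e / 4 / (M * (a + b + 1) + 1)).
have K0 : 0 <= M * (a + b + 1) by rewrite mulr_ge0// !addr_ge0// ltW.
have K1 : 0 < M * (a + b + 1) + 1 by rewrite ltr_wpDl.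
have d0 : 0 < d by rewrite lt_min ltr01 !divr_gt0.
have d1 : d <= 1 by rewrite ge_min lexx.
have dK : d * (M * (a + b + 1)) <= e / 4.
  rewrite (@le_trans _ _ (d * (M * (a + b + 1) + 1)))//.
    by rewrite ler_wpM2l ?(ltW d0)// lerDl.
  by rewrite -ler_pdivlMr// ge_min lexx orbT.
have [r ur] := fejer_trig cu pu d0.
have [s vs] := fejer_trig cv pv d0.
have cr := hcontinuous_trig r; have cs := hcontinuous_trig s.
have ra t : hnorm (trig r t) <= a + d.
  rewrite -[trig r t](subKr (u t)) (le_trans (hnormB _ _))// lerD//.
have err (m : {finite_measure set R -> \bar R}) (K : R -> H -> H) : admissible m K M ->
    cnorm (form m K u v - form m K (trig r) (trig s)) <= e / 4.
  move=> admK; rewrite (le_trans (form_diff admK M0 cu cv cr cs (addr_gt0 a0 d0) b0 d0 d0 ra vb ur vs))//.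
  rewrite (le_trans _ dK)//.
  have -> : M * (d * b + (a + d) * d) = d * (M * (a + b + d)) by ring.
  by rewrite !ler_wpM2l ?(ltW d0)// lerD2l.
have lim : ccvg (fun n => form (mu_ n) (F_ n) (trig r) (trig s)) (form mu F (trig r) (trig s)).
  under eq_fun do rewrite (form_trig _ _ (adm_ _)); rewrite (form_trig _ _ adm).
  by apply: ccvg_sum => q; apply: ccvg_sum => p; exact: coef.
have e4 : 0 < e / 4 by rewrite divr_gt0.
apply: filterS (lim _ e4) => n hn.
set A := form (mu_ n) (F_ n) u v; set B := form mu F u v.
have hA := err _ _ (adm_ n); have hB := err _ _ adm.
rewrite -/A in hA; rewrite -/B cnorm_distC in hB.
move: hn hA hB; set A' := form _ _ _ _; set B' := form _ _ _ _ => hn hA hB.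
have -> : A - B = (A - A') + ((A' - B') + (B' - B)) by ring.
rewrite (le_lt_trans (cnormD _ _))// (le_lt_trans (lerD hA (cnormD _ _)))//.
rewrite [ltRHS](_ : e = e / 4 + (e / 4 + (e / 4 + e / 4))); last by field.
by rewrite ltrD2l (lt_le_trans (ltr_leD hn hB))// lerD2l lerDl ltW.
Qed.

End convergence.
End forms.

(** * Uniformity in the parameter *)

Section continuous_fields.
Context {R : realType} {Theta : topologicalType} {H : hilbertType R}.
Implicit Types w : Theta -> R -> H.

Definition continuous_field w :=
  (forall th, periodic (w th)) /\
  forall (p : Theta * R) (e : R), 0 < e ->
    \forall q \near p, hnorm (w q.1 q.2 - w p.1 p.2) < e.

Lemma continuous_field_hcontinuous w th : continuous_field w -> hcontinuous (w th).
Proof.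
move=> [_ cw] x e e0; have [[A B] /= [hA hB] AB] := cw (th, x) e e0.
by apply: filterS hB => y By; apply: (AB (th, y)); split=> //; exact: nbhs_singleton.
Qed.

(** A tube argument: joint continuity at the points (th0, x) is uniform over the compact period, and
    periodicity extends it to the line. *)
Lemma continuous_field_equicontinuous w th0 e : continuous_field w -> 0 < e ->
  \forall th \near th0, forall x, hnorm (w th x - w th0 x) < e.
Proof.
move=> [pw cw] e0; have e2 : 0 < e / 2 by rewrite divr_gt0.
have /compact_near_coveringP cK := @segment_compact R 0 (2 * pi).
have h : \forall th \near th0, `[0, 2 * pi] `<=` [set x | hnorm (w th x - w th0 x) < e].
  apply: (cK _ _ (fun th x => hnorm (w th x - w th0 x) < e)) => x _.
  have [[A B] /= [hA hB] AB] := cw (th0, x) _ e2.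
  exists (B, A) => //= -[y th] /= [By Ath].
  rewrite (le_lt_trans (hnorm_triangle _ (w th0 x) _))// [e]splitr ltrD//.
    exact: (AB (th, y)).
  by rewrite hnorm_distC; apply: (AB (th0, y)); split=> //; exact: nbhs_singleton.
apply: filterS h => th hth x; have [y yK E] := @periodic_reduce R H x.
have -> : w th x = w th y by exact: E.
have -> : w th0 x = w th0 y by exact: E.
by apply: hth; rewrite /= in_itv.
Qed.

(** The neighbourhood of th0 is fixed before mu and F are given and depends on them through M alone,
    so one neighbourhood serves all periodograms and the limit. *)
Lemma form_field_continuous (M : R) (u v : Theta -> R -> H) th0 :
  0 <= M -> continuous_field u -> continuous_field v -> forall e : R, 0 < e ->
  \forall th \near th0, forall (mu : {finite_measure set R -> \bar R}) (F : R -> H -> H),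
    admissible mu F M ->
    cnorm (form mu F (u th) (v th) - form mu F (u th0) (v th0)) < e.
Proof.
move=> M0 cu cv e e0.
have [a a0 ua] := periodic_bounded (continuous_field_hcontinuous th0 cu) (cu.1 th0).
have [b b0 vb] := periodic_bounded (continuous_field_hcontinuous th0 cv) (cv.1 th0).
pose K := M * (a + b + 1).
have K0 : 0 <= K by rewrite mulr_ge0// !addr_ge0// ltW.
have K1 : 0 < K + 1 by rewrite ltr_wpDl.
pose d := Num.min 1 (e / 2 / (K + 1)).
have d0 : 0 < d by rewrite lt_min ltr01 !divr_gt0.
have d1 : d <= 1 by rewrite ge_min lexx.
have dK : d * K <= e / 2.
  rewrite (@le_trans _ _ (d * (K + 1)))//.
    by rewrite ler_wpM2l ?(ltW d0)// lerDl.
  by rewrite -ler_pdivlMr// ge_min lexx orbT.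
apply: filterS2 (continuous_field_equicontinuous th0 cu d0)
  (continuous_field_equicontinuous th0 cv d0) => th hu hv m G adm.
have hb t : hnorm (v th t) <= b + d.
  by rewrite -(subrK (v th0 t) (v th t)) (le_trans (hnormD _ _))// addrC lerD// ltW.
have bd0 : 0 < b + d by rewrite addr_gt0.
rewrite (le_lt_trans (form_diff adm M0 (continuous_field_hcontinuous th cu)
  (continuous_field_hcontinuous th cv) (continuous_field_hcontinuous th0 cu)
  (continuous_field_hcontinuous th0 cv) a0 bd0 d0 d0 ua hb
  (fun t => ltW (hu t)) (fun t => ltW (hv t))))//.
have -> : M * (d * (b + d) + a * d) = d * (M * (a + b + d)) by ring.
rewrite (@le_lt_trans _ _ (d * K))//; first by rewrite !ler_wpM2l ?(ltW d0)// lerD2l.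
by rewrite (le_lt_trans dK)// ltr_pdivrMr// ltr_pMr// ltr1n.
Qed.

Lemma form_field_cvg (mu_ : nat -> {finite_measure set R -> \bar R}) (F_ : nat -> R -> H -> H)
    (mu : {finite_measure set R -> \bar R}) (F : R -> H -> H) (M : R) (u v : Theta -> R -> H) :
  compact [set: Theta] -> 0 <= M ->
  (forall n, admissible (mu_ n) (F_ n) M) -> admissible mu F M ->
  (forall (h : int) x y, ccvg
    (fun n => complex_integral (mu_ n) (fun t => expi (h%:~R * t) * hdot (F_ n t y) x))
    (complex_integral mu (fun t => expi (h%:~R * t) * hdot (F t y) x))) ->
  continuous_field u -> continuous_field v -> forall e : R, 0 < e ->
  \forall n \near \oo, forall th,
    cnorm (form (mu_ n) (F_ n) (u th) (v th) - form mu F (u th) (v th)) < e.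
Proof.
move=> /compact_near_coveringP cT M0 adm_ adm coef cu cv e e0.
have e3 : 0 < e / 3 by rewrite divr_gt0.
have h : \forall n \near \oo, [set: Theta] `<=` [set th |
    cnorm (form (mu_ n) (F_ n) (u th) (v th) - form mu F (u th) (v th)) < e].
  (* Near-covering compactness along the filter of large n: convergence at th0 and the common
     neighbourhood of th0 give the local statement. *)
  apply: (cT _ _ (fun n th =>
    cnorm (form (mu_ n) (F_ n) (u th) (v th) - form mu F (u th) (v th)) < e)) => th0 _.
  have h1 := form_field_continuous th0 M0 cu cv e3.
  have h2 := form_cvg M0 adm_ adm coef (continuous_field_hcontinuous th0 cu) (cu.1 th0)
    (continuous_field_hcontinuous th0 cv) (cv.1 th0) e3.
  exists ([set th | forall (mu : {finite_measure set R -> \bar R}) (F : R -> H -> H),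
    admissible mu F M ->
    cnorm (form mu F (u th) (v th) - form mu F (u th0) (v th0)) < e / 3],
    [set n | cnorm (form (mu_ n) (F_ n) (u th0) (v th0) - form mu F (u th0) (v th0)) < e / 3]) => //=.
  move=> [th n] /= [hth hn].
  have g1 := hth _ _ (adm_ n); have := hth _ _ adm; rewrite cnorm_distC.
  move: g1 hn; set A := form _ _ _ _; set A0 := form _ _ _ _; set B0 := form _ _ _ _.
  set B := form _ _ _ _ => g1 g2 g3.
  have -> : A - B = (A - A0) + ((A0 - B0) + (B0 - B)) by ring.
  rewrite (le_lt_trans (cnormD _ _))// (le_lt_trans (lerD (lexx _) (cnormD _ _)))//.
  rewrite [ltRHS](_ : e = e / 3 + (e / 3 + e / 3)); last by field.
  by rewrite ltrD// ltrD.
by apply: filterS h => n hn th; exact: hn.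
Qed.

End continuous_fields.

Section quadratic_functionals.
Context {R : realType} {Theta : topologicalType} {H G : hilbertType R}.
Variables (m : nat) (g : 'I_m -> G) (fg : orthonormal_frame g).

(** With w the difference of the two adjoints at y, |w|^2 = <(L_q - L_p) w, y> <= d |w| |y|, so the
    norm bound on L_q - L_p passes to w. *)
Lemma adjoint_field (Lf : Theta -> R -> H -> G) (y : G) :
  continuous_operator_field Lf ->
  continuous_field (fun th x => adjoint (Lf th x) y).
Proof.
move=> [bL pL [_ cL]]; split; first by move=> th x /=; rewrite pL.
move=> p e e0; pose d := e / (hnorm y + 1).
have y1 : 0 < hnorm y + 1 by rewrite ltr_wpDl ?hnorm_ge0.
have d0 : 0 < d by rewrite divr_gt0.
apply: filterS (cL p d d0) => q hq.
set w := _ - _.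
have lA : linear (Lf q.1 q.2 - Lf p.1 p.2).
  move=> a x z; change (Lf q.1 q.2 (a *: x + z) - Lf p.1 p.2 (a *: x + z) =
    a *: (Lf q.1 q.2 x - Lf p.1 p.2 x) + (Lf q.1 q.2 z - Lf p.1 p.2 z)).
  by rewrite (bL q.1 q.2).1 (bL p.1 p.2).1 opprD addrACA scalerBr.
have /(opnorm_leP lA (ltW d0)) wd := ltW hq.
have wy : hnorm w ^+ 2 <= d * hnorm w * hnorm y.
  rewrite (le_trans _ (ler_wpM2r (hnorm_ge0 y) (wd w)))//.
  rewrite -[hnorm w ^+ 2]ger0_norm ?sqr_ge0// -cnormR -hdotxx {2}/w hdotBr -!adjointP// -hdotBl.
  exact: hdot_le.
have [w0|w0] := eqVneq (hnorm w) 0; first by rewrite w0.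
have wp : 0 < hnorm w by rewrite lt_neqAle eq_sym w0 hnorm_ge0.
have : hnorm w <= d * hnorm y.
  by rewrite -(ler_pM2r wp) -expr2 (le_trans wy)// mulrAC.
move=> /le_lt_trans; apply; rewrite /d mulrAC ltr_pdivrMr// ltr_pM2l// ltrDl//.
Qed.

Variables (Lf Rf : Theta -> R -> H -> G).
Hypotheses (cL : continuous_operator_field Lf) (cR : continuous_operator_field Rf).

Let u i th t := adjoint (Lf th t) (g i).
Let v i th t := adjoint (Rf th t) (g i).

Let cu i : continuous_field (u i).
Proof. exact: adjoint_field. Qed.

Let cv i : continuous_field (v i).
Proof. exact: adjoint_field. Qed.

(** R^H is applied to g_i, while L moves across the inner product onto g_j; hence the indices of the
    fields appear in the order j, i. *)
Lemma quadratic_functionalP (mu : {finite_measure set R -> \bar R}) (F : R -> H -> H)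
    (M : R) th : admissible mu F M ->
  linear (quadratic_functional Lf Rf mu F th) /\
  forall i j, hdot (quadratic_functional Lf Rf mu F th (g i)) (g j) =
    form mu F (u j th) (v i th).
Proof.
move=> [lF adm].
have bL t : bounded_op (Lf th t) by case: cL.
have bR t : bounded_op (Rf th t) by case: cR.
have E i j t : hdot (sandwich (Lf th t) (Rf th t) (F t) (g i)) (g j) =
    hdot (F t (v i th t)) (u j th t).
  by rewrite /sandwich /= adjointP.
have [||lQ EQ] := @bochner_frame _ _ _ _ _ _ fg mu
  (fun t => sandwich (Lf th t) (Rf th t) (F t)).
- by move=> t; exact: (linear_comp (linear_comp (adjoint_linear (bR t)) (lF t)) (bL t).1).
- move=> i j; under eq_fun do rewrite E.
  have [a a0 ua] := periodic_bounded (continuous_field_hcontinuous th (cu j)) ((cu j).1 th).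
  have [b b0 vb] := periodic_bounded (continuous_field_hcontinuous th (cv i)) ((cv i).1 th).
  by have [] := adm _ _ a b (continuous_field_hcontinuous th (cu j))
    (continuous_field_hcontinuous th (cv i)) a0 b0 ua vb.
split; first exact: lQ.
by move=> i j; rewrite EQ /form; congr complex_integral; apply/funext => t; exact: E.
Qed.

Lemma trace_norm_quadratic_diff (mu mu' : {finite_measure set R -> \bar R})
    (F F' : R -> H -> H) (M M' : R) th th' :
  admissible mu F M -> admissible mu' F' M' ->
  (trace_norm (quadratic_functional Lf Rf mu F th - quadratic_functional Lf Rf mu' F' th')%R <=
   (\sum_i \sum_j cnorm (form mu F (u j th) (v i th) - form mu' F' (u j th') (v i th')))%:E)%E.
Proof.
move=> adm adm'; have [l1 E1] := quadratic_functionalP th adm.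
have [l2 E2] := quadratic_functionalP th' adm'.
rewrite (le_trans (trace_norm_frame_le fg _))//; first exact: linear_sub.
rewrite lee_fin; apply: ler_sum => i _; apply: ler_sum => j _.
move: {l1 l2} (E1 i j) (E2 i j); move: (quadratic_functional _ _ _ _ _) => A.
move: (quadratic_functional _ _ _ _ _) => B <- <-; rewrite -hdotBl; exact: lexx.
Qed.

(** The denominator is m * m + 1 so that it stays positive for a zero-dimensional space. *)
Lemma double_sum_lt (z : 'I_m -> 'I_m -> R) (e : R) : 0 < e ->
  (forall i j, z i j < e / (m * m + 1)%:R) -> \sum_i \sum_j z i j < e.
Proof.
move=> e0 ze; have N0 : 0 < (m * m + 1)%:R :> R by rewrite ltr0n addn1.
rewrite (@le_lt_trans _ _ (\sum_(i < m) \sum_(j < m) (e / (m * m + 1)%:R)))//.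
  by apply: ler_sum => i _; apply: ler_sum => j _; exact: ltW.
under eq_bigr do rewrite sumr_const card_ord.
rewrite sumr_const card_ord -mulrnA -[_ *+ (m * m)]mulr_natr mulrAC ltr_pdivrMr// ltr_pM2l//.
by rewrite ltr_nat addn1.
Qed.

Lemma quadratic_functional_in_C (mu : {finite_measure set R -> \bar R}) (F : R -> H -> H)
    (M : R) : 0 <= M -> admissible mu F M ->
  in_C (@trace_norm R G) (quadratic_functional Lf Rf mu F).
Proof.
move=> M0 adm; split=> [th|th0 e e0].
  by have [l _] := quadratic_functionalP th adm; exact: (trace_norm_frame_fin fg).
have N0 : 0 < e / (m * m + 1)%:R by rewrite divr_gt0// ltr0n addn1.
have h : \forall th \near th0, forall i j,
    cnorm (form mu F (u j th) (v i th) - form mu F (u j th0) (v i th0)) < e / (m * m + 1)%:R.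
  apply: filter_forall => i; apply: filter_forall => j.
  by apply: filterS (form_field_continuous th0 M0 (cu j) (cv i) N0) => th; exact.
apply: filterS h => th hth; rewrite (le_lt_trans (trace_norm_quadratic_diff _ _ adm adm))//.
by rewrite lte_fin; apply: double_sum_lt.
Qed.

Lemma quadratic_functional_cvg
    (mu_ : nat -> {finite_measure set R -> \bar R}) (F_ : nat -> R -> H -> H)
    (mu : {finite_measure set R -> \bar R}) (F : R -> H -> H) (M : R) :
  compact [set: Theta] -> 0 <= M ->
  (forall n, admissible (mu_ n) (F_ n) M) -> admissible mu F M ->
  (forall (h : int) x y, ccvg
    (fun n => complex_integral (mu_ n) (fun t => expi (h%:~R * t) * hdot (F_ n t y) x))
    (complex_integral mu (fun t => expi (h%:~R * t) * hdot (F t y) x))) ->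
  uniform_cvg_in_C (@trace_norm R G)
    (fun n => quadratic_functional Lf Rf (mu_ n) (F_ n))
    (quadratic_functional Lf Rf mu F).
Proof.
move=> cT M0 adm_ adm coef; split.
- by move=> n; exact: quadratic_functional_in_C M0 (adm_ n).
- exact: quadratic_functional_in_C M0 adm.
apply/ecvg0P => [n|e e0]; first by apply: ereal_sup_ubound; left.
(* A supremum of values below e / 2 is only known to be at most e / 2, which is still strictly below
   e. *)
have e2 : 0 < e / 2 by rewrite divr_gt0.
have N0 : 0 < e / 2 / (m * m + 1)%:R by rewrite divr_gt0// ltr0n addn1.
have h : \forall n \near \oo, forall i j th,
    cnorm (form (mu_ n) (F_ n) (u j th) (v i th) - form mu F (u j th) (v i th))
      < e / 2 / (m * m + 1)%:R.
  apply: filter_forall => i; apply: filter_forall => j.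
  exact: form_field_cvg cT M0 adm_ adm coef (cu j) (cv i) _ N0.
apply: filterS h => n hn; apply: (@le_lt_trans _ _ (e / 2)%:E); last first.
  by rewrite lte_fin ltr_pdivrMr// ltr_pMr// ltr1n.
apply: ge_ereal_sup => _ [->|[th _ <-]]; first by rewrite lee_fin ltW.
rewrite (le_trans (trace_norm_quadratic_diff _ _ (adm_ n) adm))// lee_fin ltW//.
by apply: double_sum_lt.
Qed.

End quadratic_functionals.

(** * Spectral densities and periodograms *)

Section continuity_measurability.
Context {R : realType}.

Definition ccontinuous (phi : R -> R[i]) := forall (x e : R), 0 < e ->
  \forall y \near x, cnorm (phi y - phi x) < e.

Lemma ccontinuous_measurable phi : ccontinuous phi -> cmeasurable phi.
Proof.
move=> cphi; split; apply: continuous_measurable_fun => x; apply/cvgrPdist_lt => e e0;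
  apply: filterS (cphi x e e0) => y; rewrite distrC.
- by rewrite -ReB => /(le_lt_trans (Re_le_cnorm _)).
- by rewrite -ImB => /(le_lt_trans (Im_le_cnorm _)).
Qed.

Lemma hcontinuous_scalar (H : hilbertType R) (u v : R -> H) : hcontinuous u -> hcontinuous v ->
  scalar_measurable u v.
Proof.
move=> cu cv B /bounded_opP[lB [K K0 BK]]; apply: ccontinuous_measurable => x e e0.
pose C := K * (hnorm (u x) + 1) + K * hnorm (v x).
have C0 : 0 <= C by rewrite addr_ge0// mulr_ge0 ?addr_ge0 ?hnorm_ge0.
have C1 : 0 < C + 1 by rewrite ltr_wpDl.
pose d := Num.min 1 (e / (C + 1)).
have d0 : 0 < d by rewrite lt_min ltr01 divr_gt0.
apply: filterS2 (cu x d d0) (cv x d d0) => y hu hv.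
have uy : hnorm (u y) <= hnorm (u x) + 1.
  rewrite -(subrK (u x) (u y)) (le_trans (hnormD _ _))// addrC lerD2l (le_trans (ltW hu))//.
  by rewrite ge_min lexx.
have -> : hdot (B (v y)) (u y) - hdot (B (v x)) (u x) =
    hdot (B (v y - v x)) (u y) + hdot (B (v x)) (u y - u x).
  by rewrite (linB lB) hdotBl hdotBr addrA subrK.
rewrite (le_lt_trans (cnormD _ _))// (@le_lt_trans _ _ (d * C))//.
  rewrite mulrDr lerD// (le_trans (hdot_le _ _))//.
    rewrite mulrA ler_pM ?hnorm_ge0// (le_trans (BK _))// mulrC ler_wpM2r// ltW//.
  by rewrite mulrC ler_pM ?hnorm_ge0// ltW.
rewrite (@lt_le_trans _ _ (d * (C + 1)))// ?ltr_pM2l ?ltrDl//.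
by rewrite -ler_pdivlMr// ge_min lexx orbT.
Qed.

Lemma ccvg_unique (z : nat -> R[i]) a b : ccvg z a -> ccvg z b -> a = b.
Proof.
move=> za zb; apply/eqP; rewrite -subr_eq0; apply/eqP/cnorm_eq0/eqP.
rewrite eq_le cnorm_ge0 andbT; apply/ler_addgt0Pl => e e0; rewrite addr0.
have e2 : 0 < e / 2 by rewrite divr_gt0.
have [n [/= h1 h2]] := filter_ex (filterI (za _ e2) (zb _ e2)).
rewrite -(subrK (z n) a) -addrA [e]splitr (le_trans (cnormD _ _))// lerD//; last exact: ltW.
by rewrite cnorm_distC ltW.
Qed.

End continuity_measurability.

(** * Densities of operator measures *)

Section operator_densities.
Context {R : realType} {H : hilbertType R}.
Variables (nu : set R -> H -> H) (mu : {finite_measure set R -> \bar R}) (f : R -> H -> H).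
Hypothesis nuf : operator_density nu mu f.

Lemma operator_density_admissible : exists2 M : R, 0 <= M & admissible mu f M.
Proof.
(* The density identity on the whole line makes f itself Bochner integrable. *)
have := nuf.2 _ (@measurableT _ R).
rewrite (_ : (fun x => _) = f); last first.
  by apply/funext => x; rewrite indicT scale1r.
move=> fI; have [M M0 MP] := bochner_form_bound fI; exists M => //; split.
  by move=> t; exact: bochner_integrand_linear fI t.
move=> u v a b cu cv a0 b0 ua vb; apply: MP => //; exact: hcontinuous_scalar.
Qed.

Lemma operator_density_form A x y : measurable A ->
  cintegrable mu (fun t => \1_A t * hdot (f t y) x) /\
  complex_integral mu (fun t => \1_A t * hdot (f t y) x) = hdot (nu A y) x.
Proof.
move=> mA; have := bochner_form (nuf.2 _ mA) y x.
by rewrite (_ : (fun t => hdot _ _) = (fun t => \1_A t * hdot (f t y) x))//; apply/funext => t; rewrite -hdotZl.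
Qed.

(** The step sums, tested on y and x, have both sides as limits: the left one by uniform
    approximation of phi against an integrable density, the right one by convergence in trace
    norm. *)
Lemma vector_integral_density (phi : R -> R[i]) (I : H -> H) x y :
  is_vector_integral (@trace_norm R H) nu phi I ->
  cintegrable mu (fun t => phi t * hdot (f t y) x) ->
  complex_integral mu (fun t => phi t * hdot (f t y) x) = hdot (I y) x.
Proof.
move=> [s [sm su sI]] iphi.
have ig : cintegrable mu (fun t => hdot (f t y) x).
  have [i _] := operator_density_form x y (@measurableT _ R).
  by under eq_fun do rewrite -[hdot _ _]mul1r; move: i; rewrite indicT.
have Cg : mu.-integrable setT (EFin \o (fun t => cnorm (hdot (f t y) x))).
  have [i1 i2] := ig.
  apply: (le_integrable measurableT _ _ (integrableD measurableT (integrable_norm i1) (integrable_norm i2))).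
    apply/measurable_EFinP; apply: measurable_cnorm; exact: cintegrable_measurable ig.
  move=> t _ /=; rewrite lee_fin ger0_norm ?cnorm_ge0// (le_trans (cnorm_le_ReIm _))//.
  exact: ler_norm.
pose z n := hdot ((\sum_(p <- s n) p.2 *: nu p.1) y) x.
have stepE n : cintegrable mu (fun t => step (s n) t * hdot (f t y) x) /\
    complex_integral mu (fun t => step (s n) t * hdot (f t y) x) = z n.
  have E t : step (s n) t * hdot (f t y) x =
      \sum_(p <- s n) p.2 * (\1_(p.1) t * hdot (f t y) x).
    rewrite /step mulr_suml; apply: eq_bigr => p _.
    by rewrite mulrA [p.2 * _]mulrC.
  under eq_fun do rewrite E.
  have [|i ->] := @cint_sum_both _ _ _ mu _ (s n) (fun (p : set R * R[i]^o) t => p.2 * (\1_(p.1) t * hdot (f t y) x)).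
    by move=> p /(sm n) mp; apply: cintegrableZ; exact: (operator_density_form x y mp).1.
  split=> //; rewrite /z fct_sumE hdot_suml; apply: eq_big_seq => p /(sm n) mp.
  have [i1 i2] := operator_density_form x y mp.
  by rewrite cintZ// i2 -hdotZl.
apply: (@ccvg_unique _ z) => e e0.
- pose C := Rintegral mu setT (fun t => cnorm (hdot (f t y) x)).
  have C0 : 0 <= C by apply: Rintegral_ge0 => t _; exact: cnorm_ge0.
  have d0 : 0 < e / (2 * C + 1) by rewrite divr_gt0// ltr_wpDl// mulr_ge0.
  apply: filterS (su _ d0) => n hn; have [i <-] := stepE n.
  rewrite -cintB// (@le_lt_trans _ _ (2 * (e / (2 * C + 1) * C)))//.
    rewrite -RintegralZl//; apply: cint_le.
    + exact: cintegrableB.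
    + exact: (integrableZl measurableT (e / (2 * C + 1)) Cg).
    + move=> t; rewrite -mulrBl cnormM; apply: ler_wpM2r; first exact: cnorm_ge0.
      exact: ltW (hn t).
  have D0 : 0 < 2 * C + 1 by rewrite ltr_wpDl// mulr_ge0.
  have -> : 2 * (e / (2 * C + 1) * C) = e * (2 * C) / (2 * C + 1) by field; rewrite gt_eqF.
  by rewrite ltr_pdivrMr// ltr_pM2l// ltrDl.
- pose a := hnorm x + 1; pose b := hnorm y + 1.
  have a0 : 0 < a by rewrite ltr_wpDl ?hnorm_ge0.
  have b0 : 0 < b by rewrite ltr_wpDl ?hnorm_ge0.
  have d0 : 0 < e / (a * b) by rewrite divr_gt0// mulr_gt0.
  have h := (ecvg0P (fun n => trace_norm_ge0 _)).1 sI _ d0.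
  apply: filterS h => n hn; rewrite /z -hdotBl -lte_fin.
  apply: (le_lt_trans (@trace_norm_form_le _ _ (\sum_(p <- s n) p.2 *: nu p.1 - I) y x a b a0 b0 _ _)).
  + by rewrite lerDl.
  + by rewrite lerDl.
  by rewrite -lte_pdivlMl ?mulr_gt0// -EFinM mulrC.
Qed.

End operator_densities.

(** * Normalised Lebesgue measure and orthogonality of exponentials *)

Section torus_measure.
Context {R : realType}.

(** [Leb_torus] is a bare set function; its measure structure is transported from this scaled
    restriction. *)
Let Leb_mscale := [the measure _ _ of mscale (NngNum inv_2pi_ge0)
  (mrestr lebesgue_measure (@measurable_torus R))].

Let Leb_torus0 : (@Leb_torus R) set0 = 0%E.
Proof. exact: measure0 Leb_mscale. Qed.

Let Leb_torus_ge0 A : (0 <= (@Leb_torus R) A)%E.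
Proof. exact: measure_ge0 Leb_mscale A. Qed.

Let Leb_torus_additive : semi_sigma_additive (@Leb_torus R).
Proof. exact: (@measure_semi_sigma_additive _ _ _ Leb_mscale). Qed.

HB.instance Definition _ := isMeasure.Build _ _ _ (@Leb_torus R)
  Leb_torus0 Leb_torus_ge0 Leb_torus_additive.

Let Leb_torus_fin : fin_num_fun (@Leb_torus R).
Proof.
move=> A mA; rewrite fin_numM// ge0_fin_numE ?measure_ge0//.
rewrite (@le_lt_trans _ _ (lebesgue_measure (@torus R)))//.
  apply: le_measure; rewrite ?inE; [|exact: measurable_torus|exact: subIsetr].
  by apply: measurableI => //; exact: measurable_torus.
by rewrite lebesgue_measure_itv /=; case: ifP => _; rewrite ?ltry// -EFinB ltry.
Qed.

HB.instance Definition _ := Measure_isFinite.Build _ _ _ (@Leb_torus R) Leb_torus_fin.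

(* the carrier of [lebesgue_measure], which differs from R by its display *)
Let ocitv_sigma := g_sigma_algebraType R.-ocitv.-measurable.

Lemma ltNpi : - pi < pi :> R.
Proof. by rewrite (@lt_trans _ _ 0)// ?oppr_lt0 ?pi_gt0. Qed.

(** This gives access to integration against a uniform law on the closed interval, which exceeds the
    half-open torus by a null endpoint. *)
Lemma Leb_torus_uniform A : measurable A ->
  Leb_torus A = uniform_prob ltNpi A.
Proof.
move=> mA; transitivity (\int[uniform_prob ltNpi]_x (\1_A x)%:E)%E; last first.
  by rewrite integral_indic// setIT.
rewrite (@integral_uniform _ _ _ ltNpi (fun x => (\1_A x)%:E)).
- rewrite -integral_itv_obnd_cbnd.
    rewrite integral_indic//.
    by rewrite opprK; congr (_%:E * _)%E; congr (_^-1); ring.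
  by apply/measurable_EFinP; apply: measurable_indic.
- by apply/measurable_EFinP; apply: measurable_indic.
- by move=> x; rewrite lee_fin.
Qed.

Lemma Leb_torusT : Leb_torus setT = 1%E :> \bar R.
Proof.
rewrite Leb_torus_uniform; last exact: measurableT.
by rewrite /uniform_prob (integral_uniform_pdf1 ltNpi).
Qed.

Lemma Rintegral_torus_cst (c : R) : Rintegral (@Leb_torus R) setT (fun=> c) = c.
Proof.
apply: etrans; first exact: Rintegral_cst.
by rewrite -[RHS]mulr1; congr (_ * _); exact: (congr1 fine Leb_torusT).
Qed.

(** Adding the bound c makes the integrand nonnegative, as the transfer between measures requires; c
    is subtracted again at the end. *)
Lemma Rintegral_torus (f : R -> R) (c : R) : measurable_fun setT f ->
  (forall t, `|f t| <= c) ->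
  (\int[lebesgue_measure]_(t in `[(- pi)%R, pi%R]) (f t + c)%:E = (2 * pi * c)%:E)%E ->
  Rintegral (@Leb_torus R) setT f = 0.
Proof.
move=> mf fc fI.
have mfc : measurable_fun setT (fun t => f t + c) by exact: measurable_funD.
have f0 t : 0 <= f t + c.
  by have := fc t; rewrite ler_norml => /andP[h _]; rewrite -lerBlDr sub0r.
have mid : measurable_fun setT (id : ocitv_sigma -> R) by move=> _ A mA; rewrite setTI.
have U := ge0_integral_transfer mid Leb_torus_uniform.
have E : Rintegral (@Leb_torus R) setT (fun t => f t + c) = c.
  rewrite /Rintegral U; last 2 first.
  - exact/measurable_EFinP.
  - by move=> t; rewrite lee_fin.
  rewrite integral_uniform ?fI.
  - have -> : 2 * pi * c = (pi - - pi) * c by rewrite opprK mulr2n mulrDl mul1r.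
    by rewrite -EFinM /= mulKf// gt_eqF// opprK addr_gt0 ?pi_gt0.
  - exact/measurable_EFinP.
  - by move=> t; rewrite lee_fin.
have fi : (@Leb_torus R).-integrable setT (EFin \o f).
  apply: (le_integrable measurableT _ _ (integrable_cst_fin Leb_torus c)).
    exact/measurable_EFinP.
  by move=> t _ /=; rewrite lee_fin (le_trans (fc t))// ler_norm.
have ci := integrable_cst_fin Leb_torus c.
by move: E; rewrite RintegralD// Rintegral_torus_cst => /eqP; rewrite -subr_eq0 addrK => /eqP.
Qed.

Lemma Rintegral_torus_derive (f F : R -> R) (c : R) : continuous f ->
  (forall t, is_derive t (1 : R) F (f t)) -> F (- pi) = F pi -> (forall t, `|f t| <= c) ->
  Rintegral (@Leb_torus R) setT f = 0.
Proof.
move=> cf dF Fpi fc; apply: (Rintegral_torus _ fc); first exact: continuous_measurable_fun.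
(* An antiderivative of f + c, with increment 2 pi c over the period because F takes equal values at
   the ends. *)
pose G t := F t + c * t.
have dG t : is_derive t (1 : R) G (f t + c).
  have := dF t => dFt.
  have -> : G = F + (c *: id) by apply/funext.
  have -> : f t + c = f t + c *: 1 by rewrite [c *: 1]mulr1.
  exact: is_deriveD.
have cG t : {for t, continuous G}.
  by apply: differentiable_continuous; apply/derivable1_diffP; case: (dG t).
rewrite (@continuous_FTC2 _ (fun t => f t + c) G).
- by rewrite -EFinB /G Fpi; congr (_%:E); ring.
- exact: ltNpi.
- by apply: continuous_subspaceT => t; apply: cvgD; [exact: cf | exact: cvg_cst].
- split; [by move=> t _; case: (dG t) | apply: cvg_at_right_filter; exact: cG | apply: cvg_at_left_filter; exact: cG].
- by move=> t _; rewrite derive1E; by case: (dG t).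
Qed.

Lemma expi2pi_int (k : int) : expi (2 * pi * k%:~R) = 1 :> R[i].
Proof.
case: k => n; first exact: expi2pi_nat.
by rewrite NegzE mulrNz mulrN expiN expi2pi_nat rmorph1.
Qed.

Lemma expi_Npi (k : int) : expi (k%:~R * - pi) = expi (k%:~R * pi) :> R[i].
Proof.
have -> : k%:~R * pi = k%:~R * - pi + 2 * pi * k%:~R :> R by ring.
by rewrite expiD expi2pi_int mulr1.
Qed.

Lemma cint_Leb_expi (k : int) :
  cintegrable (@Leb_torus R) (fun t => expi (k%:~R * t)) /\
  complex_integral (@Leb_torus R) (fun t => expi (k%:~R * t)) = (k == 0)%:R.
Proof.
have ce : ccontinuous (fun t : R => expi (k%:~R * t)).
  move=> x e e0.
  have ca : (fun s : R => k%:~R * s) @ x --> k%:~R * x by apply: cvgM; [exact: cvg_cst | exact: cvg_id].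
  exact: ca (expi_continuous (k%:~R * x) e0).
split.
  by apply: (@cintegrable_bounded _ _ _ _ _ 1); [exact: ccontinuous_measurable | move=> t; rewrite cnorm_expi].
have [->|k0] := eqVneq k 0.
  rewrite mulr0z; under eq_fun do rewrite mul0r expi0.
  by apply: complex_eq; rewrite /= Rintegral_torus_cst.
have kR : k%:~R != 0 :> R by rewrite intr_eq0.
have dk (t : R) : is_derive t (1 : R) (fun t => k%:~R * t) k%:~R.
  rewrite (_ : (fun t : R => _) = k%:~R *: id); last by apply/funext.
  by rewrite -[X in is_derive _ _ _ X]mulr1; exact: is_deriveZ.
have Epi := expi_Npi k.
apply: complex_eq => /=.
- apply: (@Rintegral_torus_derive _ (fun t => (k%:~R)^-1 * sin (k%:~R * t)) 1).
  + move=> t; apply: continuous_comp; [exact: mulrl_continuous|exact: continuous_cos].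
  + move=> t; have E : (k%:~R)^-1 * (cos (k%:~R * t) * k%:~R) = cos (k%:~R * t) by rewrite mulrC mulfK.
    rewrite -[X in is_derive _ _ _ X]E.
    exact: (is_deriveZ (k%:~R)^-1 (is_derive1_comp (is_derive_sin (k%:~R * t)) (dk t))).
  + by have /(congr1 (@complex.Im R)) /= -> := Epi.
  + by move=> t; rewrite ler_norml cos_geN1 cos_le1.
- apply: (@Rintegral_torus_derive _ (fun t => - (k%:~R)^-1 * cos (k%:~R * t)) 1).
  + move=> t; apply: continuous_comp; [exact: mulrl_continuous|exact: continuous_sin].
  + move=> t; have E : - (k%:~R)^-1 * (- sin (k%:~R * t) * k%:~R) = sin (k%:~R * t) by rewrite mulNr mulNr mulrN opprK mulrC mulfK.
    rewrite -[X in is_derive _ _ _ X]E.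
    exact: (is_deriveZ (- (k%:~R)^-1) (is_derive1_comp (is_derive_cos (k%:~R * t)) (dk t))).
  + by have /(congr1 (@complex.Re R)) /= -> := Epi.
  + by move=> t; rewrite ler_norml sin_geN1 sin_le1.
Qed.

End torus_measure.

(** * Lagged averages *)

Section cesaro_averages.
Context {R : realType}.
Implicit Types (z w : nat -> R[i]) (a b : R[i]).

Definition average z n : R[i] := (n%:R^-1)%:C%C * \sum_(k < n) z k.

Lemma natVC n : (n%:R : R[i])^-1 = (n%:R^-1 : R)%:C%C.
Proof. by rewrite natC fmorphV. Qed.

Lemma ccvg_inv_nat c : ccvg (fun n => (n%:R^-1 : R)%:C%C * c) 0.
Proof.
move=> e e0; have := nbhs_infty_gtr (cnorm c / e); apply: filterS => n hn.
have n0 : 0 < n%:R :> R by rewrite (le_lt_trans _ hn)// divr_ge0 ?cnorm_ge0// ltW.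
rewrite subr0 cnormM cnormR ger0_norm ?invr_ge0 ?ltW// mulrC ltr_pdivrMr//.
by rewrite mulrC -ltr_pdivrMr.
Qed.

Lemma ccvg_shift z a (p q : nat) : ccvg z a -> ccvg (fun n => z (n - p + q)%N) a.
Proof.
move=> za e e0; have [N _ NP] := za e e0.
exists (N + p)%N => // n /= Nn; apply: NP => /=; lia.
Qed.

Lemma ccvg_ratio (p q : nat) :
  ccvg (fun n => (n%:R^-1 : R)%:C%C * (n - p + q)%:R) 1.
Proof.
have h := ccvgD (ccvg_cst 1) (ccvg_inv_nat (q%:R - p%:R)).
rewrite -[X in ccvg _ X]addr0; apply: ccvg_near h; exists p.+1 => // n /= pn.
have n0 : (n%:R : R) != 0 by rewrite pnatr_eq0; lia.
have -> : (n - p + q)%:R = n%:R + (q%:R - p%:R) :> R[i].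
  by rewrite natrD natrB ?(ltnW pn)// addrA addrAC.
by rewrite [RHS]mulrDr -natVC mulVf// natC; apply: contra_neq n0 => /(congr1 (@complex.Re R)).
Qed.

(** A lagged sample moment has n - p terms but is divided by n. The window is a full sum of n - p +
    q terms without its first q, which are negligible, and (n - p + q) / n tends to 1. *)
Lemma average_window z a (p q : nat) : ccvg (average z) a ->
  ccvg (fun n => (n%:R^-1 : R)%:C%C * \sum_(k < n - p) z (k + q)%N) a.
Proof.
move=> za; rewrite -[X in ccvg _ X]mul1r -[X in ccvg _ X]subr0.
apply: ccvg_near (ccvgB (ccvgM (ccvg_ratio p q) (ccvg_shift p q za))
  (ccvg_inv_nat (\sum_(k < q) z k))).
exists p.+1 => // n /= pn; rewrite /average -[RHS]addr0.
have -> : \sum_(k < n - p + q) z k = \sum_(k < q) z k + \sum_(k < n - p) z (k + q)%N.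
  by rewrite addnC big_split_ord; congr (_ + _); apply: eq_bigr => k _ /=; congr z; exact: addnC.
have N0 : (n - p + q)%:R != 0 :> R[i] by rewrite pnatr_eq0; lia.
rewrite [X in X - _]mulrA -[X in X * _ - _]mulrA -(natVC (n - p + q)) mulfV//.
by rewrite mulr1 mulrDr addrC addKr addr0.
Qed.

(** A is the limiting mean of the window and A0 that of the centring; the terms in A0 cancel in the
    limit because the centred factors be l - b n average to zero. *)
Lemma average_covariance (al be : nat -> R[i]) (p : nat) (a b : nat -> R[i]) (g A A0 B : R[i]) :
  ccvg (fun n => (n%:R^-1 : R)%:C%C * \sum_(l < n - p) al l * be l) g ->
  ccvg (fun n => (n%:R^-1 : R)%:C%C * \sum_(l < n - p) al l) A ->
  ccvg (fun n => (n%:R^-1 : R)%:C%C * \sum_(l < n - p) be l) B ->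
  ccvg a A0 -> ccvg b B ->
  ccvg (fun n => (n%:R^-1 : R)%:C%C * \sum_(l < n - p) (al l - a n) * (be l - b n)) (g - A * B).
Proof.
move=> hg hA hB ha hb.
have -> : g - A * B = g - A * B - A0 * B + 1 * (A0 * B) by ring.
apply: ccvg_near (ccvgD (ccvgB (ccvgB hg (ccvgM hA hb)) (ccvgM ha hB))
  (ccvgM (ccvg_ratio p 0) (ccvgM ha hb))).
apply: nearW => n; rewrite addn0.
have -> : \sum_(l < n - p) (al l - a n) * (be l - b n) =
    \sum_(l < n - p) al l * be l - (\sum_(l < n - p) al l) * b n
    - a n * (\sum_(l < n - p) be l) + (n - p)%:R * (a n * b n).
  rewrite mulr_suml mulr_sumr mulr_natl -[X in _ *+ X]card_ord -sumr_const.
  rewrite -!sumrB -big_split /=; apply: eq_bigr => l _; ring.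
by ring.
Qed.

Lemma ccvg_ReIm z a : complex.Re (z n) @[n --> \oo] --> complex.Re a ->
  complex.Im (z n) @[n --> \oo] --> complex.Im a -> ccvg z a.
Proof.
move=> /cvgrPdist_lt h1 /cvgrPdist_lt h2 e e0; have e2 : 0 < e / 2 by rewrite divr_gt0.
apply: filterS2 (h1 _ e2) (h2 _ e2) => n; rewrite ![`|_ - (_ (z n))|]distrC -ReB -ImB => k1 k2.
by rewrite (le_lt_trans (cnorm_le_ReIm _))// [e]splitr ltrD.
Qed.

End cesaro_averages.

Section lagged_sums.
Context {R : realType}.

(** The Kronecker factor keeps the pairs whose later index stays within the sample, hence n - p
    terms. *)
Lemma sum_lag (n p : nat) (z : nat -> nat -> R[i]) :
  \sum_(1 <= k < n.+1) \sum_(1 <= l < n.+1) (k == (l + p)%N)%:R * z k l =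
  \sum_(l < n - p) z (l.+1 + p)%N l.+1.
Proof.
rewrite big_add1 /= big_mkord /=; under eq_bigr => k _ do rewrite big_add1 /= big_mkord /=.
rewrite exchange_big /= (big_ord_widen n (fun l => z (l.+1 + p)%N l.+1)) ?leq_subr//.
rewrite [RHS]big_mkcond /=; apply: eq_bigr => l _; case: ifP => lp.
  have k1 : (l + p < n)%N by lia.
  rewrite (bigD1 (Ordinal k1)) //= addSn eqxx mul1r big1 ?addr0// => k.
  by rewrite -val_eqE /= eqSS => /negbTE ->; rewrite mul0r.
apply: big1 => k _; rewrite addSn eqSS (_ : (_ == _) = false) ?mul0r//.
by apply/negbTE/eqP => E; move: (ltn_ord k); rewrite E; lia.
Qed.

End lagged_sums.

(** * Periodograms: mass and Fourier coefficients *)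

Section periodograms.
Context {R : realType} {H : hilbertType R}.
Implicit Types (u : int -> H) (n : nat).

Lemma cint_Leb_double_sum (I J : eqType) (r : seq I) (s : seq J) (k : I -> J -> int)
    (z : I -> J -> R[i]) :
  complex_integral (@Leb_torus R)
    (fun t => \sum_(i <- r) \sum_(j <- s) z i j * expi ((k i j)%:~R * t)) =
  \sum_(i <- r) \sum_(j <- s) z i j * (k i j == 0)%:R.
Proof.
have one i j : cintegrable (@Leb_torus R) (fun t => z i j * expi ((k i j)%:~R * t)) /\
    complex_integral (@Leb_torus R) (fun t => z i j * expi ((k i j)%:~R * t)) =
    z i j * (k i j == 0)%:R.
  have [h1 h2] := @cint_Leb_expi R (k i j).
  by split; [exact: cintegrableZ | rewrite cintZ// h2].
have inner i := @cint_sum_both _ _ _ (@Leb_torus R) _ s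
  (fun j t => z i j * expi ((k i j)%:~R * t)) (fun j _ => (one i j).1).
have [_ ->] := @cint_sum_both _ _ _ (@Leb_torus R) _ r
  (fun i t => \sum_(j <- s) z i j * expi ((k i j)%:~R * t)) (fun i _ => (inner i).1).
apply: eq_bigr => i _; rewrite (inner i).2; apply: eq_bigr => j _; exact: (one i j).2.
Qed.

Lemma dft_trig u n : dft u n = trig [seq (- k%:Z, ((Num.sqrt n%:R)^-1)%:C%C *: centered u n k) |
  k <- index_iota 1 n.+1].
Proof.
apply/funext => t; rewrite /trig /dft scaler_sumr big_map; apply: eq_bigr => k _ /=.
by rewrite !scalerA mulrC; congr (_ * _ *: _); congr expi; rewrite mulrNz mulNr mulrC.
Qed.

Lemma dft_hcontinuous u n : hcontinuous (dft u n).
Proof. by rewrite dft_trig; exact: hcontinuous_trig. Qed.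

Lemma dft_hdot u n t x : hdot (dft u n t) x = \sum_(1 <= k < n.+1)
  ((Num.sqrt n%:R)^-1)%:C%C * hdot (centered u n k) x * expi (- k%:R * t).
Proof.
rewrite /dft hdotZl hdot_suml mulr_sumr; apply: eq_bigr => k _.
by rewrite hdotZl -mulrA [hdot _ _ * _]mulrC mulNr [k%:R * t]mulrC.
Qed.

Lemma dft_hdotC u n t x : hdot x (dft u n t) = \sum_(1 <= k < n.+1)
  ((Num.sqrt n%:R)^-1)%:C%C * (hdot (centered u n k) x)^* * expi (k%:R * t).
Proof.
rewrite hdotC dft_hdot rmorph_sum; apply: eq_bigr => k _.
by rewrite !rmorphM /= conjR mulNr expiN conjCK.
Qed.

Lemma sqrt_invM n : ((Num.sqrt n%:R)^-1)%:C%C * ((Num.sqrt n%:R)^-1)%:C%C = (n%:R^-1)%:C%C :> R[i].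
Proof. by rewrite -rmorphM/= -invfM -expr2 sqr_sqrtr. Qed.

Lemma centered_sum u n : \sum_(1 <= k < n.+1) centered u n k = 0.
Proof.
rewrite /centered sumrB sumr_const_nat subn1 /=.
have [->|n0] := eqVneq n 0%N; first by rewrite big_geq// mulr0n subr0.
by rewrite -scaler_nat scalerA mulfV ?pnatr_eq0// scale1r subrr.
Qed.

(** Pythagoras summed over k: the cross terms with the sample mean cancel because the centred
    observations sum to zero. *)
Lemma centered_sqr_le u n :
  \sum_(1 <= k < n.+1) hnorm (centered u n k) ^+ 2 <= \sum_(1 <= k < n.+1) hnorm (u k%:Z) ^+ 2.
Proof.
pose m := (n%:R : R[i])^-1 *: \sum_(1 <= j < n.+1) u j%:Z.
have E k : hnorm (u k%:Z) ^+ 2 = hnorm (centered u n k) ^+ 2 + hnorm m ^+ 2 +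
    2 * complex.Re (hdot (centered u n k) m).
  by rewrite -[u k%:Z](subrK m) hnorm2D addrAC.
under [leRHS]eq_bigr do rewrite E.
have S0 : \sum_(1 <= k < n.+1) 2 * complex.Re (hdot (centered u n k) m) = 0.
  rewrite -mulr_sumr; suff -> : \sum_(1 <= k < n.+1) complex.Re (hdot (centered u n k) m) = 0.
    by rewrite mulr0.
  have := congr1 (fun x => complex.Re (hdot x m)) (centered_sum u n).
  by rewrite hdot_suml Re_sum hdot0l.
rewrite !big_split /= -addrA S0 addr0 lerDl.
by rewrite sumr_ge0// => k _; rewrite sqr_ge0.
Qed.

(** Parseval's identity for the centred sample. *)
Lemma cint_dft_sqr u n : complex_integral (@Leb_torus R) (fun t => hdot (dft u n t) (dft u n t)) =
  (n%:R^-1 * \sum_(1 <= k < n.+1) hnorm (centered u n k) ^+ 2)%:C%C.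
Proof.
have E t : hdot (dft u n t) (dft u n t) = \sum_(k <- index_iota 1 n.+1) \sum_(l <- index_iota 1 n.+1)
    (n%:R^-1)%:C%C * hdot (centered u n k) (centered u n l) * expi ((l%:Z - k%:Z)%:~R * t).
  rewrite dft_hdot; apply: eq_bigr => k _.
  rewrite dft_hdotC mulr_sumr mulr_suml; apply: eq_bigr => l _ /=.
  rewrite -hdotC intrB mulrBl expiD -sqrt_invM mulNr.
  by ring.
under [in LHS]eq_fun do rewrite E.
rewrite cint_Leb_double_sum rmorphM rmorph_sum mulr_sumr /=; apply: eq_big_seq => k kr.
rewrite (bigD1_seq k) ?iota_uniq//= subrr eqxx mulr1 big1 ?addr0 => [|l lk].
  by rewrite -hdotxx.
by rewrite subr_eq0 eqz_nat (negbTE lk) mulr0.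
Qed.

Lemma periodogram_hdot u n t x y :
  hdot (periodogram u n t y) x = hdot y (dft u n t) * hdot (dft u n t) x.
Proof. by rewrite /periodogram /tensor hdotZl. Qed.

(** Pointwise the form is at most a b |d|^2, where d is the transform; Parseval integrates this
    bound, and the 2 is that of [cint_le]. *)
Lemma periodogram_admissible u n : admissible (@Leb_torus R) (periodogram u n)
  (2 * (n%:R^-1 * \sum_(1 <= k < n.+1) hnorm (u k%:Z) ^+ 2)).
Proof.
split=> [t a x y|x y a b cx cy a0 b0 xa yb].
  change (hdot (a *: x + y) (dft u n t) *: dft u n t =
    a *: (hdot x (dft u n t) *: dft u n t) + hdot y (dft u n t) *: dft u n t).
  by move: (dft u n t) => d; rewrite hdotDl hdotZl scalerDl scalerA.
have idb : bounded_op (id : H -> H).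
  by apply/bounded_opP; split=> //; exists 1 => // z; rewrite mul1r.
have cd := dft_hcontinuous u n.
have md := hcontinuous_scalar cd cd idb.
have le t : cnorm (hdot (periodogram u n t (y t)) (x t)) <=
    a * b * complex.Re (hdot (dft u n t) (dft u n t)).
  rewrite periodogram_hdot cnormM hdotxx /=.
  rewrite (le_trans (ler_pM _ _ (hdot_le _ _) (hdot_le _ _))) ?cnorm_ge0//.
  move: (xa t) (yb t) (hnorm_ge0 (x t)) (hnorm_ge0 (y t)).
  move: (hnorm (dft u n t)) (hnorm (x t)) (hnorm (y t)) => d p q pa qb p0 q0.
  have -> : q * d * (d * p) = p * q * d ^+ 2 by ring.
  by rewrite ler_wpM2r ?sqr_ge0// ler_pM.
have id : cintegrable (@Leb_torus R) (fun t => hdot (dft u n t) (dft u n t)).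
  pose D := \sum_(1 <= k < n.+1) hnorm (((Num.sqrt n%:R)^-1)%:C%C *: centered u n k).
  have dD t : hnorm (dft u n t) <= D.
    rewrite dft_trig /trig big_map (le_trans (hnorm_sum _ _ _))// /D.
    by apply: ler_sum => k _; rewrite hnormZ cnorm_expi mul1r.
  apply: (cintegrable_bounded _ md (c := D * D)) => t.
  by rewrite (le_trans (hdot_le _ _))// ler_pM ?hnorm_ge0.
have iB : (@Leb_torus R).-integrable setT
    (EFin \o (fun t => a * b * complex.Re (hdot (dft u n t) (dft u n t)))).
  exact: (integrableZl measurableT (a * b) id.1).
have iF : cintegrable (@Leb_torus R) (fun t => hdot (periodogram u n t (y t)) (x t)).
  apply: (cintegrable_dom _ iB le).
  under eq_fun do rewrite periodogram_hdot.
  apply: cmeasurableM; [exact: hcontinuous_scalar cd cy _ idb|exact: hcontinuous_scalar cx cd _ idb].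
split=> //; rewrite /form (le_trans (cint_le iF iB le))// RintegralZl//; last exact: id.1.
rewrite -[leRHS]mulrA ler_pM2l// [leRHS]mulrC ler_pM2l ?mulr_gt0//.
have /(congr1 (@complex.Re R)) /= -> := cint_dft_sqr u n.
by rewrite ler_wpM2l ?invr_ge0// centered_sqr_le.
Qed.

Lemma periodogram_coef u n (h : int) x y :
  complex_integral (@Leb_torus R) (fun t => expi (h%:~R * t) * hdot (periodogram u n t y) x) =
  (n%:R^-1)%:C%C * \sum_(1 <= k < n.+1) \sum_(1 <= l < n.+1)
    (h + l%:Z - k%:Z == 0)%:R * (hdot (centered u n k) x * (hdot (centered u n l) y)^*).
Proof.
have E t : expi (h%:~R * t) * hdot (periodogram u n t y) x =
    \sum_(k <- index_iota 1 n.+1) \sum_(l <- index_iota 1 n.+1)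
    (n%:R^-1)%:C%C * (hdot (centered u n k) x * (hdot (centered u n l) y)^*) *
      expi ((h + l%:Z - k%:Z)%:~R * t).
  rewrite periodogram_hdot dft_hdot !mulr_sumr; apply: eq_bigr => k _.
  rewrite dft_hdotC mulr_suml mulr_sumr; apply: eq_bigr => l _ /=.
  rewrite intrB intrD mulrBl mulrDl !expiD -sqrt_invM mulNr.
  by ring.
under [in LHS]eq_fun do rewrite E.
rewrite cint_Leb_double_sum mulr_sumr; apply: eq_bigr => k _.
by rewrite mulr_sumr; apply: eq_bigr => l _; rewrite -mulrA [X in _ * X]mulrC.
Qed.

End periodograms.

Section periodogram_coefficients.
Context {R : realType} {H : hilbertType R}.
Variables (u : int -> H) (S : set H) (A : int -> H -> R[i]) (V : int -> H -> H -> R[i]).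
Hypothesis uA : forall h x, S x ->
  ccvg (average (fun m => hdot (u (m.+1%:Z + h)) x)) (A h x).
Hypothesis uV : forall h x y, S x -> S y ->
  ccvg (average (fun m => hdot (u (m.+1%:Z + h)) x * (hdot (u m.+1%:Z) y)^*)) (V h x y).

Let uA0 x : S x -> ccvg (average (fun m => hdot (u m.+1%:Z) x)) (A 0 x).
Proof.
move=> Sx; have -> : (fun m => hdot (u m.+1%:Z) x) = fun m => hdot (u (m.+1%:Z + 0)) x.
  by apply/funext => m; rewrite addr0.
exact: uA.
Qed.

Let mean n x := average (fun m => hdot (u m.+1%:Z) x) n.

Lemma hdot_centered n k x : hdot (centered u n k) x = hdot (u k%:Z) x - mean n x.
Proof.
rewrite /centered hdotBl hdotZl hdot_suml natVC /mean /average; congr (_ - _ * _).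
by rewrite big_add1 /= big_mkord.
Qed.

(** The sign of the frequency decides which factor carries the lag: x here, y for negative
    frequencies. Treating them apart keeps the window length n - p a natural number. *)
Lemma periodogram_coef_lag n p x y :
  complex_integral (@Leb_torus R)
    (fun t => expi (p%:Z%:~R * t) * hdot (periodogram u n t y) x) =
  (n%:R^-1)%:C%C * \sum_(l < n - p)
    (hdot (u (l.+1%:Z + p%:Z)) x - mean n x) * ((hdot (u l.+1%:Z) y)^* - (mean n y)^*).
Proof.
rewrite periodogram_coef; congr (_ * _).
rewrite -(sum_lag n p (fun k l => (hdot (u k%:Z) x - mean n x) * ((hdot (u l%:Z) y)^* - (mean n y)^*))).
apply: eq_bigr => k _; apply: eq_bigr => l _.
by rewrite subr_eq0 eq_sym addrC -PoszD eqz_nat !hdot_centered rmorphB.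
Qed.

Lemma periodogram_coef_lead n p x y :
  complex_integral (@Leb_torus R)
    (fun t => expi ((- p%:Z)%:~R * t) * hdot (periodogram u n t y) x) =
  (n%:R^-1)%:C%C * \sum_(l < n - p)
    (hdot (u l.+1%:Z) x - mean n x) * ((hdot (u (l.+1%:Z + p%:Z)) y)^* - (mean n y)^*).
Proof.
rewrite periodogram_coef; congr (_ * _).
rewrite -(sum_lag n p (fun l k => (hdot (u k%:Z) x - mean n x) * ((hdot (u l%:Z) y)^* - (mean n y)^*))).
rewrite exchange_big /=; apply: eq_bigr => k _; apply: eq_bigr => l _.
rewrite [- _ + _]addrC subr_eq0 subr_eq addrC -PoszD eqz_nat !hdot_centered rmorphB.
by rewrite addnC.
Qed.

Lemma periodogram_coef_cvg h x y : S x -> S y ->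
  ccvg (fun n => complex_integral (@Leb_torus R)
    (fun t => expi (h%:~R * t) * hdot (periodogram u n t y) x)) (V h x y - A h x * (A 0 y)^*).
Proof.
move=> Sx Sy; have avgJ (z : nat -> R[i]) n : average (fun m => (z m)^*) n = (average z n)^*.
  by rewrite /average rmorphM /= conjR rmorph_sum.
have hJ : ccvg (average (fun m => (hdot (u m.+1%:Z) y)^*)) (A 0 y)^*.
  rewrite (_ : average _ = fun n => (average (fun m => hdot (u m.+1%:Z) y) n)^*).
    exact: ccvgJ (uA0 Sy).
  by apply/funext => n; exact: avgJ.
have [p hp] : exists p : nat, h = p%:Z \/ h = - p%:Z.
  by case: h => p; [exists p; left|exists p.+1; right; rewrite NegzE].
have h1 := uA h Sx; have h2 := uV h Sx Sy.
case: hp h1 h2 => -> h1 h2.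
- under eq_fun do rewrite periodogram_coef_lag.
  apply: (@average_covariance _ (fun l => hdot (u (l.+1%:Z + p%:Z)) x)
    (fun l => (hdot (u l.+1%:Z) y)^*) p _ _ _ _ (A 0 x)).
  + by have := average_window p 0 h2; under eq_fun do under eq_bigr do rewrite addn0.
  + by have := average_window p 0 h1; under eq_fun do under eq_bigr do rewrite addn0.
  + by have := average_window p 0 hJ; under eq_fun do under eq_bigr do rewrite addn0.
  + exact: uA0.
  + exact: ccvgJ (uA0 Sy).
- under eq_fun do rewrite periodogram_coef_lead.
  (* A window starting at p turns averages at lag - p into averages of x at time l against y at time
     l + p. *)
  have E (k : nat) : (k + p).+1%:Z - p%:Z = k.+1%:Z by rewrite -addSn PoszD addrK.
  apply: (@average_covariance _ (fun l => hdot (u l.+1%:Z) x)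
    (fun l => (hdot (u (l.+1%:Z + p%:Z)) y)^*) p _ _ _ _ (A 0 x)).
  + have := average_window p p h2.
    by under eq_fun do under eq_bigr do rewrite E -addSn PoszD.
  + by have := average_window p p h1; under eq_fun do under eq_bigr do rewrite E.
  + have := average_window p p hJ.
    by under eq_fun do under eq_bigr do rewrite -addSn PoszD.
  + exact: uA0.
  + exact: ccvgJ (uA0 Sy).
Qed.

End periodogram_coefficients.

Section dense_coefficients.
Context {R : realType} {H : hilbertType R}.
Variables (mu_ : nat -> {finite_measure set R -> \bar R}) (F_ : nat -> R -> H -> H).
Variables (mu : {finite_measure set R -> \bar R}) (F : R -> H -> H) (M : R).
Hypotheses (M0 : 0 <= M) (adm_ : forall n, admissible (mu_ n) (F_ n) M)
  (adm : admissible mu F M).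

Let coef (m : {finite_measure set R -> \bar R}) (G : R -> H -> H) (h : int) x y :=
  complex_integral m (fun t => expi (h%:~R * t) * hdot (G t y) x).

(** A Fourier coefficient becomes a form of bounded continuous functions, so the bound by M applies
    to it. *)
Lemma coef_form m G h x y : (forall t, linear (G t)) ->
  coef m G h x y = form m G (fun=> x) (fun t => expi (h%:~R * t) *: y).
Proof.
by move=> lG; congr complex_integral; apply/funext => t; rewrite (linZ (lG t)) hdotZl.
Qed.

Lemma coef_dense (S : set H) h : dense S ->
  (forall x y, S x -> S y -> ccvg (fun n => coef (mu_ n) (F_ n) h x y) (coef mu F h x y)) ->
  forall x y, ccvg (fun n => coef (mu_ n) (F_ n) h x y) (coef mu F h x y).
Proof.
move=> dS cS x y e e0.
pose C := M * (hnorm x + 1 + (hnorm y + 1)).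
have C0 : 0 <= C by rewrite mulr_ge0// !addr_ge0 ?hnorm_ge0.
have C1 : 0 < C + 1 by rewrite ltr_wpDl.
pose d := Num.min 1 (e / 3 / (C + 1)).
have d0 : 0 < d by rewrite lt_min ltr01 !divr_gt0.
have dC : d * C < e / 3.
  rewrite (@lt_le_trans _ _ (d * (C + 1)))// ?ltr_pM2l ?ltrDl//.
  by rewrite -ler_pdivlMr// ge_min lexx orbT.
have [x' Sx' xx'] := dense_hnorm x dS d0.
have [y' Sy' yy'] := dense_hnorm y dS d0.
have diff m G : admissible m G M -> cnorm (coef m G h x y - coef m G h x' y') < e / 3.
  move=> admG; rewrite !coef_form; [|exact: admG.1|exact: admG.1].
  apply: le_lt_trans dC.
  have x1 : 0 < hnorm x + 1 by rewrite ltr_wpDl ?hnorm_ge0.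
  have y1 : 0 < hnorm y + 1 by rewrite ltr_wpDl ?hnorm_ge0.
  have -> : d * C = M * (d * (hnorm y + 1) + (hnorm x + 1) * d) by rewrite /C; ring.
  apply: (form_diff admG M0) => //; try exact: hcontinuous_cst; try exact: hcontinuous_expi.
  - move=> t; rewrite -(subrK x x') (le_trans (hnormD _ _))// addrC lerD2l.
    by rewrite hnorm_distC ltW// (lt_le_trans xx')// ge_min lexx.
  - by move=> t; rewrite hnormZ cnorm_expi mul1r lerDl.
  - by move=> t; exact: ltW.
  - by move=> t; rewrite -scalerBr hnormZ cnorm_expi mul1r ltW.
have e3 : 0 < e / 3 by rewrite divr_gt0.
apply: filterS (cS _ _ Sx' Sy' _ e3) => n hn.
have g1 := diff _ _ (adm_ n); have := diff _ _ adm; rewrite cnorm_distC.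
move: g1 hn; set a := coef _ _ _ _ _; set a' := coef _ _ _ _ _; set b' := coef _ _ _ _ _.
set b := coef _ _ _ _ _ => g1 g2 g3.
have -> : a - b = (a - a') + ((a' - b') + (b' - b)) by ring.
rewrite (le_lt_trans (cnormD _ _))// (le_lt_trans (lerD (lexx _) (cnormD _ _)))//.
rewrite [ltRHS](_ : e = e / 3 + (e / 3 + e / 3)); last by field.
by rewrite ltrD// ltrD.
Qed.

End dense_coefficients.

(** * Sample moments of stationary ergodic processes *)

Section measurable_hilbert_maps.
Context {R : realType} {H : hilbertType R} {d} {T : measurableType d}.
Variable Z : T -> H.
Hypothesis mZ : forall U : set H, open U -> measurable (Z @^-1` U).

(** Open intervals generate the Borel sets of the line, and their preimages under a continuous phi
    are open, which is what [mZ] controls. *)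
Lemma hmeasurable_comp (phi : H -> R) :
  (forall (x : H) (e : R), 0 < e -> \forall y \near x, `|phi y - phi x| < e) ->
  measurable_fun setT (fun t => phi (Z t)).
Proof.
move=> cphi; have cont : continuous phi.
  move=> x; apply/cvgrPdist_lt => e e0.
  by apply: filterS (cphi x e e0) => y; rewrite distrC.
apply: (measurability _ (RGenOpens.measurableE R)) => _ [_ [a [b ->] <-]].
rewrite setTI; apply: (mZ (U := phi @^-1` `]a, b[%classic)).
by move/continuousP : cont; apply; exact: interval_open.
Qed.

Lemma hmeasurable_hdot x : cmeasurable (fun t => hdot (Z t) x).
Proof.
have near z (e : R) : 0 < e -> \forall y \near z, cnorm (hdot y x - hdot z x) < e.
  move=> e0; have d0 : 0 < e / (hnorm x + 1) by rewrite divr_gt0// ltr_wpDl ?hnorm_ge0.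
  apply/nbhs_hnormP; exists (e / (hnorm x + 1)) => // y zy /=.
  rewrite -hdotBl (le_lt_trans (hdot_le _ _))// hnorm_distC.
  have x1 : 0 < hnorm x + 1 by rewrite ltr_wpDl ?hnorm_ge0.
  rewrite (@le_lt_trans _ _ (e / (hnorm x + 1) * hnorm x))//.
    by rewrite ler_wpM2r ?hnorm_ge0// ltW.
  by rewrite mulrAC ltr_pdivrMr// ltr_pM2l// ltrDl.
split.
- apply: (hmeasurable_comp (phi := fun z => complex.Re (hdot z x))) => z e e0.
  apply: filterS (near z e e0) => y; rewrite -ReB; exact: le_lt_trans (Re_le_cnorm _).
- apply: (hmeasurable_comp (phi := fun z => complex.Im (hdot z x))) => z e e0.
  apply: filterS (near z e e0) => y; rewrite -ImB; exact: le_lt_trans (Im_le_cnorm _).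
Qed.

Lemma hmeasurable_hnorm : measurable_fun setT (fun t => hnorm (Z t)).
Proof.
apply: hmeasurable_comp => z e e0; apply/nbhs_hnormP; exists e => // y zy /=.
by rewrite (le_lt_trans (hnorm_distD _ _))// hnorm_distC.
Qed.

End measurable_hilbert_maps.

(** * The path space and its shift *)

Section path_space.
Context {R : realType} {H : hilbertType R}.

(** The same generators as in [path_sigma_algebra], so that stationarity and ergodicity apply as
    they stand to the measurable sets of [path_space]. *)
Definition cylinders : set (set (int -> H)) :=
  [set A | exists t (U : set H), open U /\ A = [set x | U (x t)]].

Definition path_space := g_sigma_algebraType cylinders.

Lemma measurable_coordinate t (U : set H) : open U ->
  measurable ((fun x : path_space => x t) @^-1` U).
Proof. by move=> oU; apply: sub_sigma_algebra; exists t, U. Qed.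

Lemma measurable_path_shift : measurable_fun setT (path_shift : path_space -> path_space).
Proof.
apply: (measurability _ (erefl : @measurable _ path_space = <<s cylinders >>)).
move=> _ [_ [t [U [oU ->]] <-]]; rewrite setTI.
exact: (measurable_coordinate (t + 1) oU).
Qed.

Lemma iter_path_shift m (x : int -> H) t : iter m path_shift x t = x (t + m%:Z).
Proof.
elim: m t => [|m IH] t; first by rewrite addr0.
by rewrite iterS /path_shift IH -addrA -PoszD addnC addn1.
Qed.

Context {d} {Om : measurableType d} (P : probability Om R) (X : int -> Om -> H).
Hypothesis X_process : process X.

Definition sample_path (w : Om) : path_space := X ^~ w.

Lemma measurable_sample_path : measurable_fun setT sample_path.
Proof.
apply: (measurability _ (erefl : @measurable _ path_space = <<s cylinders >>)).
move=> _ [_ [t [U [oU ->]] <-]]; rewrite setTI; exact: X_process.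
Qed.

Hypotheses (X_stationary : strictly_stationary P X) (X_ergodic : ergodic P X).

(** The sample space carries no shift. The ergodic theorem is applied to the law of the path, and
    its null set is pulled back along [sample_path]. *)
Lemma sample_path_birkhoff (g : path_space -> R) : measurable_fun setT g ->
  P.-integrable setT (EFin \o (g \o sample_path)) ->
  {ae P, forall w, (\sum_(k < n) g (iter k path_shift (sample_path w))) / n%:R @[n --> \oo]
    --> Rintegral P setT (g \o sample_path)}.
Proof.
move=> mg ig.
pose Xm : {mfun Om >-> path_space} := mfun_Sub (mem_set measurable_sample_path).
pose Q := distribution P Xm.
have QE A : measurable A -> Q A = P (sample_path @^-1` A) by [].
have iQ : Q.-integrable setT (EFin \o g).
  by apply/(integrable_transfer measurable_sample_path QE mg).
rewrite -(Rintegral_transfer measurable_sample_path QE mg iQ).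
have tauP A : measurable A -> Q A = Q (path_shift @^-1` A).
  by move=> mA; apply: esym; exact: X_stationary.
have erg (A : set path_space) : measurable A -> path_shift @^-1` A = A -> Q A = 0%E \/ Q A = 1%E.
  exact: X_ergodic.
exact: (ae_transfer measurable_sample_path QE (birkhoff measurable_path_shift tauP erg iQ)).
Qed.

Lemma sample_path_average (g : path_space -> R[i]) : cmeasurable g ->
  cintegrable P (fun w => g (sample_path w)) ->
  {ae P, forall w, ccvg (average (fun k => g (iter k path_shift (sample_path w))))
    (complex_integral P (fun w => g (sample_path w)))}.
Proof.
move=> [m1 m2] [i1 i2].
apply: filterS2 (sample_path_birkhoff m1 i1) (sample_path_birkhoff m2 i2) => w h1 h2.
apply: ccvg_ReIm.
- rewrite (_ : (fun n => complex.Re _) = (fun n => (\sum_(k < n)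
    complex.Re (g (iter k path_shift (sample_path w)))) / n%:R)); first exact: h1.
  by apply/funext => n; rewrite /average ReM /= mul0r subr0 Re_sum mulrC.
- rewrite (_ : (fun n => complex.Im _) = (fun n => (\sum_(k < n)
    complex.Im (g (iter k path_shift (sample_path w)))) / n%:R)); first exact: h2.
  by apply/funext => n; rewrite /average ImM /= mul0r addr0 Im_sum mulrC.
Qed.

End path_space.

Section integral_conjugation.
Context {R : realType} {d} {T : measurableType d} (mu : {measure set T -> \bar R}).

Lemma cintJ (F : T -> R[i]) : cintegrable mu F ->
  cintegrable mu (fun t => (F t)^*) /\
  complex_integral mu (fun t => (F t)^*) = (complex_integral mu F)^*.
Proof.
move=> [i1 i2].
have [i3 E] := Rintegral_linear (-1) 0 i2 i2.
have EI : (fun t => complex.Im (F t)^*) =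
    (fun t => -1 * complex.Im (F t) + 0 * complex.Im (F t)).
  by apply/funext => t; rewrite ImJ mulN1r mul0r addr0.
have ER : (fun t => complex.Re (F t)^*) = (fun t => complex.Re (F t)).
  by apply/funext => t; rewrite ReJ.
split; first by split; rewrite ?ER ?EI.
apply: complex_eq; first by rewrite /= ER.
rewrite [LHS]/= EI E mulN1r mul0r addr0 ImJ //.
Qed.

End integral_conjugation.

Lemma cint_cst {R : realType} {d} {T : measurableType d} (P : probability T R) (c : R[i]) :
  cintegrable P (fun=> c) /\ complex_integral P (fun=> c) = c.
Proof.
split; first by split; exact: integrable_cst_fin.
have P1 : fine (P setT) = 1 by exact: (congr1 fine (probability_setT P)).
have E (a : R) : Rintegral P setT (fun=> a) = a.
  by apply: etrans; first exact: Rintegral_cst; rewrite P1 mulr1.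
by apply: complex_eq; rewrite /= E.
Qed.

(** * Moments and covariance operators *)

Section second_order_processes.
Context {R : realType} {H : hilbertType R} {d} {Om : measurableType d} (P : probability Om R).
Variable X : int -> Om -> H.
Hypothesis X_process : process X.
Hypothesis X_L2 : forall t, (\int[P]_w ((hnorm (X t w)) ^+ 2)%:E < +oo)%E.

Lemma measurable_sqr_norm t : measurable_fun setT (fun w => hnorm (X t w) ^+ 2).
Proof. by apply: measurable_funX; exact: hmeasurable_hnorm (X_process t). Qed.

Lemma integrable_sqr_norm t : P.-integrable setT (EFin \o (fun w => hnorm (X t w) ^+ 2)).
Proof.
apply/integrableP; split; first exact/measurable_EFinP/measurable_sqr_norm.
rewrite (eq_integral (fun w => (hnorm (X t w) ^+ 2)%:E))//.
by move=> w _ /=; rewrite ger0_norm// sqr_ge0.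
Qed.

(** One integrable majorant for first and second moments, from a <= 2 a^2 + 1 and a b <= a^2 + b^2 +
    1; c carries the dependence on the test vectors. *)
Let bound (t s : int) (c : R) w := c * (hnorm (X t w) ^+ 2 + hnorm (X s w) ^+ 2 + 1).

Let integrable_bound t s c : P.-integrable setT (EFin \o bound t s c).
Proof.
have i := integrableD measurableT (integrable_sqr_norm t) (integrable_sqr_norm s).
exact: (integrableZl measurableT c (integrableD measurableT i (integrable_cst_fin P 1))).
Qed.

Definition moment1 t x := complex_integral P (fun w => hdot (X t w) x).

Definition moment2 t s x y :=
  complex_integral P (fun w => hdot (X t w) x * (hdot (X s w) y)^*).

Let hdot_bound t x w : cnorm (hdot (X t w) x) <= bound t t (hnorm x) w.
Proof.
rewrite (le_trans (hdot_le _ _))// mulrC ler_wpM2l ?hnorm_ge0//.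
have := sqr_ge0 (hnorm (X t w) - 1); move: (hnorm (X t w)) (hnorm_ge0 (X t w)) => a a0 h.
nra.
Qed.

Let hdot2_bound t s x y w : cnorm (hdot (X t w) x * (hdot (X s w) y)^*) <=
  bound t s (hnorm x * hnorm y) w.
Proof.
rewrite cnormM cnormJ (le_trans (ler_pM _ _ (hdot_le _ _) (hdot_le _ _))) ?cnorm_ge0//.
rewrite mulrACA mulrC ler_wpM2l ?mulr_ge0 ?hnorm_ge0//.
move: (hnorm (X t w)) (hnorm_ge0 (X t w)) (hnorm (X s w)) (hnorm_ge0 (X s w)) => a a0 b b0.
have := sqr_ge0 (a - b); nra.
Qed.

Lemma cintegrable_hdot t x : cintegrable P (fun w => hdot (X t w) x).
Proof.
exact: cintegrable_dom (hmeasurable_hdot (X_process t) x) (integrable_bound t t (hnorm x)) (hdot_bound t x).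
Qed.

Lemma cintegrable_hdot2 t s x y : cintegrable P (fun w => hdot (X t w) x * (hdot (X s w) y)^*).
Proof.
apply: cintegrable_dom (integrable_bound t s (hnorm x * hnorm y)) (hdot2_bound t s x y).
apply: cmeasurableM; first exact: (hmeasurable_hdot (X_process t) x).
by apply: cmeasurableJ; exact: (hmeasurable_hdot (X_process s) y).
Qed.

Let mass t s := Rintegral P setT (bound t s 1).

Let Rintegral_bound t s c : Rintegral P setT (bound t s c) = c * mass t s.
Proof.
have -> : bound t s c = (fun w => c * bound t s 1 w).
  by apply/funext => w; rewrite /bound mul1r.
by rewrite RintegralZl; [|exact: measurableT|exact: integrable_bound].
Qed.

Lemma moment1_le t : exists2 K : R, 0 <= K & forall x, cnorm (moment1 t x) <= K * hnorm x.
Proof.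
exists (2 * mass t t) => [|x].
  rewrite mulr_ge0//; apply: Rintegral_ge0 => w _.
  by rewrite /bound mul1r !addr_ge0 ?sqr_ge0.
rewrite (le_trans (cint_le (cintegrable_hdot t x) (integrable_bound t t (hnorm x)) (hdot_bound t x)))//.
by rewrite Rintegral_bound -mulrA [_ * hnorm x]mulrC.
Qed.

Lemma moment2_le t s : exists2 K : R, 0 <= K &
  forall x y, cnorm (moment2 t s x y) <= K * (hnorm x * hnorm y).
Proof.
exists (2 * mass t s) => [|x y].
  rewrite mulr_ge0//; apply: Rintegral_ge0 => w _.
  by rewrite /bound mul1r !addr_ge0 ?sqr_ge0.
rewrite (le_trans (cint_le (cintegrable_hdot2 t s x y) (integrable_bound t s _) (hdot2_bound t s x y)))//.
by rewrite Rintegral_bound -[leRHS]mulrA [mass t s * _]mulrC.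
Qed.

Lemma moment1_linear t a x y : moment1 t (a *: x + y) = a^* * moment1 t x + moment1 t y.
Proof.
rewrite /moment1 -cintZ; last exact: cintegrable_hdot.
rewrite -cintD; [|by apply: cintegrableZ; exact: cintegrable_hdot|exact: cintegrable_hdot].
by congr complex_integral; apply/funext => w; rewrite hdotDr hdotZr.
Qed.

Lemma moment2_linearl t s a x x' y :
  moment2 t s (a *: x + x') y = a^* * moment2 t s x y + moment2 t s x' y.
Proof.
rewrite /moment2 -cintZ; last exact: cintegrable_hdot2.
rewrite -cintD; [|by apply: cintegrableZ; exact: cintegrable_hdot2|exact: cintegrable_hdot2].
by congr complex_integral; apply/funext => w; rewrite hdotDr hdotZr mulrDl mulrA.
Qed.

Lemma moment2_linearr t s a x y y' :
  moment2 t s x (a *: y + y') = a * moment2 t s x y + moment2 t s x y'.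
Proof.
rewrite /moment2 -cintZ; last exact: cintegrable_hdot2.
rewrite -cintD; [|by apply: cintegrableZ; exact: cintegrable_hdot2|exact: cintegrable_hdot2].
congr complex_integral; apply/funext => w.
by rewrite hdotDr hdotZr rmorphD rmorphM /= conjCK mulrDr mulrCA.
Qed.

Lemma complex_cov_moments t s x y :
  complex_cov P (fun w => hdot (X t w) x) (fun w => hdot (X s w) y) =
  moment2 t s x y - moment1 t x * (moment1 s y)^*.
Proof.
rewrite /complex_cov -/(moment1 t x) -/(moment1 s y).
set a := moment1 t x; set b := moment1 s y.
have i1 := cintegrable_hdot2 t s x y.
have i2 := cintegrableZ (b^*) (cintegrable_hdot t x).
have [j3 e3] := cintJ (cintegrable_hdot s y).
have i3 := cintegrableZ a j3.
have [i4 e4] := cint_cst P (a * b^*).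
have -> : (fun w => (hdot (X t w) x - a) * (hdot (X s w) y - b)^*) = (fun w =>
    hdot (X t w) x * (hdot (X s w) y)^* - b^* * hdot (X t w) x
    - a * (hdot (X s w) y)^* + a * b^*).
  by apply/funext => w; rewrite rmorphB; ring.
rewrite (cintD (cintegrableB (cintegrableB i1 i2) i3) i4) (cintB (cintegrableB i1 i2) i3).
rewrite (cintB i1 i2) (cintZ _ (cintegrable_hdot t x)) (cintZ a j3) e3 e4.
by rewrite -/(moment2 t s x y) -/(moment1 t x) -/(moment1 s y) -/a -/b; ring.
Qed.

(** [cov_op] is a choice with a default, so an operator with the required form has to be exhibited;
    the moment bounds allow Riesz to construct it. *)
Lemma cov_op_moments t s x y : hdot (cov_op P (X t) (X s) y) x =
  moment2 t s x y - moment1 t x * (moment1 s y)^*.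
Proof.
pose c x y := moment2 t s x y - moment1 t x * (moment1 s y)^*.
have [K1 K10 h1] := moment1_le t; have [K2 K20 h2] := moment1_le s.
have [K K0 h] := moment2_le t s.
have cle x' y' : cnorm (c x' y') <= (K + K1 * K2) * hnorm y' * hnorm x'.
  rewrite /c (le_trans (cnormB _ _))// mulrDl mulrDl lerD//.
    by rewrite (le_trans (h _ _))// [hnorm x' * _]mulrC mulrA.
  rewrite cnormM cnormJ (le_trans (ler_pM _ _ (h1 _) (h2 _))) ?cnorm_ge0//.
  by rewrite mulrACA -!mulrA [hnorm x' * _]mulrC.
(* c is antilinear in its first argument, so Riesz is applied to its conjugate. *)
have /choice[C CP] (y' : H) : exists z, forall x', (c x' y')^* = hdot x' z.
  apply: (@riesz _ _ (fun x' => (c x' y')^*) ((K + K1 * K2) * hnorm y')) => [a u v|x'].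
    rewrite /c moment2_linearl moment1_linear !(rmorphB, rmorphD, rmorphM, conjCK) /=.
    rewrite !(rmorphD, rmorphM, conjCK) /=; ring.
  by rewrite cnormJ.
have CE y' x' : hdot (C y') x' = c x' y' by rewrite hdotC -CP conjCK.
have bC : bounded_op C.
  apply/bounded_opP; split.
    move=> a u v; apply: hdot_eq => z; rewrite hdotDl hdotZl !CE /c.
    by rewrite moment2_linearr moment1_linear rmorphD rmorphM /= conjCK; ring.
  exists (K + K1 * K2) => [|z]; first by rewrite addr_ge0 ?mulr_ge0.
  (* The bound on the form is tested at C z itself and divided by |C z|. *)
  have [z0|z0] := eqVneq (hnorm (C z)) 0.
    by rewrite z0 !mulr_ge0 ?addr_ge0 ?mulr_ge0 ?hnorm_ge0.
  have zp : 0 < hnorm (C z) by rewrite lt_neqAle eq_sym z0 hnorm_ge0.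
  rewrite -(ler_pM2r zp) -expr2 (le_trans _ (cle _ _))// -CE hdotxx cnormR.
  by rewrite ger0_norm ?sqr_ge0.
have := @xgetPex _ (0 : H -> H) [set C : H -> H | bounded_op C /\ forall x y,
  hdot (C y) x = complex_cov P (fun w => hdot (X t w) x) (fun w => hdot (X s w) y)].
move=> /(_ _)[|_ ->]; last by rewrite complex_cov_moments.
by exists C; split=> // x' y'; rewrite CE complex_cov_moments.
Qed.

End second_order_processes.

Lemma cvg_nonneg_bounded {R : realType} (s : nat -> R) (l : R) : (forall n, 0 <= s n) ->
  s n @[n --> \oo] --> l -> exists2 K : R, 0 <= K & forall n, s n <= K.
Proof.
move=> s0 /cvgrPdist_lt /(_ 1 ltr01)[N _ hN].
(* From N on the terms are at most |l| + 1; each earlier term is at most the sum of all earlier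
   ones. *)
exists (`|l| + 1 + \sum_(k < N) s k) => [|n].
  by rewrite !addr_ge0// sumr_ge0.
have [nN|Nn] := ltnP n N.
  rewrite (bigD1 (Ordinal nN)) //= addrCA lerDl !addr_ge0//.
  by rewrite sumr_ge0.
rewrite (@le_trans _ _ (`|l| + 1))//; last by rewrite lerDl sumr_ge0.
have := hN n Nn; rewrite /= distrC => h; rewrite -lerBlDl (le_trans _ (ltW h))//.
by rewrite (le_trans _ (ler_norm _))// lerB// ler_norm.
Qed.

(** * Almost sure limits of sample moments *)

Section sample_moments.
Context {R : realType} {H : hilbertType R} {d} {Om : measurableType d} (P : probability Om R).
Variable X : int -> Om -> H.
Hypotheses (X_process : process X) (X_stationary : strictly_stationary P X)
  (X_ergodic : ergodic P X)
  (X_L2 : forall t, (\int[P]_w ((hnorm (X t w)) ^+ 2)%:E < +oo)%E).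

(** Birkhoff averages start at time 0, samples at time 1. *)
Let average_shift (z : nat -> R[i]) a : ccvg (average z) a -> ccvg (average (fun m => z m.+1)) a.
Proof.
move=> /(average_window 0 1); congr ccvg; apply/funext => n.
by rewrite /average subn0; congr (_ * _); apply: eq_bigr => k _; rewrite addn1.
Qed.

Lemma sample_moment1_cvg h x : {ae P, forall w,
  ccvg (average (fun m => hdot (X (m.+1%:Z + h) w) x)) (moment1 P X h x)}.
Proof.
have mg := hmeasurable_hdot (measurable_coordinate h) x.
apply: filterS (sample_path_average X_process X_stationary X_ergodic mg (cintegrable_hdot X_process X_L2 h x)) => w hw.
move: (average_shift hw); congr ccvg; congr average; apply/funext => m.
by rewrite iter_path_shift addrC.
Qed.

Lemma sample_moment2_cvg h x y : {ae P, forall w,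
  ccvg (average (fun m => hdot (X (m.+1%:Z + h) w) x * (hdot (X m.+1%:Z w) y)^*))
    (moment2 P X h 0 x y)}.
Proof.
have mg : cmeasurable (fun p : path_space => hdot (p h) x * (hdot (p 0) y)^*).
  apply: cmeasurableM; first exact: hmeasurable_hdot (measurable_coordinate h) x.
  by apply: cmeasurableJ; exact: hmeasurable_hdot (measurable_coordinate 0) y.
apply: filterS (sample_path_average X_process X_stationary X_ergodic mg
  (cintegrable_hdot2 X_process X_L2 h 0 x y)) => w hw.
move: (average_shift hw); congr ccvg; congr average; apply/funext => m.
by rewrite !iter_path_shift addrC add0r.
Qed.

Lemma sample_sqr_norm_bounded : {ae P, forall w, exists2 K : R, 0 <= K & forall n,
  n%:R^-1 * \sum_(1 <= k < n.+1) hnorm (X k%:Z w) ^+ 2 <= K}.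
Proof.
(* Reading coordinate 1 makes the k-th iterate yield time k + 1, in agreement with sums that start
   at 1. *)
have mg : measurable_fun setT (fun p : @path_space R H => hnorm (p 1) ^+ 2).
  by apply: measurable_funX; exact: hmeasurable_hnorm (measurable_coordinate 1).
apply: filterS (sample_path_birkhoff X_process X_stationary X_ergodic mg
  (integrable_sqr_norm X_process X_L2 1)) => w hw.
have E n : n%:R^-1 * \sum_(1 <= k < n.+1) hnorm (X k%:Z w) ^+ 2 =
    (\sum_(k < n) hnorm (iter k path_shift (sample_path X w) 1) ^+ 2) / n%:R.
  rewrite mulrC; congr (_ / _); rewrite big_add1 /= big_mkord; apply: eq_bigr => k _.
  by rewrite iter_path_shift -[1%R]/(1%:Z) -PoszD add1n.
have [|K K0 hK] := cvg_nonneg_bounded _ hw.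
  by move=> n; rewrite divr_ge0// sumr_ge0// => k _; rewrite sqr_ge0.
by exists K => // n; rewrite E.
Qed.

Lemma sample_moments_cvg (S : set H) : countable S -> {ae P, forall w,
  [/\ forall h x, S x ->
        ccvg (average (fun m => hdot (X (m.+1%:Z + h) w) x)) (moment1 P X h x),
      forall h x y, S x -> S y ->
        ccvg (average (fun m => hdot (X (m.+1%:Z + h) w) x * (hdot (X m.+1%:Z w) y)^*))
          (moment2 P X h 0 x y) &
      exists2 K : R, 0 <= K & forall n,
        n%:R^-1 * \sum_(1 <= k < n.+1) hnorm (X k%:Z w) ^+ 2 <= K]}.
Proof.
move=> cS; have cZ : countable [set: int] by exact: countableP.
apply: filterS3 (ae_forall_countable cZ (fun h _ => ae_forall_countable cS
    (fun x _ => sample_moment1_cvg h x)))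
  (ae_forall_countable cZ (fun h _ => ae_forall_countable cS
    (fun x _ => ae_forall_countable cS (fun y _ => sample_moment2_cvg h x y))))
  sample_sqr_norm_bounded => w h1 h2 h3; split=> //.
- by move=> h x Sx; exact: h1.
- by move=> h x y Sx Sy; exact: h2.
Qed.

End sample_moments.

Lemma admissible_le {R : realType} {H : hilbertType R} (mu : {finite_measure set R -> \bar R})
    (F : R -> H -> H) (M M' : R) : M <= M' -> admissible mu F M -> admissible mu F M'.
Proof.
move=> MM [lF adm]; split=> // u v a b cu cv a0 b0 ua vb.
have [i h] := adm u v a b cu cv a0 b0 ua vb; split=> //.
by rewrite (le_trans h)// ler_wpM2r// mulr_ge0// ltW.
Qed.

Theorem theorem4p2 (R : realType) (H0 G0 : hilbertType R)
    (H0_separable : separable H0) (G0_findim : finite_dimensional G0)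
    (d : measure_display) (Om : measurableType d) (P : probability Om R)
    (X : int -> Om -> H0)
    (X_process : process X)
    (X_stationary : strictly_stationary P X)
    (X_ergodic : ergodic P X)
    (X_weakly_stationary : weakly_stationary P X)
    (nu : set R -> H0 -> H0)
    (nu_spectral : spectral_operator_measure P X nu)
    (norm_nu : {finite_measure set R -> \bar R})
    (norm_nuE : forall A : set R, measurable A -> norm_nu A = trace_norm (nu A))
    (f : R -> H0 -> H0)
    (f_density : operator_density nu norm_nu f)
    (Theta : metricType R) (Theta_compact : compact [set: Theta])
    (Lf Rf : Theta -> R -> H0 -> G0)
    (Lf_continuous : continuous_operator_field Lf)
    (Rf_continuous : continuous_operator_field Rf) :
  {ae P, forall w : Om,
    uniform_cvg_in_C (@trace_norm R G0)
      (fun n : nat =>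
         quadratic_functional Lf Rf Leb_torus (periodogram (X ^~ w) n))
      (quadratic_functional Lf Rf norm_nu f)}.
Proof.
have [S cS dS] := H0_separable.
have [m [g fg]] := orthonormal_frame_exists G0_findim.
have [M M0 adm] := operator_density_admissible f_density.
have [L2 _ _] := X_weakly_stationary.
apply: filterS (sample_moments_cvg X_process X_stationary X_ergodic L2 cS) => w.
move=> [h1 h2 [K K0 hK]].
(* K bounds the sample second moments of this outcome for all n, and [periodogram_admissible]
   doubles it; the maximum is a common constant for the periodograms and the limit. *)
pose M' := Num.max M (2 * K).
have M'0 : 0 <= M' by rewrite le_max M0.
have adm' : admissible norm_nu f M' by apply: admissible_le adm; rewrite le_max lexx.
have adm_ n : admissible (@Leb_torus R) (periodogram (X ^~ w) n) M'.
  apply: admissible_le (periodogram_admissible (X ^~ w) n).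
  by rewrite le_max ler_pM2l// hK orbT.
apply: (quadratic_functional_cvg fg Lf_continuous Rf_continuous
  (mu_ := fun=> @Leb_torus R) Theta_compact M'0 adm_ adm') => h.
apply: (@coef_dense _ _ (fun=> @Leb_torus R) (periodogram (X ^~ w)) norm_nu f M' M'0 adm_ adm' S h dS).
move=> x y Sx Sy.
(* The spectral representation identifies the limit coefficient with <Cov(X_h, X_0) y, x>, written
   with the means at times h and 0 to match the limit of the sample moments. *)
have -> : complex_integral norm_nu (fun t => expi (h%:~R * t) * hdot (f t y) x) =
    moment2 P X h 0 x y - moment1 P X h x * (moment1 P X 0 y)^*.
  rewrite (vector_integral_density f_density (nu_spectral.2 h)) ?cov_op_moments//.
  exact: cintegrable_expi adm.
exact: periodogram_coef_cvg h1 h2 h x y Sx Sy.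
Qed.
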